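(* Let $-1<a,b,\alpha,\beta<+\infty$ with $\beta=\beta_0+m$, $m\in\mathbb N$ and $\beta_0\in\mathcal J_\alpha$. Define two integral operators $A$ and $B$ by $$Af(z)=\frac{1}{z^m}\int_{\mathbb D}\frac{f(w)\,Q_{\alpha,\beta}(z\overline w)\,(1-|w|^2)^{\alpha-a}\,w^m}{|w|^{2m+2b-2\beta}(1-z\overline w)^{2+\alpha}}\,d\mu_{a,b}(w)$$ and $$Bf(z)=\frac{1}{|z|^m}\int_{\mathbb D}\frac{f(w)\,|Q_{\alpha,\beta}(z\overline w)|\,(1-|w|^2)^{\alpha-a}\,|w|^{2\beta-2b-m}}{|1-z\overline w|^{2+\alpha}}\,d\mu_{a,b}(w).$$ Then for $1\le p<+\infty$ the following assertions are equivalent: (1) $A$ is bounded on $L^p(\mathbb D,d\mu_{a,b})$; (2) $B$ is bounded on $L^p(\mathbb D,d\mu_{a,b})$; (3) $p(\alpha+1)>a+1$ and $$\begin{cases} m-2<2b\le 2\beta-m & \text{if } p=1,\\ pm-2<2b<p(2\beta+2)-pm-2 & \text{if } p>1.\end{cases}$$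
   Context: $\mathbb D$ is the open unit disc in $\mathbb C$, $dA$ is the area measure on $\mathbb D$ normalized so that $\mathbb D$ has measure $1$, $\mathrm B(\cdot,\cdot)$ is the Euler beta function, and $\mathbb N=\{0,1,2,\dots\}$. For $-1<a,b<+\infty$, $$d\mu_{a,b}(z)=\frac{1}{\mathrm B(a+1,b+1)}|z|^{2b}(1-|z|^2)^a\,dA(z).$$ Every $\beta>-1$ is written uniquely as $\beta=\beta_0+m$ with $m\in\mathbb N$ and $-1<\beta_0\le 0$. For $\xi\in\mathbb D$, $$Q_{\alpha,\beta}(\xi)=\begin{cases}(\alpha+1)\mathrm B(\alpha+1,\beta+1) & \text{if }\beta\in\mathbb N,\\[4pt] \dfrac{\mathrm B(\alpha+1,\beta+1)}{\mathrm B(\alpha+1,\beta_0+1)}\displaystyle\sum_{n=0}^{+\infty}\frac{\beta_0(-\xi)^n}{n+\beta_0}\binom{\alpha+1}{n} & \text{if }\beta\notin\mathbb N.\end{cases}$$ $\mathcal J_\alpha$ denotes the set of $\beta\in(-1,0]$ such that $Q_{\alpha,\beta}$ has no zero in $\mathbb D$. *)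

(* Defs.v *)
From HB Require Import structures.
From mathcomp Require Import all_boot all_order all_algebra.
From mathcomp Require Import complex.
From mathcomp Require Import all_classical all_reals all_analysis.
From mathcomp Require Import measurable_realfun.
Set Implicit Arguments.
Unset Strict Implicit.
Unset Printing Implicit Defensive.
Import Order.TTheory GRing.Theory Num.Theory.
Import numFieldNormedType.Exports.
Local Open Scope classical_set_scope.
Local Open Scope complex_scope.
Local Open Scope ring_scope.

Section ComplexFunctions.
Variable R : realType.
Implicit Types (u xi : R[i]) (s x y alpha beta : R).

Definition cmod u : R := Normc.normc u.

(* Principal determination, with values in ]-pi, pi]; carg 0 is irrelevant. *)
Definition carg u : R :=
  if 0 <= complex.Im u then acos (complex.Re u / cmod u)
  else - acos (complex.Re u / cmod u).

(* u ^ s for a real exponent s, on the principal branch.  It is only used at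
   u = 1 - z w^* with |z|, |w| < 1, which lies in the right half-plane. *)
Definition cpow u s : R[i] :=
  (cmod u `^ s)%:C * (cos (s * carg u) +i* sin (s * carg u)).

Definition euler_beta x y : R :=
  \int[@lebesgue_measure R]_(t in `]0, 1[) (t `^ (x - 1) * (1 - t) `^ (y - 1)).

Definition gbinom s (n : nat) : R := (\prod_(k < n) (s - k%:R)) / n`!%:R.

(* For beta > -1, the ceiling of beta is the natural number m such that
   beta = beta_0 + m with -1 < beta_0 <= 0 (see beta0_ofE). *)
Definition beta0_of beta : R := beta - (Num.ceil beta)%:~R.

Lemma beta0_ofE (b0 : R) (m : nat) :
  -1 < b0 -> b0 <= 0 -> beta0_of (b0 + m%:R) = b0.
Proof.
move=> b0N1 b00; rewrite /beta0_of.
suff -> : Num.ceil (b0 + m%:R) = m%:Z by rewrite addrK.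
apply: ceil_def; rewrite rmorphB/= -pmulrn.
by rewrite addrC ltrD2r b0N1 gerDr b00.
Qed.

(* R[i]^o carries the norm topology of R[i]. *)
Definition Q_series alpha beta xi : R[i] :=
  limn (series (fun n : nat =>
    ((beta0_of beta)%:C * (- xi) ^+ n / (n%:R + beta0_of beta)%:C
      * (gbinom (alpha + 1) n)%:C : R[i]^o))).

Definition Q alpha beta xi : R[i] :=
  if beta \is a Num.nat then
    ((alpha + 1) * euler_beta (alpha + 1) (beta + 1))%:C
  else
    (euler_beta (alpha + 1) (beta + 1)
       / euler_beta (alpha + 1) (beta0_of beta + 1))%:C
    * Q_series alpha beta xi.

Definition unit_disc : set R[i] := [set u | cmod u < 1].

Definition J_set alpha : set R :=
  [set b0 | -1 < b0 <= 0 /\ forall xi, unit_disc xi -> Q alpha b0 xi <> 0].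

End ComplexFunctions.

(* R * R with its Borel sigma-algebra; R[i] has no measurable structure, so
   functions of a complex variable are functions on the plane, read through
   cplx. *)
Notation plane R := (measurableTypeR R * measurableTypeR R)%type.

Section Disc.
Variable R : realType.

Definition cplx (z : plane R) : R[i] := (z.1 : R) +i* (z.2 : R).

Definition disc : set (plane R) := cplx @^-1` @unit_disc R.

Lemma invpi_ge0 : 0 <= pi^-1 :> R.
Proof. by rewrite invr_ge0 pi_ge0. Qed.

Definition area : {measure set (plane R) -> \bar R} :=
  mscale (NngNum invpi_ge0) (@lebesgue_measure R \x @lebesgue_measure R)%E.

Definition weight (a b : R) (z : plane R) : R :=
  (euler_beta (a + 1) (b + 1))^-1
  * cmod (cplx z) `^ (2 * b) * (1 - cmod (cplx z) ^+ 2) `^ a.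

Lemma measurable_cmod_cplx : measurable_fun setT (fun z => cmod (cplx z)).
Proof.
rewrite (_ : (fun _ => _) =
  (fun z : plane R => Num.sqrt ((z.1 : R) ^+ 2 + (z.2 : R) ^+ 2))) //.
apply: (@measurableT_comp _ _ _ _ _ _ (@Num.sqrt R)).
  by apply: continuous_measurable_fun; exact: sqrt_continuous.
apply: measurable_funD; apply: (@measurableT_comp _ _ _ _ _ _ (fun x : R => x ^+ 2)).
- exact: exprn_measurable.
- exact: measurable_fst.
- exact: exprn_measurable.
- exact: measurable_snd.
Qed.

Lemma measurable_disc : measurable disc.
Proof.
rewrite (_ : disc = setT `&` (fun z => cmod (cplx z)) @^-1` `]-oo, 1[%classic).
  exact: measurable_cmod_cplx.
by rewrite setTI; apply/seteqP; split => z /=; rewrite in_itv.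
Qed.

Lemma measurable_weight (a b : R) : measurable_fun setT (weight a b).
Proof.
apply: measurable_funM; first apply: measurable_funM.
- exact: measurable_cst.
- apply: (@measurableT_comp _ _ _ _ _ _ (fun x : R => x `^ (2 * b))).
    exact: measurable_powR.
  exact: measurable_cmod_cplx.
- apply: (@measurableT_comp _ _ _ _ _ _ (fun x : R => x `^ a)).
    exact: measurable_powR.
  apply: measurable_funB; first exact: measurable_cst.
  apply: (@measurableT_comp _ _ _ _ _ _ (fun x : R => x ^+ 2)).
    exact: exprn_measurable.
  exact: measurable_cmod_cplx.
Qed.

Lemma weight_ge0 (a b : R) z : 0 <= weight a b z.
Proof.
rewrite /weight !mulr_ge0 ?powR_ge0// invr_ge0.
by apply: Rintegral_ge0 => x _; rewrite mulr_ge0 ?powR_ge0.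
Qed.

Definition mu_disc (a b : R) (E : set (plane R)) : \bar R :=
  (\int[area]_(z in E `&` disc) (weight a b z)%:E)%E.

Section mu_disc_measure.
Variables a b : R.

Let mu_disc0 : mu_disc a b set0 = 0%E.
Proof. by rewrite /mu_disc set0I integral_set0. Qed.

Let mu_disc_ge0 E : (0 <= mu_disc a b E)%E.
Proof. by apply: integral_ge0 => z _; rewrite lee_fin weight_ge0. Qed.

Let mu_disc_sigma_additive : semi_sigma_additive (mu_disc a b).
Proof.
move=> /= F mF tF mUF; rewrite /mu_disc setI_bigcupl ge0_integral_bigcup/=.
- apply: is_cvg_ereal_nneg_natsum_cond => n _ _.
  by apply: integral_ge0 => z _; rewrite lee_fin weight_ge0.
- by move=> k; apply: measurableI => //; exact: measurable_disc.
- apply/measurable_EFinP; apply: (measurable_funS measurableT) => //.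
  exact: measurable_weight.
- by move=> z _; rewrite lee_fin weight_ge0.
- exact: trivIset_setIr.
Qed.

HB.instance Definition _ := isMeasure.Build _ _ _
  (mu_disc a b) mu_disc0 mu_disc_ge0 mu_disc_sigma_additive.

End mu_disc_measure.

End Disc.
Arguments disc R : clear implicits.
Arguments area R : clear implicits.

Section ComplexLp.
Variable R : realType.
Variable mu : {measure set (plane R) -> \bar R}.
Implicit Types (f g : plane R -> R[i]) (p : R).

Definition cintegrable f : Prop :=
  mu.-integrable (disc R) (fun z => (complex.Re (f z))%:E) /\
  mu.-integrable (disc R) (fun z => (complex.Im (f z))%:E).

Definition cintegral f : R[i] :=
  (\int[mu]_(z in disc R) complex.Re (f z))
  +i* (\int[mu]_(z in disc R) complex.Im (f z)).

Definition cmeasurable f : Prop :=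
  measurable_fun (disc R) (fun z => complex.Re (f z) : R) /\
  measurable_fun (disc R) (fun z => complex.Im (f z) : R).

Definition Lp_norm p f : \bar R :=
  ('N[mu]_(p%:E)[(fun z => (cmod (f z))%:E) \_ (disc R)])%E.

Definition Lp p : set (plane R -> R[i]) :=
  [set f | cmeasurable f /\ (Lp_norm p f < +oo)%E].

(* Boundedness on L^p of an integral operator T, where dom f z states that the
   integral defining T f z converges absolutely: T f must be defined almost
   everywhere on the disc for every f in L^p, and |T f|_p <= C |f|_p. *)
Definition bounded_on_Lp p (dom : (plane R -> R[i]) -> plane R -> Prop)
    (T : (plane R -> R[i]) -> plane R -> R[i]) : Prop :=
  exists C : R, forall f, Lp p f ->
    [/\ {ae mu, forall z, disc R z -> dom f z},
        Lp p (T f) &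
        (Lp_norm p (T f) <= C%:E * Lp_norm p f)%E].

End ComplexLp.

Section Operators.
Variable R : realType.
Variables (a b alpha beta : R) (m : nat).
Implicit Types (f : plane R -> R[i]) (z w : plane R).

Definition A_integrand f z w : R[i] :=
  let zeta := cplx z in let omega := cplx w in
  f w * Q alpha beta (zeta * omega^*)
    * ((1 - cmod omega ^+ 2) `^ (alpha - a))%:C * omega ^+ m
  / ((cmod omega `^ (2 * m%:R + 2 * b - 2 * beta))%:C
     * cpow (1 - zeta * omega^*) (2 + alpha)).

Definition opA f z : R[i] :=
  (cplx z ^+ m)^-1 * cintegral (mu_disc a b) (A_integrand f z).

Definition B_integrand f z w : R[i] :=
  let zeta := cplx z in let omega := cplx w in
  f w * (cmod (Q alpha beta (zeta * omega^*))
         * (1 - cmod omega ^+ 2) `^ (alpha - a)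
         * cmod omega `^ (2 * beta - 2 * b - m%:R)
         / cmod (1 - zeta * omega^*) `^ (2 + alpha))%:C.

Definition opB f z : R[i] :=
  ((cmod (cplx z) ^+ m)^-1)%:C
  * cintegral (mu_disc a b) (B_integrand f z).

Definition A_bounded (p : R) : Prop :=
  bounded_on_Lp (mu_disc a b) p
    (fun f z => cintegrable (mu_disc a b) (A_integrand f z)) opA.

Definition B_bounded (p : R) : Prop :=
  bounded_on_Lp (mu_disc a b) p
    (fun f z => cintegrable (mu_disc a b) (B_integrand f z)) opB.

End Operators.

(* Main.v *)
From HB Require Import structures.
Require Import Defs.
From mathcomp Require Import all_boot all_order all_algebra.
From mathcomp Require Import complex.
From mathcomp Require Import all_classical all_reals all_analysis.
From mathcomp Require Import measurable_realfun.
From mathcomp Require Import ring lra.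
Set Implicit Arguments.
Unset Strict Implicit.
Unset Printing Implicit Defensive.
Import Order.TTheory GRing.Theory Num.Theory.
Import numFieldNormedType.Exports.
Import HBNNSimple.
Local Open Scope classical_set_scope.
Local Open Scope complex_scope.
Local Open Scope ring_scope.

(** Up to notation, A and B are operators
    T f(z) = k(z) int f e phi K(xi) dmu_{a,b}(w) with xi = z w^*, where
    |k(z)| = |z|^-m, e is unimodular off the origin, phi(w) is
    |w|^(2 beta - 2 b - m) (1 - |w|^2)^(alpha - a), and K(xi) is
    Q(xi) / (1 - xi)^(2 + alpha) for A and its modulus for B. The proof treats
    all these operators at once. It uses of K only that it is measurable, that
    |K(xi)| <= C |1 - xi|^-(2 + alpha), and that
    Re K(xi) >= c |1 - xi|^-(2 + alpha) near 0 and in a thin cone at 1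
    ([kernel_regular]). Each of the boundedness of A and that of B is then
    equivalent to the same condition on the exponents.

    The properties of K come from those of Q. For an integer beta, Q is a
    positive constant. Otherwise the coefficients of the series, even multiplied
    by n, are absolutely summable ([Qcoef_sum_bounded]), so that Q is bounded and
    Lipschitz up to the boundary, and it is positive at 0 and at 1. Positivity
    at 1 is the least obvious: by Pascal's rule, replacing alpha by alpha + 1
    multiplies the value of the series at 1 by a positive factor, which reduces
    the claim to a series with nonnegative terms ([Qcoef_alternating_gt0]).

    Sufficiency ([kop_bounded_of_exponents]). |T f| is dominated by the operator
    with the positive kernel |z|^-m phi(w) |1 - z w^*|^-(2 + alpha). Its rows and
    columns, weighted by powers of |w| and of 1 - |w|^2, are Forelli-Rudin
    integrals. These are estimated on dyadic layers of |1 - z w^*| from the area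
    of Carleson boxes ([carleson_area], [forelli_rudin]). For p = 1 the column
    bound is enough; for p > 1 Schur's test applies ([schur_test]) with a test
    function |z|^-s (1 - |z|^2)^-t, and the condition on the exponents provides
    suitable s and t ([majorant_bounded]).

    Necessity ([exponents_of_kop_bounded]). Applied to g times the conjugate of
    e, with g >= 0, the operator has an integrand without cancellation wherever
    Re K is bounded below, in particular for all w if z is near 0. There
    |T f(z)| is at least c |z|^-m int g phi dmu. So |z|^(-p m) is integrable near
    0 ([origin_exponent]) and g -> int g phi dmu is a bounded functional on L^p
    ([functional_bounded]). Powers of |z| near 0 and of 1 - |z|^2 near the
    circle, cut off at a small scale, then give all the remaining inequalities
    ([layer_exponents]), except that for p = 1 they give alpha >= a instead of
    alpha > a. For alpha = a, bumps concentrated at 1 have images of the size of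
    the Bergman kernel, whose integral in a cone at 1 diverges logarithmically
    ([alpha_neq_a]). *)

(** * Integrals of nonnegative functions *)

Section positivity.
Context d (T : measurableType d) (R : realType) (mu : {measure set T -> \bar R}).
Local Open Scope ereal_scope.

Lemma integral_gt0 (E : set T) (G : T -> R) : measurable E -> 0 < mu E ->
  measurable_fun E G -> (forall x, E x -> (0 < G x)%R) ->
  0 < \int[mu]_(x in E) (G x)%:E.
Proof.
move=> mE muE mG G0; rewrite lt_neqAle integral_ge0 ?andbT; last first.
  by move=> x Ex; rewrite lee_fin ltW// G0.
apply/eqP => /esym I0.
have : \int[mu]_(x in E) `|(G x)%:E| = 0.
  rewrite -[RHS]I0; apply: eq_integral => x /[!inE] Ex.
  by rewrite gee0_abs// lee_fin ltW// G0.
move=> /ae_eq_integral_abs - /(_ mE) [|N [mN N0 sub]]; first exact/measurable_EFinP.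
suff : mu E <= mu N by rewrite N0 leNgt muE.
apply: le_measure; rewrite ?inE// => x Ex; apply: sub => /= /(_ Ex) [] G00.
by have := G0 x Ex; rewrite G00 ltxx.
Qed.

Lemma ge0_integral_lincomb (E : set T) (f g : T -> R) (x y : R) :
  measurable E -> measurable_fun E f -> measurable_fun E g ->
  (forall t, (0 <= f t)%R) -> (forall t, (0 <= g t)%R) ->
  (0 <= x)%R -> (0 <= y)%R ->
  \int[mu]_(t in E) ((x * f t)%:E + (y * g t)%:E) =
  x%:E * \int[mu]_(t in E) (f t)%:E + y%:E * \int[mu]_(t in E) (g t)%:E.
Proof.
move=> mE mf mg f0 g0 x0 y0.
have Z (h : T -> R) (c : R) : measurable_fun E h -> (forall t, (0 <= h t)%R) ->
    (0 <= c)%R -> \int[mu]_(t in E) (c * h t)%:E = c%:E * \int[mu]_(t in E) (h t)%:E.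
  move=> mh h0 c0; under eq_integral do rewrite EFinM.
  by rewrite ge0_integralZl_EFin// => [t _|]; [rewrite lee_fin|exact/measurable_EFinP].
rewrite ge0_integralD ?Z//.
- by move=> t _; rewrite lee_fin mulr_ge0.
- by apply/measurable_EFinP; exact: measurable_funM.
- by move=> t _; rewrite lee_fin mulr_ge0.
- by apply/measurable_EFinP; exact: measurable_funM.
Qed.

End positivity.

Section density.
Local Open Scope ereal_scope.
Context d (T : measurableType d) (R : realType).
Variables (nu mu : {measure set T -> \bar R}) (D : set T) (w : T -> R).
Hypotheses (mD : measurable D) (mw : measurable_fun D w)
  (w0 : forall x, D x -> (0 <= w x)%R)
  (muE : forall A, measurable A -> mu A = \int[nu]_(x in A `&` D) (w x)%:E).

Let emw : measurable_fun D (fun x => (w x)%:E).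
Proof. exact/measurable_EFinP. Qed.

Let density_indic E : measurable E ->
  \int[mu]_x (\1_E x)%:E = \int[nu]_(x in D) ((\1_E x)%:E * (w x)%:E).
Proof.
move=> mE; rewrite integral_indic// setIT muE// setIC.
rewrite integral_mkcondr; apply: eq_integral => x _.
by rewrite epatch_indic muleC.
Qed.

Let density_nnsfun (h : {nnsfun T >-> R}) :
  \int[mu]_x (h x)%:E = \int[nu]_(x in D) ((h x)%:E * (w x)%:E).
Proof.
under [LHS]eq_integral do rewrite fimfunE -fsumEFin//.
rewrite [LHS]ge0_integral_fsum//; last 2 first.
  - by move=> r; exact/measurable_EFinP/measurableT_comp.
  - by move=> n x _; rewrite EFinM nnfun_muleindic_ge0.
transitivity (\int[nu]_(x in D) (\sum_(r \in range h)
    ((r * \1_(h @^-1` [set r]) x)%:E * (w x)%:E))); last first.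
  apply: eq_integral => x _; rewrite -ge0_mule_fsuml => [|r].
    by rewrite fsumEFin// -fimfunE.
  exact: nnfun_muleindic_ge0.
rewrite [RHS]ge0_integral_fsum//; last 2 first.
  - move=> r; apply: emeasurable_funM => //.
    by apply/measurable_EFinP; apply: measurable_funTS; exact: measurable_funM.
  - move=> r x Dx; apply: mule_ge0; last by rewrite lee_fin w0.
    exact: nnfun_muleindic_ge0.
apply: eq_fsbigr => r; rewrite inE => -[t _ rE].
have r0 : (0 <= r)%R by rewrite -rE.
under [LHS]eq_integral do rewrite EFinM.
under [RHS]eq_integral do rewrite EFinM -muleA.
rewrite ge0_integralZl// ?density_indic ?ge0_integralZl//.
- apply: emeasurable_funM => //.
  by apply/measurable_EFinP; apply: measurable_funTS; exact: measurable_indic.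
- by move=> x Dx; rewrite mule_ge0 ?lee_fin ?w0.
- by apply/measurable_EFinP; exact: measurable_indic.
Qed.

(** Both sides agree on indicator functions, hence on simple functions, and
    monotone convergence does the rest. *)
Lemma ge0_integral_density (f : T -> \bar R) : measurable_fun setT f ->
  (forall x, 0 <= f x) -> \int[mu]_x f x = \int[nu]_(x in D) (f x * (w x)%:E).
Proof.
move=> mf f0; pose f_ := nnsfun_approx measurableT mf.
have cvf x : (f_ n x)%:E @[n --> \oo] --> f x by exact: cvg_nnsfun_approx.
have -> : \int[mu]_x f x = limn (fun n => \int[mu]_x (f_ n x)%:E).
  rewrite -monotone_convergence//=.
  - by apply: eq_integral => x _; apply/esym/cvg_lim.
  - by move=> n; exact/measurable_EFinP.
  - by move=> n x _; rewrite lee_fin.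
  - by move=> x _ a b ab; rewrite lee_fin; exact/lefP/nd_nnsfun_approx.
have -> : \int[nu]_(x in D) (f x * (w x)%:E) =
    limn (fun n => \int[nu]_(x in D) ((f_ n x)%:E * (w x)%:E)).
  rewrite -monotone_convergence//=.
  - by apply: eq_integral => x _; apply/esym/cvg_lim => //; exact: cvgeZr.
  - move=> n; apply: emeasurable_funM => //.
    by apply/measurable_EFinP; exact: measurable_funTS.
  - by move=> n x Dx; rewrite mule_ge0 ?lee_fin ?w0.
  - move=> x Dx a b ab; rewrite lee_wpmul2r ?lee_fin ?w0//.
    exact/lefP/nd_nnsfun_approx.
by congr (limn _); apply/funext => n; exact: density_nnsfun.
Qed.

Lemma ge0_integral_density_dom (f : T -> \bar R) : measurable_fun D f ->
  (forall x, D x -> 0 <= f x) ->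
  \int[mu]_(x in D) f x = \int[nu]_(x in D) (f x * (w x)%:E).
Proof.
move=> mf f0; rewrite integral_mkcond ge0_integral_density.
- by apply: eq_integral => x xD; rewrite patchE xD.
- exact/(measurable_restrictT f mD).
- by move=> x; rewrite patchE; case: ifPn => // /[!inE]; exact: f0.
Qed.

End density.

(** * Integrals over dyadic layers *)

Section dyadic.
Context (R : realType).
Implicit Types (x r L q th : R).

Lemma powR_expn x n th : 0 <= x -> (x ^+ n) `^ th = (x `^ th) ^+ n.
Proof.
by move=> x0; rewrite -powR_mulrn// -powRrM mulrC powRrM powR_mulrn// powR_ge0.
Qed.

Lemma two_powR_norm_ge1 th : 1 <= 2 `^ `|th| :> R.
Proof. by rewrite -[leLHS](powRr0 2) ler_powR// ler1n. Qed.

(** Within a dyadic layer a power varies by a bounded factor, whatever the sign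
    of its exponent. *)
Lemma powR_dyadic x r th : 0 < x -> x <= r -> r <= 2 * x ->
  x `^ th <= 2 `^ `|th| * r `^ th.
Proof.
move=> x0 xr rx; have r0 : 0 < r by exact: lt_le_trans xr.
have [th0|th0] := leP 0 th.
  apply: (@le_trans _ _ (r `^ th)).
    by rewrite ge0_ler_powR// ?nnegrE ltW.
  by rewrite ler_peMl ?powR_ge0// two_powR_norm_ge1.
rewrite ltr0_norm//; have t0 : 0 < - th by rewrite oppr_gt0.
rewrite -[th in x `^ th]opprK -[th in r `^ th]opprK; move: (- th) t0 => t t0.
rewrite !powRN ler_pdivlMr ?powR_gt0// mulrC ler_pdivrMr ?powR_gt0//.
rewrite -powRM ?(ltW x0)// ge0_ler_powR ?nnegrE ?(ltW t0) ?(ltW r0)//.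
by rewrite mulr_ge0// ltW.
Qed.

Lemma powR_half_one x th : 2^-1 <= x -> x <= 1 -> x `^ th <= 2 `^ `|th|.
Proof.
move=> x2 x1; have := @powR_dyadic x 1 th; rewrite powR1 mulr1; apply => //.
  by apply: lt_le_trans x2; rewrite invr_gt0.
by rewrite mulrC -ler_pdivrMr// div1r.
Qed.

Lemma dyadic_scale x : 1 <= x -> exists k : nat, 2 ^+ k <= x < 2 ^+ k.+1.
Proof.
move=> x1; have x0 : 0 <= x by exact: le_trans x1.
have ex : exists n : nat, x < 2 ^+ n.
  exists (Num.truncn x).+1; apply: (lt_le_trans (truncnS_gt x)).
  by rewrite -natrX ler_nat ltnW// ltn_expl.
have [n xn nmin] := ex_minnP ex.
case: n xn nmin => [|k] xk kmin; first by move: xk; rewrite expr0 ltNge x1.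
exists k; rewrite xk andbT leNgt; apply/negP => /kmin.
by rewrite ltnn.
Qed.

Lemma geometric_sum_le r n : 0 <= r < 1 -> \sum_(k < n) r ^+ k <= (1 - r)^-1.
Proof.
move=> /andP[r0 r1]; rewrite -(@ler_pM2l _ (1 - r)) ?subr_gt0//.
rewrite mulfV ?gt_eqF ?subr_gt0// -opprB mulNr -subrX1 opprB.
by rewrite gerBl exprn_ge0.
Qed.

Lemma powR_half_lt1 th : 0 < th -> (2^-1 : R) `^ th < 1.
Proof.
move=> th0; rewrite -[ltRHS](_ : 1 `^ th = 1); last by rewrite powR1.
by rewrite gt0_ltr_powR ?nnegrE// invf_lt1 ?ltr1n.
Qed.
End dyadic.

Section layers.
Context d (T : measurableType d) (R : realType) (mu : {measure set T -> \bar R}).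
Variables (E : set T) (G g : T -> R).
Hypotheses (mE : measurable E) (mG : measurable_fun E G)
  (mg : measurable_fun E g) (G0 : forall w, E w -> 0 <= G w)
  (g0 : forall w, E w -> 0 <= g w).

Lemma measurable_sublevel r : measurable (E `&` [set w | g w <= r]).
Proof.
rewrite (_ : [set w | g w <= r] = g @^-1` `]-oo, r]); last first.
  by apply/seteqP; split => w /=; rewrite in_itv.
exact: mg.
Qed.

(** On the layer where g is comparable to r = L q^k, the factor g^th is
    comparable to r^th, and G has mass at most M r^ka there. The layers thus
    contribute a geometric series of ratio q^(th + ka) < 1. The layers shrink
    towards g = 0 for q = 1/2 and grow from g = L for q = 2. *)
Lemma layers_integral (q L th ka M : R) : 0 < q -> 0 < L -> 0 <= M ->
  q `^ (th + ka) < 1 ->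
  (forall w, E w -> exists k : nat,
     g w <= L * q ^+ k /\ g w `^ th <= 2 `^ `|th| * (L * q ^+ k) `^ th) ->
  (forall r : R, (0 < r)%R -> \int[mu]_(w in E `&` [set w | (g w <= r)%R]) (G w)%:E
     <= (M * r `^ ka)%:E)%E ->
  (\int[mu]_(w in E) (G w * g w `^ th)%:E
   <= (2 `^ `|th| * M * L `^ (th + ka) / (1 - q `^ (th + ka)))%:E)%E.
Proof.
move=> q0 L0 M0 q1 cover bnd; pose r k := L * q ^+ k.
have r0 k : 0 < r k by rewrite mulr_gt0// exprn_gt0.
pose Ek k := E `&` [set w | g w <= r k].
have mEk k : measurable (Ek k) by exact: measurable_sublevel.
pose c k := 2 `^ `|th| * r k `^ th.
have c0 k : 0 <= c k by rewrite mulr_ge0 ?powR_ge0.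
pose h k := (EFin \o (fun w => c k * G w)) \_ (Ek k).
have mh k : measurable_fun E (h k).
  apply/measurable_restrict => //.
  apply/measurable_EFinP; apply: measurable_funM => //.
  by apply: measurable_funS mG => //; exact: subIsetl.
have h0 k w : E w -> (0 <= h k w)%E.
  move=> Ew; rewrite /h patchE; case: ifPn => // _.
  by rewrite /= lee_fin mulr_ge0// G0.
apply: (@le_trans _ _ (\int[mu]_(w in E) \sum_(0 <= k <oo) h k w)%E).
  apply: ge0_le_integral => //.
  - by move=> w Ew; rewrite lee_fin mulr_ge0 ?powR_ge0// G0.
  - apply/measurable_EFinP; apply: measurable_funM => //.
    exact: (measurableT_comp (measurable_powR th)).
  - by apply: (ge0_emeasurable_sum (P := xpredT)) => // k w Ew _; exact: h0.
  move=> w Ew; have [k [gk ck]] := cover w Ew.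
  apply: (@le_trans _ _ (h k w)).
    rewrite /h patchE ifT ?lee_fin/=; last by rewrite inE.
    by rewrite mulrC ler_wpM2r// G0.
  rewrite (nneseriesD1 (n := k)) ?leeDl//; last by move=> *; exact: h0.
  by apply: nneseries_ge0 => *; exact: h0.
rewrite integral_nneseries//.
apply: lime_le; first by apply: is_cvg_nneseries => *; apply: integral_ge0 => *; exact: h0.
apply: nearW => n; rewrite big_mkord.
apply: (@le_trans _ _ (\sum_(k < n) (2 `^ `|th| * M * L `^ (th + ka) * (q `^ (th + ka)) ^+ k)%:E)%E).
  apply: lee_sum => k _; rewrite /h -integral_mkcondr setIA setIid.
  rewrite [leLHS](_ : _ = ((c k)%:E * \int[mu]_(w in Ek k) (G w)%:E)%E); last first.
    rewrite -ge0_integralZl_EFin//.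
    - by move=> w -[Ew _]; rewrite lee_fin G0.
    - apply/measurable_EFinP; apply: measurable_funS mG => //.
      exact: subIsetl.
  apply: (@le_trans _ _ ((c k)%:E * (M * r k `^ ka)%:E)%E).
    by rewrite lee_wpmul2l ?lee_fin//; exact: bnd.
  rewrite -EFinM lee_fin.
  have -> : c k * (M * r k `^ ka) = 2 `^ `|th| * M * r k `^ (th + ka).
    by rewrite powRD ?(gt_eqF (r0 k)) ?implybT// /c mulrACA.
  by rewrite /r powRM ?exprn_ge0 ?(ltW L0) ?(ltW q0)// powR_expn ?(ltW q0)// mulrA.
rewrite sumEFin lee_fin -mulr_sumr ler_wpM2l ?mulr_ge0 ?powR_ge0//.
by rewrite geometric_sum_le// powR_ge0.
Qed.

End layers.

Section layers_small_large.
Context d (T : measurableType d) (R : realType) (mu : {measure set T -> \bar R}).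
Variables (E : set T) (G g : T -> R) (L th ka M : R).
Hypotheses (mE : measurable E) (mG : measurable_fun E G)
  (mg : measurable_fun E g) (G0 : forall w, E w -> 0 <= G w)
  (L0 : 0 < L) (M0 : 0 <= M)
  (bnd : forall r : R, 0 < r ->
    (\int[mu]_(w in E `&` [set w | (g w <= r)%R]) (G w)%:E
     <= (M * r `^ ka)%:E)%E).

Lemma layers_integral_small : 0 < th + ka ->
  (forall w, E w -> 0 <= g w <= L) ->
  (\int[mu]_(w in E) (G w * g w `^ th)%:E
   <= (2 `^ `|th| * M * L `^ (th + ka) / (1 - 2^-1 `^ (th + ka)))%:E)%E.
Proof.
move=> tk gL; apply: layers_integral => //.
  exact: powR_half_lt1.
move=> w /gL /andP[]; rewrite le_eqVlt => /predU1P[<- _|g0 gleL].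
  (* where g vanishes, g^th is 0, or 1 if th = 0 *)
  exists 0%N; rewrite expr0 mulr1; split; first exact: ltW.
  have [->|th0] := eqVneq th 0; last by rewrite powR0// mulr_ge0 ?powR_ge0.
  by rewrite !powRr0 normr0 powRr0 mulr1.
have [k /andP[k1 k2]] : exists k : nat, 2 ^+ k <= L / g w < 2 ^+ k.+1.
  by apply: dyadic_scale; rewrite ler_pdivlMr// mul1r.
have gk : g w <= L * 2^-1 ^+ k.
  by rewrite exprVn ler_pdivlMr ?exprn_gt0// mulrC -ler_pdivlMr.
exists k; split => //; apply: powR_dyadic => //.
by rewrite exprVn ler_pdivrMr ?exprn_gt0// mulrAC -exprS -ler_pdivrMr// ltW.
Qed.

Lemma layers_integral_large : th + ka < 0 -> (forall w, E w -> L <= g w) ->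
  (\int[mu]_(w in E) (G w * g w `^ th)%:E
   <= (2 `^ `|th| * M * (2 * L) `^ (th + ka) / (1 - 2 `^ (th + ka)))%:E)%E.
Proof.
move=> tk gL; apply: layers_integral => //.
- by rewrite mulr_gt0.
- rewrite -[th + ka]opprK powRN -powR_inv1 ?powR_ge0// -powRrM mulrC powRrM.
  by rewrite powR_inv1// powR_half_lt1// oppr_gt0.
move=> w /gL Lg; have g0 : 0 < g w by exact: lt_le_trans Lg.
have [k /andP[k1 k2]] : exists k : nat, 2 ^+ k <= g w / L < 2 ^+ k.+1.
  by apply: dyadic_scale; rewrite ler_pdivlMr// mul1r.
have gk : g w <= 2 * L * 2 ^+ k.
  by rewrite mulrAC -exprS -ler_pdivrMr// ltW.
exists k; split => //; apply: powR_dyadic => //.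
by rewrite -mulrA ler_pM2l// mulrC -ler_pdivlMr.
Qed.

End layers_small_large.

Lemma layers_power d (T : measurableType d) (R : realType)
    (mu : {measure set T -> \bar R}) (E : set T) (g : T -> R) (L th ka M : R) :
  measurable E -> measurable_fun E g -> 0 < L -> 0 <= M -> 0 < th + ka ->
  (forall w, E w -> 0 <= g w <= L) ->
  (forall r, 0 < r -> (mu (E `&` [set w | (g w <= r)%R]) <= (M * r `^ ka)%:E)%E) ->
  (\int[mu]_(w in E) (g w `^ th)%:E
   <= (2 `^ `|th| * M * L `^ (th + ka) / (1 - 2^-1 `^ (th + ka)))%:E)%E.
Proof.
move=> mE mg L0 M0 tk gL bnd.
rewrite (eq_integral (fun w => (1 * g w `^ th)%:E)) => [|w _]; last by rewrite mul1r.
apply: (@layers_integral_small _ _ _ mu E (cst 1)) => // r r0.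
rewrite (@integral_cst _ _ _ mu _ _ 1%:E) ?mul1e; first exact: bnd.
exact: measurable_sublevel.
Qed.

(** * Lebesgue measure on the plane *)

Section plane_measure.
Variable R : realType.
Local Open Scope ereal_scope.

(** The product measure under a name of its own, which carries the instances of
    a measure and of a sigma-finite measure. *)
Definition prod_leb : set (plane R) -> \bar R :=
  (@lebesgue_measure R \x @lebesgue_measure R).

HB.instance Definition _ := Measure.on prod_leb.

Let prod_leb_sigma_finite : sigma_finite setT prod_leb.
Proof.
exists (fun n => `](- n%:R)%R, n%:R%R[%classic `*` `](- n%:R)%R, n%:R%R[%classic).
  apply/esym; rewrite -subTset => -[x y] _.
  have xy0 : (0 <= `|x| + `|y|)%R by rewrite addr_ge0.
  exists (Num.truncn (`|x| + `|y|)).+1 => //=.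
  by split; rewrite /= in_itv/= -ltr_norml; apply: le_lt_trans (truncnS_gt _);
    rewrite ?lerDl ?lerDr.
move=> n; split; first exact: measurableX.
rewrite /prod_leb/= product_measure1E// lte_mul_pinfty//= lebesgue_measure_itv//=.
- by case: ifP => _ //; rewrite -EFinD.
- by case: ifP => _ //; rewrite -EFinD ltry.
Qed.

HB.instance Definition _ :=
  Measure_isSigmaFinite.Build _ _ _ prod_leb prod_leb_sigma_finite.

Lemma prod_leb_rect (A B : set (measurableTypeR R)) :
  measurable A -> measurable B ->
  prod_leb (A `*` B) = lebesgue_measure A * lebesgue_measure B.
Proof. by move=> mA mB; rewrite /prod_leb/= product_measure1E. Qed.

Lemma prod_leb_swap (E : set (plane R)) : measurable E ->
  prod_leb E = \int[@lebesgue_measure R]_y @lebesgue_measure R (ysection E y).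
Proof.
move=> mE; transitivity ((@lebesgue_measure R \x^ @lebesgue_measure R) E) => //.
apply: product_measure_unique => //= A B mA mB.
exact: product_measure2E.
Qed.

Lemma plane_set1E (z : plane R) : [set z] = [set z.1] `*` [set z.2].
Proof. by apply/seteqP; case: z => x y; split=> [_ ->|[u v] [/= -> ->]]. Qed.

Lemma measurable_plane_set1 (z : plane R) : measurable [set z].
Proof. by rewrite plane_set1E; exact: measurableX. Qed.

Lemma prod_leb_set1 (z : plane R) : prod_leb [set z] = 0.
Proof.
by rewrite plane_set1E prod_leb_rect// lebesgue_measure_set1 mul0e.
Qed.

Let integral_indic_cst (s : R) (A : set (measurableTypeR R)) :
  (0 <= s)%R -> measurable A ->
  \int[@lebesgue_measure R]_x (s * \1_A x)%:E = s%:E * lebesgue_measure A.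
Proof.
move=> s0 mA; under eq_integral do rewrite EFinM.
by rewrite ge0_integralZl_EFin// ?integral_indic ?setIT//; exact/measurable_EFinP.
Qed.

(** Cavalieri's principle. The upper bounds serve for Carleson boxes, and the
    lower bound below for layers at the unit circle. *)
Lemma prod_leb_xslice_le (E : set (plane R)) (A : set (measurableTypeR R)) (s : R) :
  measurable E -> measurable A -> (0 <= s)%R ->
  (forall z, E z -> A z.1) ->
  (forall x, A x -> @lebesgue_measure R (xsection E x) <= s%:E) ->
  prod_leb E <= s%:E * lebesgue_measure A.
Proof.
move=> mE mA s0 EA Es; rewrite -integral_indic_cst//.
apply: ge0_le_integral => //.
- exact: measurable_fun_xsection.
- by apply/measurable_EFinP; apply: measurable_funM.
move=> x _ /=; have [xA|xA] := pselect (A x).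
  by rewrite indicE mem_set// mulr1 Es.
rewrite (_ : xsection E x = set0) ?measure0 ?lee_fin ?mulr_ge0//.
by apply/seteqP; split => y //; rewrite /xsection/= inE => /EA.
Qed.

Lemma prod_leb_yslice_le (E : set (plane R)) (A : set (measurableTypeR R)) (s : R) :
  measurable E -> measurable A -> (0 <= s)%R ->
  (forall z, E z -> A z.2) ->
  (forall x, A x -> @lebesgue_measure R (ysection E x) <= s%:E) ->
  prod_leb E <= s%:E * lebesgue_measure A.
Proof.
move=> mE mA s0 EA Es; rewrite -integral_indic_cst// prod_leb_swap//.
apply: ge0_le_integral => //.
- exact: measurable_fun_ysection.
- by apply/measurable_EFinP; apply: measurable_funM.
move=> x _ /=; have [xA|xA] := pselect (A x).
  by rewrite indicE mem_set// mulr1 Es.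
rewrite (_ : ysection E x = set0) ?measure0 ?lee_fin ?mulr_ge0//.
by apply/seteqP; split => y //; rewrite /ysection/= inE => /EA.
Qed.

Lemma prod_leb_yslice_ge (E : set (plane R)) (A : set (measurableTypeR R)) (s : R) :
  measurable E -> measurable A -> (0 <= s)%R ->
  (forall x, A x -> s%:E <= @lebesgue_measure R (ysection E x)) ->
  s%:E * lebesgue_measure A <= prod_leb E.
Proof.
move=> mE mA s0 Es; rewrite -integral_indic_cst// prod_leb_swap//.
apply: ge0_le_integral => //.
- by move=> x _; rewrite lee_fin mulr_ge0.
- by apply/measurable_EFinP; apply: measurable_funM.
- exact: measurable_fun_ysection.
move=> x _ /=; have [xA|xA] := pselect (A x).
  by rewrite indicE mem_set// mulr1 Es.
by rewrite indicE memNset// mulr0.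
Qed.

Lemma integral_area (D : set (plane R)) (f : plane R -> \bar R) :
  measurable D -> measurable_fun D f -> (forall z, D z -> 0 <= f z) ->
  \int[area R]_(z in D) f z = (pi^-1)%:E * \int[prod_leb]_(z in D) f z.
Proof. by move=> mD mf f0; rewrite /area ge0_integral_mscale. Qed.

End plane_measure.

(** * Moduli and the distance |1 - z w^*| *)

Section cmod_theory.
Variable R : realType.
Implicit Types (u v : R[i]) (x y : R) (z w : plane R).

Lemma ReB u v : complex.Re (u - v) = complex.Re u - complex.Re v.
Proof. by case: u v => a b [c d]. Qed.

Lemma ImB u v : complex.Im (u - v) = complex.Im u - complex.Im v.
Proof. by case: u v => a b [c d]. Qed.

Lemma cmodE u : cmod u = Num.sqrt (complex.Re u ^+ 2 + complex.Im u ^+ 2).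
Proof. by case: u. Qed.

Lemma sqr_cmod u : cmod u ^+ 2 = complex.Re u ^+ 2 + complex.Im u ^+ 2.
Proof. by rewrite cmodE sqr_sqrtr// addr_ge0 ?sqr_ge0. Qed.

Lemma cmod_ge0 u : 0 <= cmod u.
Proof. by rewrite cmodE sqrtr_ge0. Qed.

Lemma cmodM u v : cmod (u * v) = cmod u * cmod v.
Proof. exact: Normc.normcM. Qed.

Lemma cmodV u : cmod u^-1 = (cmod u)^-1.
Proof. exact: Normc.normcV. Qed.

Lemma cmodD u v : cmod (u + v) <= cmod u + cmod v.
Proof. exact: le_normcD. Qed.

Lemma cmodN u : cmod (- u) = cmod u.
Proof. by case: u => a b; rewrite !cmodE/= !sqrrN. Qed.

Lemma cmod1 : cmod (1 : R[i]) = 1.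
Proof. exact: Normc.normc1. Qed.

Lemma cmod0 : cmod (0 : R[i]) = 0.
Proof. exact: Normc.normc0. Qed.

Lemma cmodX u n : cmod (u ^+ n) = cmod u ^+ n.
Proof. by elim: n => [|n IH]; rewrite ?expr0 ?cmod1// !exprS cmodM IH. Qed.

Lemma cmod_real x : cmod (x%:C) = `|x|.
Proof. by rewrite cmodE/= expr0n addr0 sqrtr_sqr. Qed.

Lemma cmod_eq0 u : (cmod u == 0) = (u == 0).
Proof. by apply/eqP/eqP => [/Normc.eq0_normc|->]//; rewrite cmod0. Qed.

Lemma conjE x y : (x +i* y)^* = x -i* y :> R[i].
Proof. by []. Qed.

Lemma cmod_conj u : cmod u^* = cmod u.
Proof. by case: u => a b; rewrite conjE !cmodE/= sqrrN. Qed.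

Lemma normr_Re_le u : `|complex.Re u| <= cmod u.
Proof.
by rewrite -[leLHS]sqrtr_sqr cmodE ler_wsqrtr// lerDl sqr_ge0.
Qed.

Lemma normr_Im_le u : `|complex.Im u| <= cmod u.
Proof.
by rewrite -[leLHS]sqrtr_sqr cmodE ler_wsqrtr// lerDr sqr_ge0.
Qed.

Lemma Re_le_cmod u : complex.Re u <= cmod u.
Proof. exact: le_trans (ler_norm _) (normr_Re_le u). Qed.

Lemma cmod_le_ReIm u : cmod u <= `|complex.Re u| + `|complex.Im u|.
Proof.
rewrite -(@ler_pXn2r _ 2) ?nnegrE ?cmod_ge0 ?addr_ge0// sqr_cmod.
by rewrite sqrrD !real_normK ?num_real// lerD2r lerDl mulrn_wge0// mulr_ge0.
Qed.

Lemma Re_mul u v : complex.Re (u * v) =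
  complex.Re u * complex.Re v - complex.Im u * complex.Im v.
Proof. by case: u v => a b [c d]. Qed.

Lemma Im_mul u v : complex.Im (u * v) =
  complex.Re u * complex.Im v + complex.Im u * complex.Re v.
Proof. by case: u v => a b [c d]. Qed.

Lemma mul_conj u : u * u^* = (cmod u ^+ 2)%:C.
Proof.
case: u => a b; rewrite conjE sqr_cmod; apply/eqP; rewrite eq_complex/=.
by apply/andP; split; apply/eqP; ring.
Qed.

(** The pairing z w^* that enters every kernel. *)
Lemma mul_conj_cplx z w : cplx z * (cplx w)^* =
  ((z.1 : R) * w.1 + (z.2 : R) * w.2) +i* ((z.2 : R) * w.1 - (z.1 : R) * w.2).
Proof.
by apply/eqP; rewrite eq_complex/=; apply/andP; split; apply/eqP; ring.
Qed.

Definition kdist z w : R := cmod (1 - cplx z * (cplx w)^*).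

Lemma sqr_kdist z w : kdist z w ^+ 2 =
  (1 - ((z.1 : R) * w.1 + (z.2 : R) * w.2)) ^+ 2 +
  ((z.2 : R) * w.1 - (z.1 : R) * w.2) ^+ 2.
Proof. by rewrite /kdist mul_conj_cplx sqr_cmod/= sub0r sqrrN. Qed.

Lemma kdist_ge0 z w : 0 <= kdist z w. Proof. exact: cmod_ge0. Qed.

Lemma kdistC z w : kdist z w = kdist w z.
Proof.
apply/eqP; rewrite -(@eqrXn2 _ 2) ?kdist_ge0// !sqr_kdist.
by apply/eqP; ring.
Qed.

Lemma sqr_cmod_cplx z : cmod (cplx z) ^+ 2 = (z.1 : R) ^+ 2 + (z.2 : R) ^+ 2.
Proof. by rewrite sqr_cmod. Qed.

Lemma cmod_pairing z w : disc R z -> cmod (cplx z * (cplx w)^*) <= cmod (cplx w).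
Proof.
move=> zD; rewrite cmodM cmod_conj ler_piMl ?cmod_ge0//; exact: ltW.
Qed.

Lemma pairing_disc z w : disc R z -> disc R w ->
  cmod (cplx z * (cplx w)^*) < 1.
Proof. by move=> zD; apply: le_lt_trans; exact: cmod_pairing. Qed.

Lemma kdist_ge z w : disc R z -> 1 - cmod (cplx w) <= kdist z w.
Proof.
move=> zD; rewrite lerBlDr; apply: le_trans (_ : _ <= kdist z w + cmod (cplx z * (cplx w)^*)) _.
  by rewrite -[leLHS]cmod1 -[X in cmod X](subrK (cplx z * (cplx w)^*)) cmodD.
by rewrite lerD2l cmod_pairing.
Qed.

Lemma kdist_gt0 z w : disc R z -> disc R w -> 0 < kdist z w.
Proof. by move=> zD wD; apply: lt_le_trans (kdist_ge _ zD); rewrite subr_gt0. Qed.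

Lemma kdist_le2 z w : disc R z -> disc R w -> kdist z w <= 2.
Proof.
move=> zD wD; apply: le_trans (cmodD _ _) _; rewrite cmodN cmod1.
by rewrite (_ : 2 = 1 + 1)// lerD2l ltW// pairing_disc.
Qed.

Lemma one_sub_sqr_gt0 z : disc R z -> 0 < 1 - cmod (cplx z) ^+ 2.
Proof. by move=> zD; rewrite subr_gt0 expr_lt1 ?cmod_ge0. Qed.

Lemma one_sub_sqr_le1 z : 1 - cmod (cplx z) ^+ 2 <= 1.
Proof. by rewrite gerBl sqr_ge0. Qed.

Lemma one_sub_sqr_le z : disc R z ->
  1 - cmod (cplx z) ^+ 2 <= 2 * (1 - cmod (cplx z)).
Proof.
move=> zD; rewrite -subr_ge0.
by rewrite (_ : _ - _ = (1 - cmod (cplx z)) ^+ 2) ?sqr_ge0//; ring.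
Qed.

(** This identity makes |1 - z w^*| dominate |z - w| on the disc. *)
Lemma sqr_kdist_dist z w : kdist z w ^+ 2 =
  ((z.1 : R) - w.1) ^+ 2 + ((z.2 : R) - w.2) ^+ 2 +
  (1 - cmod (cplx z) ^+ 2) * (1 - cmod (cplx w) ^+ 2).
Proof. by rewrite sqr_kdist !sqr_cmod_cplx; ring. Qed.

Lemma kdist_ge_dist z w : disc R z -> disc R w ->
  `|(z.1 : R) - w.1| <= kdist z w /\ `|(z.2 : R) - w.2| <= kdist z w.
Proof.
move=> zD wD; have := mulr_gt0 (one_sub_sqr_gt0 zD) (one_sub_sqr_gt0 wD).
have := sqr_kdist_dist z w; set X := (_ * _) => kE X0.
split; rewrite -(@ler_pXn2r _ 2) ?nnegrE ?kdist_ge0// real_normK ?num_real//.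
  by rewrite kE -addrA lerDl addr_ge0 ?sqr_ge0// ltW.
by rewrite kE addrAC lerDr addr_ge0 ?sqr_ge0// ltW.
Qed.

End cmod_theory.

(** * Measurability of complex functions *)

Section complex_measurable.
Context d (T : measurableType d) (R : realType).
Variable D : set T.
Implicit Types (f g : T -> R[i]).

(** On the disc this is the measurability required of the elements of L^p; the
    kernels need it on the product of two discs. *)
Definition cmeas f := measurable_fun D (fun x => complex.Re (f x) : R) /\
  measurable_fun D (fun x => complex.Im (f x) : R).

Lemma cmeas_ext f g : f =1 g -> cmeas f -> cmeas g.
Proof. by move=> /funext ->. Qed.

Lemma cmeas_real (h : T -> R) : measurable_fun D h -> cmeas (fun x => (h x)%:C).
Proof. by move=> mh; split => //=; exact: measurable_cst. Qed.

Lemma cmeas_cst (c : R[i]) : cmeas (fun=> c).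
Proof. by split; exact: measurable_cst. Qed.

Lemma cmeas_one_sub f : cmeas f -> cmeas (fun x => 1 - f x).
Proof.
move=> [f1 f2]; split.
  by under eq_fun do rewrite ReB; apply: measurable_funB.
by under eq_fun do rewrite ImB /= sub0r; exact: measurableT_comp.
Qed.

Lemma cmeasM f g : cmeas f -> cmeas g -> cmeas (fun x => f x * g x).
Proof.
move=> [f1 f2] [g1 g2]; split.
  under eq_fun do rewrite Re_mul.
  by apply: measurable_funB; exact: measurable_funM.
under eq_fun do rewrite Im_mul.
by apply: measurable_funD; exact: measurable_funM.
Qed.

Lemma cmeasX f n : cmeas f -> cmeas (fun x => f x ^+ n).
Proof.
move=> mf; elim: n => [|n IH]; first exact: cmeas_cst.
by apply: (@cmeas_ext (fun x => f x * f x ^+ n)) => [x|]; rewrite ?exprS//; exact: cmeasM.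
Qed.

Lemma cmeas_conj f : cmeas f -> cmeas (fun x => (f x)^*).
Proof.
move=> [f1 f2]; split.
  by rewrite (_ : (fun _ => _) = (fun x => complex.Re (f x) : R))//; apply/funext => x; case: (f x).
rewrite (_ : (fun _ => _) = (fun x => - complex.Im (f x) : R)).
  exact: measurableT_comp.
by apply/funext => x; case: (f x).
Qed.

Lemma cmeas_cmod f : cmeas f -> measurable_fun D (fun x => cmod (f x)).
Proof.
move=> [f1 f2]; under eq_fun do rewrite cmodE.
apply: (@measurableT_comp _ _ _ _ _ _ (@Num.sqrt R)).
  by apply: continuous_measurable_fun; exact: sqrt_continuous.
by apply: measurable_funD; exact: measurable_funX.
Qed.

Lemma measurable_fun_powR (h : T -> R) t :
  measurable_fun D h -> measurable_fun D (fun x => h x `^ t).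
Proof. exact: (measurableT_comp (measurable_powR t)). Qed.

Lemma measurable_fun_inv (h : T -> R) : measurable_fun D h ->
  (forall x, 0 <= h x) -> measurable_fun D (fun x => (h x)^-1).
Proof.
move=> mh h0; under eq_fun do rewrite -powR_inv1//.
exact: measurable_fun_powR.
Qed.

Lemma complex_invE (u : R[i]) : u^-1 = (cmod u ^+ 2)^-1%:C * u^*.
Proof.
have [->|u0] := eqVneq u 0; first by rewrite invr0 conjE/= oppr0 mulr0.
apply: (mulfI u0); rewrite divff// mulrCA mul_conj -rmorphM mulVf//.
by rewrite sqrf_eq0 cmod_eq0.
Qed.

Lemma cmeasV f : cmeas f -> cmeas (fun x => (f x)^-1).
Proof.
move=> mf; apply: (@cmeas_ext (fun x => (cmod (f x) ^+ 2)^-1%:C * (f x)^*)).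
  by move=> x; rewrite complex_invE.
apply: cmeasM; last exact: cmeas_conj.
apply: cmeas_real; apply: measurable_fun_inv => [|x]; last exact: sqr_ge0.
by apply: measurable_funX; exact: cmeas_cmod.
Qed.

End complex_measurable.

Section pairing.
Variable R : realType.

Definition pairing (u : plane R * plane R) : R[i] := cplx u.1 * (cplx u.2)^*.

Lemma cmeas_cplx d (T : measurableType d) (D : set T) (f : T -> plane R) :
  measurable_fun D f -> cmeas D (fun x => cplx (f x)).
Proof.
move=> mf; split.
  exact: (measurableT_comp measurable_fst mf).
exact: (measurableT_comp measurable_snd mf).
Qed.

Lemma cmeas_pairing D : cmeas D pairing.
Proof.
apply: cmeasM; last apply: cmeas_conj; apply: cmeas_cplx; apply: measurable_funTS.
  exact: measurable_fst.
exact: measurable_snd.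
Qed.

End pairing.

(** * Carleson boxes *)

Section disc_integrals.
Variable R : realType.
Implicit Types (x y s r t : R) (z w : plane R).
Local Notation leb := (@lebesgue_measure R).
Local Notation leb2 := (@prod_leb R).
Local Notation nz z := (cmod (cplx z)).

Lemma measurable_kdist2 :
  measurable_fun setT (fun u : plane R * plane R => kdist u.1 u.2).
Proof.
apply: (@cmeas_cmod _ _ _ _ (fun u => 1 - pairing u)).
by apply: cmeas_one_sub; exact: cmeas_pairing.
Qed.

Lemma measurable_kdist z : measurable_fun setT (kdist z).
Proof.
rewrite (_ : kdist z = (fun u : plane R * plane R => kdist u.1 u.2) \o pair z)//.
exact: measurableT_comp measurable_kdist2 (measurable_pair1 z).
Qed.

Lemma measurable_one_sub_sqr : measurable_fun setT (fun w => 1 - nz w ^+ 2).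
Proof.
apply: measurable_funB; first exact: measurable_cst.
by apply: measurable_funX; exact: measurable_cmod_cplx.
Qed.

Lemma lebesgue_measure_le_itv (S : set (measurableTypeR R)) x r : measurable S ->
  0 <= r -> S `<=` `[x, x + r]%classic -> (leb S <= r%:E)%E.
Proof.
move=> mS r0 Sx; apply: le_trans (le_measure _ _ _ Sx) _; rewrite ?inE//.
rewrite /= lebesgue_measure_itv/= lte_fin ltrDl; case: ifPn => // _.
by rewrite -EFinB lee_fin addrAC subrr add0r.
Qed.

(** Away from the x-axis, a vertical line meets the annulus
    1 - s <= |w|^2 <= 1 in two segments of length at most s, because the
    square root is 1-Lipschitz on [1/4, 1]. *)
Lemma annulus_slice (S : set (measurableTypeR R)) x s : measurable S -> 0 < s ->
  (forall y, S y -> [/\ 2^-1 <= `|y|, x ^+ 2 + y ^+ 2 <= 1 &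
     1 - s <= x ^+ 2 + y ^+ 2]) ->
  (leb S <= (2 * s)%:E)%E.
Proof.
move=> mS s0 Sy; pose Y := Num.sqrt (1 - x ^+ 2).
have SY : S `<=` `[Y - s, Y - s + s]%classic `|` `[- Y, - Y + s]%classic.
  move=> y /Sy[y1 y2 y3]; have x1 : 0 <= 1 - x ^+ 2.
    by rewrite subr_ge0; apply: le_trans y2; rewrite lerDl sqr_ge0.
  have Y0 : 0 <= Y by rewrite sqrtr_ge0.
  have YY : Y ^+ 2 = 1 - x ^+ 2 by rewrite sqr_sqrtr.
  have yY : `|y| <= Y.
    rewrite -(@ler_pXn2r _ 2) ?nnegrE// real_normK ?num_real// YY lerBrDl//.
  have Ys : Y - `|y| <= s.
    apply: (@le_trans _ _ ((Y - `|y|) * (Y + `|y|))).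
      rewrite ler_peMr ?subr_ge0//; lra.
    rewrite -subr_sqr YY real_normK ?num_real//; lra.
  have [y0|y0] := leP 0 y.
    by left; rewrite /= in_itv/=; rewrite ger0_norm// in yY Ys; lra.
  by right; rewrite /= in_itv/=; rewrite ltr0_norm// in yY Ys; lra.
apply: le_trans (le_measure _ _ _ SY) _; rewrite ?inE//; first exact: measurableU.
apply: le_trans (measureU2 _ _ _) _ => //.
rewrite mulr_natl mulr2n EFinD.
by apply: leeD; apply: (lebesgue_measure_le_itv _ (ltW s0)) => //; exact: subset_refl.
Qed.

Definition carleson z s r : set (plane R) :=
  disc R `&` [set w | kdist z w <= r] `&` [set w | 1 - nz w ^+ 2 <= s].

Lemma measurable_le_set d (T : measurableType d) (f : T -> R) r :
  measurable_fun setT f -> measurable [set u | f u <= r].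
Proof.
move=> mf; rewrite (_ : [set u | f u <= r] = setT `&` f @^-1` `]-oo, r]).
  exact: mf.
by rewrite setTI; apply/seteqP; split => w /=; rewrite in_itv.
Qed.

Lemma measurable_ge_set d (T : measurableType d) (f : T -> R) r :
  measurable_fun setT f -> measurable [set u | r <= f u].
Proof.
move=> mf; rewrite (_ : [set u | r <= f u] = [set u | - f u <= - r]).
  by apply: measurable_le_set; exact: measurableT_comp.
by apply/seteqP; split => w /=; rewrite lerN2.
Qed.

Lemma measurable_carleson z s r : measurable (carleson z s r).
Proof.
apply: measurableI; first apply: measurableI.
- exact: measurable_disc.
- by apply: measurable_le_set; exact: measurable_kdist.
- by apply: measurable_le_set; exact: measurable_one_sub_sqr.
Qed.

(** The box lies in a square of side 2 r and in an annulus of width s. A vertical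
    chord of the annulus has length O(s) only where |y| > 1/2, and a
    horizontal one where |x| > 1/2; for small s every point of the box is in one
    of these two regions, and each is sliced in its own direction. *)
Lemma carleson_area z s r : disc R z -> 0 < s -> 0 < r ->
  (leb2 (carleson z s r) <= (16 * r * s)%:E)%E.
Proof.
move=> zD s0 r0.
have mC := measurable_carleson z s r.
pose I x := (`[x - r, x - r + 2 * r]%classic : set (measurableTypeR R)).
have lI x : leb (I x) = (2 * r)%:E.
  rewrite /I /= lebesgue_measure_itv/= lte_fin ltrDl mulr_gt0//.
  by rewrite -EFinB addrAC subrr add0r.
have mI x : measurable (I x) by exact: measurable_itv.
have CI1 w : carleson z s r w -> I z.1 w.1.
  move=> [[wD wr] _]; have [+ _] := kdist_ge_dist zD wD.
  by rewrite /I /= in_itv/= ler_norml; move: wr => /=; lra.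
have CI2 w : carleson z s r w -> I z.2 w.2.
  move=> [[wD wr] _]; have [_] := kdist_ge_dist zD wD.
  by rewrite /I /= in_itv/= ler_norml; move: wr => /=; lra.
have disc1 w : disc R w -> (w.1 : R) ^+ 2 + (w.2 : R) ^+ 2 < 1.
  by move=> wD; rewrite -sqr_cmod_cplx expr_lt1// cmod_ge0.
have [s4|s4] := leP 4^-1 s.
  (* in a thick annulus, a chord of the disc has length at most 2 <= 8 s *)
  apply: (@le_trans _ _ (2%:E * leb (I z.1))%E).
    apply: prod_leb_xslice_le => // x _.
    apply: (@lebesgue_measure_le_itv _ (-1)) => //; first exact: measurable_xsection.
    move=> y; rewrite /xsection/= inE => -[[/disc1 /= xy _] _].
    by rewrite in_itv/=; apply/andP; split; nra.
  by rewrite lI -EFinM lee_fin; nra.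
pose E1 := carleson z s r `&` ~` [set w | `|w.2 : R| <= 2^-1].
pose E2 := carleson z s r `&` ~` [set w | `|w.1 : R| <= 2^-1].
have mE1 : measurable E1.
  apply: measurableI => //; apply: measurableC; apply: measurable_le_set.
  by apply: measurableT_comp => //; exact: measurable_snd.
have mE2 : measurable E2.
  apply: measurableI => //; apply: measurableC; apply: measurable_le_set.
  by apply: measurableT_comp => //; exact: measurable_fst.
have CE : carleson z s r `<=` E1 `|` E2.
  move=> w wC; have [w2|w2] := leP (`|w.2 : R|) (2^-1); last first.
    by left; split => //=; apply/negP; rewrite -ltNge.
  right; split => //=; apply/negP; rewrite -ltNge ltNge; apply/negP => w1.
  move: wC => [_ /=]; rewrite sqr_cmod_cplx.
  have : `|w.1 : R| ^+ 2 <= 2^-1 ^+ 2 by rewrite ler_pXn2r ?nnegrE.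
  have : `|w.2 : R| ^+ 2 <= 2^-1 ^+ 2 by rewrite ler_pXn2r ?nnegrE.
  rewrite !real_normK ?num_real//; lra.
apply: le_trans (le_measure _ _ _ CE) _; rewrite ?inE//; first exact: measurableU.
apply: le_trans (measureU2 _ _ _) _ => //.
apply: (@le_trans _ _ ((2 * s)%:E * leb (I z.1) + (2 * s)%:E * leb (I z.2))%E).
  apply: leeD.
    apply: prod_leb_xslice_le => //; first by rewrite mulr_ge0// ltW.
    - by move=> w [/CI1].
    move=> x _; apply: (@annulus_slice _ x) => //; first exact: measurable_xsection.
    move=> y; rewrite /xsection/= inE => -[[[/disc1/= xy _]]].
    rewrite sqr_sqrtr ?addr_ge0 ?sqr_ge0// => xys /negP; rewrite -ltNge => y2.
    by split; lra.
  apply: prod_leb_yslice_le => //; first by rewrite mulr_ge0// ltW.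
  - by move=> w [/CI2].
  move=> y _; apply: (@annulus_slice _ y) => //; first exact: measurable_ysection.
  move=> x; rewrite /ysection/= inE => -[[[/disc1/= xy _]]].
  rewrite sqr_sqrtr ?addr_ge0 ?sqr_ge0// => xys /negP; rewrite -ltNge => y2.
    by split; lra.
by rewrite !lI -!EFinM -EFinD lee_fin; nra.
Qed.

End disc_integrals.

(** * Forelli-Rudin estimates *)

Section forelli_rudin.
Variable R : realType.
Implicit Types (x y s r t c e : R) (z w : plane R).
Local Notation leb2 := (@prod_leb R).
Local Notation nz z := (cmod (cplx z)).

Lemma disc_square r : 0 < r ->
  (leb2 (disc R `&` [set w | (nz w <= r)%R]) <= (4 * r `^ 2)%:E)%E.
Proof.
move=> r0; pose I := (`[- r, r]%classic : set (measurableTypeR R)).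
have mI : measurable I by exact: measurable_itv.
apply: (@le_trans _ _ (leb2 (I `*` I))).
  apply: le_measure; rewrite ?inE.
  - apply: measurableI; first exact: measurable_disc.
    by apply: measurable_le_set; exact: measurable_cmod_cplx.
  - exact: measurableX.
  move=> w [_ /= wr]; split; rewrite /I /= in_itv/= -ler_norml.
    exact: le_trans (normr_Re_le (cplx w)) wr.
  exact: le_trans (normr_Im_le (cplx w)) wr.
rewrite prod_leb_rect// /I lebesgue_measure_itv/= lte_fin gtrN//.
by rewrite -EFinB -EFinM lee_fin powR_mulrn ?(ltW r0)//; nra.
Qed.

Lemma disc_powR_integral e : -2 < e -> exists2 C, 0 <= C &
  (\int[leb2]_(w in disc R) (nz w `^ e)%:E <= C%:E)%E.
Proof.
move=> e2; have e20 : 0 < e + 2 by rewrite -ltrBlDr sub0r.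
eexists; last first.
  apply: (@layers_power _ _ _ leb2 (disc R) (fun w => nz w) 1 e 2 4) => //.
  - exact: measurable_disc.
  - by apply: measurable_funTS; exact: measurable_cmod_cplx.
  - by move=> w wD; rewrite cmod_ge0 ltW.
  - exact: disc_square.
rewrite divr_ge0 ?mulr_ge0 ?powR_ge0// subr_ge0 ltW//.
exact: powR_half_lt1.
Qed.

(** Layers of 1 - |w|^2, which is at most 2 r on the box: the layer of height s
    has area O(r s) by [carleson_area]. *)
Lemma carleson_integral t : -1 < t -> exists2 C, 0 <= C &
  forall z r, disc R z -> 0 < r ->
  (\int[leb2]_(w in disc R `&` [set w | (kdist z w <= r)%R])
     ((1 - nz w ^+ 2) `^ t)%:E <= (C * r `^ (t + 2))%:E)%E.
Proof.
move=> t1; have t10 : 0 < t + 1 by rewrite -ltrBlDr sub0r.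
exists (2 `^ `|t| * 16 * 2 `^ (t + 1) / (1 - 2^-1 `^ (t + 1))).
  rewrite divr_ge0 ?mulr_ge0 ?powR_ge0// subr_ge0 ltW//.
  exact: powR_half_lt1.
move=> z r zD r0.
have mE : measurable (disc R `&` [set w | kdist z w <= r]).
  apply: measurableI; first exact: measurable_disc.
  by apply: measurable_le_set; exact: measurable_kdist.
apply: le_trans (@layers_power _ _ _ leb2 _ (fun w => 1 - nz w ^+ 2) (2 * r) t 1
    (16 * r) mE _ _ _ _ _ _) _ => //.
- by apply: measurable_funTS; exact: measurable_one_sub_sqr.
- by rewrite mulr_gt0.
- by rewrite mulr_ge0// ltW.
- move=> w [wD /= wr]; rewrite ltW ?one_sub_sqr_gt0//=.
  apply: le_trans (one_sub_sqr_le wD) _; rewrite ler_pM2l//.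
  exact: le_trans (kdist_ge _ zD) wr.
- by move=> s s0; rewrite powRr1 ?(ltW s0)//; exact: carleson_area.
rewrite lee_fin powRM ?(ltW r0)// le_eqVlt; apply/predU1P; left.
rewrite (_ : t + 2 = 1 + (t + 1)); last by ring.
rewrite [r `^ (1 + _)]powRD ?(gt_eqF r0) ?implybT// powRr1 ?(ltW r0)//.
by ring.
Qed.

(** Layers of |1 - z w^*|, which is at least 1 - |z|: the layer at distance r
    contributes r^(t + 2) r^-(2 + t + c) = r^-c by [carleson_integral], so that
    the first layer dominates. *)
Lemma forelli_rudin_disc t c : -1 < t -> 0 < c -> exists2 C, 0 <= C &
  forall z, disc R z ->
  (\int[leb2]_(w in disc R)
     ((1 - nz w ^+ 2) `^ t * kdist z w `^ (- (2 + t + c)))%:E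
   <= (C * (1 - nz z ^+ 2) `^ (- c))%:E)%E.
Proof.
move=> t1 c0; have [M M0 Mle] := carleson_integral t1.
have tk : - (2 + t + c) + (t + 2) = - c by ring.
exists (2 `^ `|- (2 + t + c)| * M / (1 - 2 `^ (- c))).
  rewrite divr_ge0 ?mulr_ge0 ?powR_ge0// subr_ge0 ltW//.
  rewrite powRN -powR_inv1 ?powR_ge0// -powRrM mulrC powRrM.
  by rewrite powR_inv1// powR_half_lt1.
move=> z zD.
have z1 : 0 < 1 - nz z by rewrite subr_gt0.
apply: le_trans (@layers_integral_large _ _ _ leb2 _
    (fun w => (1 - nz w ^+ 2) `^ t) (kdist z) (1 - nz z)
    (- (2 + t + c)) (t + 2) M (@measurable_disc R) _ _ _ _ _ _ _ _) _ => //.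
- apply: measurable_funTS; apply: measurable_fun_powR.
  exact: measurable_one_sub_sqr.
- by apply: measurable_funTS; exact: measurable_kdist.
- by move=> w _; rewrite powR_ge0.
- by move=> r r0; exact: Mle.
- by rewrite tk oppr_lt0.
- by move=> w wD; rewrite kdistC; exact: kdist_ge.
rewrite tk lee_fin [leRHS]mulrAC.
rewrite ler_wpM2r ?invr_ge0 ?subr_ge0//; last first.
  rewrite ler_wpM2l ?mulr_ge0 ?powR_ge0//.
  rewrite !powRN lef_pV2 ?posrE ?powR_gt0 ?mulr_gt0 ?one_sub_sqr_gt0//.
  rewrite ge0_ler_powR ?nnegrE ?(ltW c0) ?(ltW (one_sub_sqr_gt0 zD)) ?mulr_ge0 ?(ltW z1)//.
  exact: one_sub_sqr_le.
rewrite powRN -powR_inv1 ?powR_ge0// -powRrM mulrC powRrM.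
by rewrite powR_inv1// ltW// powR_half_lt1.
Qed.

(** The weight |w|^e only matters near the origin, where the other two
    factors are bounded. *)
Lemma forelli_rudin e t c : -2 < e -> -1 < t -> 0 < c -> exists2 C, 0 <= C &
  forall z, disc R z ->
  (\int[leb2]_(w in disc R)
     (nz w `^ e * ((1 - nz w ^+ 2) `^ t * kdist z w `^ (- (2 + t + c))))%:E
   <= (C * (1 - nz z ^+ 2) `^ (- c))%:E)%E.
Proof.
move=> e2 t1 c0; have [C1 C10 C1le] := disc_powR_integral e2.
have [C2 C20 C2le] := forelli_rudin_disc t1 c0.
have mD : measurable (disc R) by exact: measurable_disc.
pose T := 2 + t + c; have T0 : 0 < T by rewrite /T; lra.
pose K1 := 2 `^ `|t| * 2 `^ T; pose K2 : R := 2 `^ `|e|.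
have K10 : 0 <= K1 by rewrite mulr_ge0 ?powR_ge0.
have K20 : 0 <= K2 by rewrite powR_ge0.
have mnz s : measurable_fun (disc R) (fun w => nz w `^ s).
  by apply: measurable_funTS; apply: measurable_fun_powR; exact: measurable_cmod_cplx.
exists (K1 * C1 + K2 * C2); first by rewrite addr_ge0 ?mulr_ge0.
move=> z zD.
have mk : measurable_fun (disc R)
    (fun w => (1 - nz w ^+ 2) `^ t * kdist z w `^ (- (2 + t + c))).
  apply: measurable_funM; apply: measurable_funTS; apply: measurable_fun_powR.
    exact: measurable_one_sub_sqr.
  exact: measurable_kdist.
apply: (@le_trans _ _ (\int[leb2]_(w in disc R)
  ((K1 * nz w `^ e)%:E +
   (K2 * ((1 - nz w ^+ 2) `^ t * kdist z w `^ (- (2 + t + c))))%:E))%E).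
  apply: ge0_le_integral => //.
  - by move=> w _; rewrite lee_fin !mulr_ge0 ?powR_ge0.
  - by apply/measurable_EFinP; exact: measurable_funM.
  - by apply: emeasurable_funD; apply/measurable_EFinP; exact: measurable_funM.
  move=> w wD; rewrite -EFinD lee_fin.
  have kw := kdist_gt0 zD wD; have ow := one_sub_sqr_gt0 wD.
  have [w2|w2] := leP (nz w) 2^-1.
    apply: (@le_trans _ _ (K1 * nz w `^ e)); last first.
      by rewrite lerDl !mulr_ge0 ?powR_ge0.
    rewrite mulrC ler_wpM2r ?powR_ge0//; apply: ler_pM; rewrite ?powR_ge0//.
      apply: powR_half_one; last exact: one_sub_sqr_le1.
      have : nz w ^+ 2 <= 2^-1 ^+ 2 by rewrite ler_pXn2r ?nnegrE ?cmod_ge0.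
      lra.
    rewrite powRN invf_ple ?posrE ?powR_gt0// -powRN.
    rewrite -/T powRN -powR_inv1 ?powR_ge0// -powRrM mulrC powRrM powR_inv1//.
    rewrite ge0_ler_powR ?nnegrE ?invr_ge0 ?(ltW T0) ?(ltW kw)//.
    by apply: le_trans (kdist_ge w zD); lra.
  apply: (@le_trans _ _ (K2 * ((1 - nz w ^+ 2) `^ t * kdist z w `^ (- (2 + t + c)))));
    last by rewrite lerDr !mulr_ge0 ?powR_ge0.
  rewrite ler_wpM2r ?mulr_ge0 ?powR_ge0//.
  have wlt1 : nz w < 1 by [].
  by apply: powR_half_one; exact: ltW.
rewrite ge0_integral_lincomb ?mulr_ge0//; last 2 first.
- by move=> w; exact: powR_ge0.
- by move=> w; rewrite mulr_ge0 ?powR_ge0.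
rewrite mulrDl EFinD; apply: leeD.
  apply: (@le_trans _ _ (K1%:E * C1%:E)%E); first by rewrite lee_wpmul2l.
  rewrite -EFinM lee_fin ler_peMr ?mulr_ge0// powRN.
  rewrite invf_ge1 ?powR_gt0 ?one_sub_sqr_gt0//.
  apply: (@le_trans _ _ (1 `^ c)); last by rewrite powR1.
  by rewrite ge0_ler_powR ?nnegrE ?one_sub_sqr_le1 ?(ltW c0) ?(ltW (one_sub_sqr_gt0 zD)).
by rewrite -mulrA EFinM lee_wpmul2l ?lee_fin//; exact: C2le.
Qed.

End forelli_rudin.

(** * The beta integral *)

Section euler_beta_pos.
Variable R : realType.
Implicit Types (x y r t e : R).
Local Notation leb := (@lebesgue_measure R).
Local Notation I01 := (`]0, 1[%classic : set (measurableTypeR R)).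

Let mI01 : measurable I01. Proof. exact: measurable_itv. Qed.

Let power_integral (g : measurableTypeR R -> R) e : -1 < e -> measurable_fun I01 g ->
  (forall t, I01 t -> 0 <= g t <= 1) ->
  (forall r, 0 < r -> (leb (I01 `&` [set t | (g t <= r)%R]) <= r%:E)%E) ->
  (\int[leb]_(t in I01) (g t `^ e)%:E < +oo)%E.
Proof.
move=> e1 mg g01 gr; have e10 : 0 < e + 1 by rewrite -ltrBlDr sub0r.
apply: le_lt_trans (@layers_power _ _ _ leb I01 g 1 e 1 1 mI01 _ _ _ _ _ _)
  (ltry _) => // r r0.
by rewrite mul1r powRr1 ?(ltW r0)//; exact: gr.
Qed.

Let beta_integrand x y (t : measurableTypeR R) : R := t `^ (x - 1) * (1 - t) `^ (y - 1).

Let m1t : measurable_fun I01 (fun t : measurableTypeR R => 1 - t).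
Proof. by apply: measurable_funB => //; exact: measurable_id. Qed.

Let mpow x : measurable_fun I01 (fun t : measurableTypeR R => t `^ x).
Proof. by apply: measurable_fun_powR; exact: measurable_id. Qed.

Let mpow1 x : measurable_fun I01 (fun t : measurableTypeR R => (1 - t) `^ x).
Proof. exact: measurable_fun_powR. Qed.

Let mbeta x y : measurable_fun I01 (beta_integrand x y).
Proof. exact: measurable_funM. Qed.

(** On each half of the interval one factor is bounded and the other is a power
    with exponent above -1. *)
Lemma beta_integral_lty x y : 0 < x -> 0 < y ->
  (\int[leb]_(t in I01) (beta_integrand x y t)%:E < +oo)%E.
Proof.
move=> x0 y0; pose C := 2 `^ `|y - 1| : R; pose D := 2 `^ `|x - 1| : R.
apply: (@le_lt_trans _ _ (\int[leb]_(t in I01)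
  ((C * t `^ (x - 1))%:E + (D * (1 - t) `^ (y - 1))%:E))%E).
  apply: ge0_le_integral => //.
  - by move=> t _; rewrite lee_fin mulr_ge0 ?powR_ge0.
  - exact/measurable_EFinP.
  - by apply: emeasurable_funD; apply/measurable_EFinP; exact: measurable_funM.
  move=> t; rewrite /= in_itv/= => /andP[t0 t1]; rewrite -EFinD lee_fin.
  have [t2|t2] := leP t 2^-1.
    apply: (@le_trans _ _ (C * t `^ (x - 1))); last first.
      by rewrite lerDl mulr_ge0 ?powR_ge0.
    rewrite /beta_integrand mulrC ler_wpM2r ?powR_ge0//.
    by apply: powR_half_one; lra.
  apply: (@le_trans _ _ (D * (1 - t) `^ (y - 1))); last first.
    by rewrite lerDr mulr_ge0 ?powR_ge0.
  rewrite /beta_integrand ler_wpM2r ?powR_ge0//.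
  by apply: powR_half_one; lra.
rewrite ge0_integral_lincomb ?powR_ge0//; last 2 first.
- by move=> t; exact: powR_ge0.
- by move=> t; exact: powR_ge0.
rewrite lte_add_pinfty// lte_mul_pinfty ?lee_fin ?powR_ge0//.
  apply: power_integral; first by rewrite ltrBrDr addNr.
  - exact: measurable_id.
  - by move=> t; rewrite /= in_itv/= => /andP[t0 t1]; rewrite !ltW.
  move=> r r0; apply: (@lebesgue_measure_le_itv _ _ 0); rewrite ?(ltW r0)//.
    apply: measurableI => //; apply: measurable_le_set; exact: measurable_id.
  move=> t [/=]; rewrite !in_itv/= => /andP[t0 t1] tr.
  by rewrite (ltW t0) add0r.
apply: power_integral; first by rewrite ltrBrDr addNr.
- exact: m1t.
- by move=> t; rewrite /= in_itv/= => /andP[t0 t1]; lra.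
move=> r r0; apply: (@lebesgue_measure_le_itv _ _ (1 - r)); rewrite ?(ltW r0)//.
  apply: measurableI => //; apply: measurable_le_set.
  by apply: measurable_funB => //; exact: measurable_id.
move=> t [/=]; rewrite !in_itv/= => /andP[t0 t1] tr; lra.
Qed.

(** The real-valued integral of a function with infinite integral is 0, so that
    positivity rests on [beta_integral_lty]. *)
Lemma euler_beta_gt0 x y : 0 < x -> 0 < y -> 0 < euler_beta x y.
Proof.
move=> x0 y0; have fin := beta_integral_lty x0 y0.
have -> : euler_beta x y =
  fine (\int[leb]_(t in I01) (beta_integrand x y t)%:E)%E by [].
rewrite fine_gt0// fin andbT; apply: integral_gt0 => //.
  by rewrite /= lebesgue_measure_itv/= lte_fin ltr01 sube0 lte_fin ltr01.
move=> t; rewrite /= in_itv/= => /andP[t0 t1].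
by rewrite mulr_gt0 ?powR_gt0// subr_gt0.
Qed.

End euler_beta_pos.

(** * The measures mu_{a,b} *)

Section mu_disc_theory.
Variable R : realType.
Implicit Types (a b e t c : R) (z w : plane R).
Local Notation leb2 := (@prod_leb R).
Local Notation nz z := (cmod (cplx z)).

Let mD : measurable (disc R). Proof. exact: measurable_disc. Qed.
#[local] Hint Resolve measurable_plane_set1 : core.

Lemma mu_discE a b (A : set (plane R)) : measurable A -> (mu_disc a b A =
  \int[leb2]_(z in A `&` disc R) (pi^-1 * weight a b z)%:E)%E.
Proof.
move=> mA; have mAD : measurable (A `&` disc R) by exact: measurableI.
rewrite /mu_disc integral_area//.
- rewrite -ge0_integralZl_EFin ?invpi_ge0//.
  + by move=> z _; rewrite lee_fin weight_ge0.
  + by apply/measurable_EFinP; apply: measurable_funTS; exact: measurable_weight.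
- by apply/measurable_EFinP; apply: measurable_funTS; exact: measurable_weight.
- by move=> z _; rewrite lee_fin weight_ge0.
Qed.

Lemma integral_mu_disc a b (f : plane R -> \bar R) : measurable_fun (disc R) f ->
  (forall z, disc R z -> 0 <= f z)%E ->
  (\int[mu_disc a b]_(z in disc R) f z =
   \int[leb2]_(z in disc R) (f z * (pi^-1 * weight a b z)%:E))%E.
Proof.
move=> mf f0; rewrite (@ge0_integral_density_dom _ _ _ leb2 _ _
  (fun z => pi^-1 * weight a b z))//.
- apply: measurable_funM => //; apply: measurable_funTS; exact: measurable_weight.
- by move=> z _; rewrite mulr_ge0 ?invpi_ge0 ?weight_ge0.
- exact: mu_discE.
Qed.

Lemma mu_disc_set1 a b z : mu_disc a b [set z] = 0%E.
Proof.
rewrite mu_discE//; have mz : measurable ([set z] `&` disc R).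
  exact: measurableI.
have mw : measurable_fun ([set z] `&` disc R) (fun z => (pi^-1 * weight a b z)%:E).
  apply/measurable_EFinP; apply: measurable_funM => //.
  by apply: measurable_funTS; exact: measurable_weight.
rewrite -(@integral_abs_eq0 _ _ _ leb2 ([set z] `&` disc R) _ mz mw).
  apply: eq_integral => w _; rewrite gee0_abs// lee_fin.
  by rewrite mulr_ge0 ?invpi_ge0 ?weight_ge0.
apply: subset_measure0 (prod_leb_set1 z) => //; exact: subIsetl.
Qed.

Let mu_disc_sigma_finite a b : sigma_finite setT (mu_disc a b).
Proof.
exists (fun n => [set z | weight a b z <= n%:R]).
  apply/esym; rewrite -subTset => z _; exists (Num.truncn (weight a b z)).+1 => //=.
  by rewrite ltW// truncnS_gt.
move=> n; pose A := [set z | weight a b z <= n%:R].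
have mE : measurable A by apply: measurable_le_set; exact: measurable_weight.
split => //; rewrite mu_discE//.
apply: (@le_lt_trans _ _ (\int[leb2]_(z in disc R) (pi^-1 * n%:R)%:E)%E).
  apply: (@le_trans _ _ (\int[leb2]_(z in A `&` disc R)
     (pi^-1 * n%:R)%:E)%E).
    apply: ge0_le_integral => //.
    - exact: measurableI.
    - by move=> w _; rewrite lee_fin mulr_ge0 ?invpi_ge0 ?weight_ge0.
    - apply/measurable_EFinP; apply: measurable_funM => //.
      by apply: measurable_funTS; exact: measurable_weight.
    - by move=> w [/= wn _]; rewrite lee_fin ler_wpM2l ?invpi_ge0.
  apply: ge0_subset_integral => //; first exact: measurableI.
  by move=> w _; rewrite lee_fin mulr_ge0 ?invpi_ge0.
rewrite (integral_cst _ mD) lte_mul_pinfty// ?lee_fin ?mulr_ge0 ?invpi_ge0//.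
apply: le_lt_trans (ltry (4 * 1 `^ 2)); apply: le_trans (disc_square ltr01).
apply: le_measure; rewrite ?inE//.
  by apply: measurableI => //; apply: measurable_le_set; exact: measurable_cmod_cplx.
by move=> w wD; split => //=; exact: ltW.
Qed.

HB.instance Definition _ a b := Measure_isSigmaFinite.Build _ _ _
  (mu_disc a b) (mu_disc_sigma_finite a b).

(** The point 0 is null for every mu_{a,b}; on the punctured disc all powers
    of |z| and of 1 - |z|^2 are positive. *)
Definition pdisc : set (plane R) := disc R `\` [set ((0 : R), (0 : R))].

Lemma measurable_pdisc : measurable pdisc.
Proof. exact: measurableD. Qed.

Lemma pdisc_disc : pdisc `<=` disc R. Proof. by move=> z []. Qed.

Lemma pdisc_gt0 z : pdisc z -> 0 < nz z.
Proof.
move=> [_ z0]; rewrite lt_neqAle cmod_ge0 andbT eq_sym cmod_eq0.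
by apply/eqP; case: z z0 => x y /= z0 [x0 y0]; apply: z0; rewrite x0 y0.
Qed.

Lemma integral_pdisc a b (f : plane R -> \bar R) : measurable_fun (disc R) f ->
  (forall z, disc R z -> 0 <= f z)%E ->
  (\int[mu_disc a b]_(z in disc R) f z = \int[mu_disc a b]_(z in pdisc) f z)%E.
Proof. by move=> mf f0; apply: ge0_negligible_integral => //; exact: mu_disc_set1. Qed.

(** Equality fails for x = 0 when the exponents cancel, because 0 ^ 0 = 1. *)
Lemma powRM_le e t x : 0 <= x -> x `^ e * x `^ t <= x `^ (e + t).
Proof.
rewrite le_eqVlt => /predU1P[<-|x0]; last first.
  by rewrite -powRD ?(gt_eqF x0) ?implybT.
have [->|e0] := eqVneq e 0; first by rewrite powRr0 mul1r add0r.
by rewrite powR0// mul0r powR_ge0.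
Qed.

(** [forelli_rudin] with the density of mu_{a,b} absorbed in the exponents. *)
Lemma forelli_rudin_mu a b e t c : -2 < e + 2 * b -> -1 < t + a -> 0 < c ->
  exists2 C, 0 <= C & forall z, disc R z ->
  (\int[mu_disc a b]_(w in disc R)
     (nz w `^ e * ((1 - nz w ^+ 2) `^ t * kdist z w `^ (- (2 + (t + a) + c))))%:E
   <= (C * (1 - nz z ^+ 2) `^ (- c))%:E)%E.
Proof.
move=> eb ta c0; have [C C0 Cle] := forelli_rudin eb ta c0.
pose K := pi^-1 * (euler_beta (a + 1) (b + 1))^-1.
have K0 : 0 <= K.
  rewrite mulr_ge0 ?invpi_ge0// invr_ge0.
  by apply: Rintegral_ge0 => x _; rewrite mulr_ge0 ?powR_ge0.
exists (K * C); first by rewrite mulr_ge0.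
move=> z zD.
have mfun e' t' T : measurable_fun (disc R) (fun w =>
    (nz w `^ e' * ((1 - nz w ^+ 2) `^ t' * kdist z w `^ T))).
  apply: measurable_funTS; apply: measurable_funM.
    by apply: measurable_fun_powR; exact: measurable_cmod_cplx.
  apply: measurable_funM; apply: measurable_fun_powR.
    exact: measurable_one_sub_sqr.
  exact: measurable_kdist.
rewrite integral_mu_disc//; last 2 first.
- exact/measurable_EFinP.
- by move=> w _; rewrite lee_fin !mulr_ge0 ?powR_ge0.
rewrite -mulrA EFinM; apply: le_trans (lee_wpmul2l _ (Cle z zD)); last by rewrite lee_fin.
rewrite -ge0_integralZl_EFin; last 4 first.
- exact: mD.
- by move=> w _; rewrite lee_fin !mulr_ge0 ?powR_ge0.
- exact/measurable_EFinP.
- by [].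
apply: ge0_le_integral => //.
- by move=> w _; rewrite -EFinM lee_fin !(invpi_ge0, weight_ge0, mulr_ge0, powR_ge0).
- under eq_fun do rewrite -EFinM.
  apply/measurable_EFinP; apply: measurable_funM => //; apply: measurable_funM => //.
  by apply: measurable_funTS; exact: measurable_weight.
- by under eq_fun do rewrite -EFinM; apply/measurable_EFinP; exact: measurable_funM.
move=> w wD; rewrite -!EFinM lee_fin /weight.
set kk := kdist z w `^ _; set o := 1 - nz w ^+ 2.
rewrite [leLHS](_ : _ = K * ((nz w `^ e * nz w `^ (2 * b)) * ((o `^ t * o `^ a) * kk))); last first.
  by rewrite /K; ring.
rewrite ler_wpM2l// ler_pM ?mulr_ge0 ?powR_ge0 ?powRM_le ?cmod_ge0//.
by rewrite ler_wpM2r ?powR_ge0// powRM_le// ltW// one_sub_sqr_gt0.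
Qed.

(** The form in which the rows and columns of a kernel on the punctured disc
    appear. *)
Lemma forelli_rudin_pdisc a b e t c : -2 < e + 2 * b -> -1 < t + a -> 0 < c ->
  exists2 C, 0 <= C & forall z x (H : plane R -> R), disc R z -> 0 <= x ->
  (forall w, pdisc w -> H w = x * (nz w `^ e *
     ((1 - nz w ^+ 2) `^ t * kdist z w `^ (- (2 + (t + a) + c))))) ->
  (forall w, ~ pdisc w -> H w = 0) ->
  (\int[mu_disc a b]_w (H w)%:E <= (C * (x * (1 - nz z ^+ 2) `^ (- c)))%:E)%E.
Proof.
move=> eb ta c0; have [C C0 Cle] := forelli_rudin_mu eb ta c0.
exists C => // z x H zD x0 HD H0.
set h := fun w => nz w `^ e * ((1 - nz w ^+ 2) `^ t * kdist z w `^ (- (2 + (t + a) + c))).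
have mh : measurable_fun setT h.
  apply: measurable_funM; first by apply: measurable_fun_powR; exact: measurable_cmod_cplx.
  apply: measurable_funM; apply: measurable_fun_powR.
    exact: measurable_one_sub_sqr.
  exact: measurable_kdist.
have h0 w : 0 <= h w by rewrite !mulr_ge0 ?powR_ge0.
rewrite (_ : (\int[mu_disc a b]_w _)%E =
    (\int[mu_disc a b]_(w in pdisc) (x%:E * (h w)%:E))%E); last first.
  rewrite [RHS]integral_mkcond; apply: eq_integral => w _; rewrite patchE.
  by case: ifPn => [/set_mem/HD ->//|]; rewrite notin_setE => /H0 ->.
rewrite ge0_integralZl_EFin//; last 3 first.
- exact: measurable_pdisc.
- by move=> w _; rewrite lee_fin.
- by apply/measurable_EFinP; exact: measurable_funTS.
rewrite mulrCA EFinM; apply: le_trans (lee_wpmul2l _ (Cle z zD)); last by rewrite lee_fin.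
apply: lee_wpmul2l; first by rewrite lee_fin.
apply: ge0_subset_integral => //; first exact: measurable_pdisc.
- by apply/measurable_EFinP; exact: measurable_funTS.
- by move=> w _; rewrite lee_fin; exact: h0.
- exact: pdisc_disc.
Qed.

(** This is the Forelli-Rudin integral at z = 0, where the kernel is 1. *)
Lemma mu_disc_lty a b : -1 < a -> -1 < b -> (mu_disc a b (disc R) < +oo)%E.
Proof.
move=> a1 b1; have [||C C0 Cle] := @forelli_rudin_mu a b 0 0 1 _ _ ltr01; [lra..|].
have D0 : disc R ((0 : R), (0 : R)) by rewrite /disc /unit_disc /preimage/mkset (_ : cplx _ = 0)// cmod0 ltr01.
apply: le_lt_trans (ltry (C * (1 - nz ((0 : R), (0 : R)) ^+ 2) `^ (-1))).
apply: le_trans (Cle _ D0).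
rewrite -[leLHS]mul1e -(integral_cst _ mD).
rewrite le_eqVlt; apply/predU1P; left; apply: eq_integral => w _.
rewrite /kdist (_ : cplx ((0 : R), (0 : R)) = 0)// mul0r subr0 cmod1 !powRr0 !mul1r.
by rewrite powR1.
Qed.

End mu_disc_theory.

(** * Summability of the coefficients of Q *)

Section generalized_binomial.
Variable R : realType.
Implicit Types (s : R) (n k : nat).

Lemma gbinom0 s : gbinom s 0 = 1.
Proof. by rewrite /gbinom big_ord0 fact0 divr1. Qed.

Lemma gbinomS s n : n.+1%:R * gbinom s n.+1 = (s - n%:R) * gbinom s n.
Proof.
rewrite /gbinom big_ord_recr/= factS natrM invfM; field.
by rewrite addrC natr1 !pnatr_eq0 -lt0n fact_gt0.
Qed.

Lemma normr_gbinomS s n : s <= n%:R ->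
  s * `|gbinom s n| = n%:R * `|gbinom s n| - n.+1%:R * `|gbinom s n.+1|.
Proof.
move=> sn; have := congr1 Num.norm (gbinomS s n).
rewrite !normrM ger0_norm// [`|s - _|]ler0_norm ?subr_le0// => ->.
by rewrite -mulrBl opprB opprB addrC subrK.
Qed.

(** From the index s on, the terms telescope by [normr_gbinomS]. *)
Lemma gbinom_sum_bounded s : 0 < s ->
  exists2 M, 0 <= M & forall n, \sum_(k < n) `|gbinom s k| <= M.
Proof.
move=> s0; pose N := (Num.truncn s).+1.
have sN : s <= N%:R by rewrite ltW// truncnS_gt.
pose S n := \sum_(k < n) `|gbinom s k|.
have SN m : s * S (N + m)%N = s * S N +
    (N%:R * `|gbinom s N| - (N + m)%:R * `|gbinom s (N + m)|).
  elim: m => [|m IH]; first by rewrite addn0 subrr addr0.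
  rewrite addnS /S big_ord_recr/= -/(S _) mulrDr IH normr_gbinomS; first by rewrite -/(S N); ring.
  by apply: (le_trans sN); rewrite ler_nat leq_addr.
have Smono m n : (m <= n)%N -> S m <= S n.
  move=> mn; rewrite /S -(subnKC mn) big_split_ord/= lerDl; exact: sumr_ge0.
have N0 : 0 <= N%:R * `|gbinom s N| by rewrite mulr_ge0.
exists (S N + N%:R * `|gbinom s N| / s).
  by rewrite addr_ge0 ?divr_ge0 ?(ltW s0)// sumr_ge0.
move=> n; apply: (le_trans (Smono n (N + n)%N (leq_addl _ _))).
rewrite -(ler_pM2l s0) SN mulrDr lerD2l [s * (_ / s)]mulrC divfK ?gt_eqF// gerBl.
by rewrite mulr_ge0.
Qed.

End generalized_binomial.

Section Q_coefficients.
Variable R : realType.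
Implicit Types (s : R) (n k : nat).
Variable b0 : R.
Hypotheses (b0N1 : -1 < b0) (b00 : b0 < 0).

Definition Qcoef s n : R := b0 / (n%:R + b0) * gbinom s n.

Let nb0 n : (0 < n)%N -> 0 < n%:R + b0.
Proof.
case: n => // n _; rewrite -natr1 -addrA ltr_wpDl// ?ler0n//.
by rewrite addrC -ltrBlDr sub0r.
Qed.

Lemma Qcoef0 s : Qcoef s 0 = 1.
Proof. by rewrite /Qcoef gbinom0 add0r mulr1 divff// lt_eqF. Qed.

(** The factor b0 / (n + b0) is O(1 / n), which pays for a factor n: not only Q
    but also its derivative is given by an absolutely convergent series on the
    closed disc. *)
Lemma Qcoef_le s n : `|Qcoef s n| <= (1 + b0)^-1 * `|gbinom s n| /\
  n%:R * `|Qcoef s n| <= (1 + b0)^-1 * `|gbinom s n|.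
Proof.
have b1 : 0 < 1 + b0 by rewrite addrC -ltrBlDr sub0r.
case: n => [|n].
  rewrite Qcoef0 gbinom0 normr1 mul0r !mulr1 invr_ge0 (ltW b1) invf_ge1//.
  by split=> //; rewrite gerDl ltW.
have n0 := nb0 (ltn0Sn n).
rewrite /Qcoef (normrM _ (gbinom s n.+1)) normf_div (gtr0_norm n0) (ltr0_norm b00).
have nb : n.+1%:R * (1 + b0) <= n.+1%:R + b0.
  rewrite mulrDr mulr1 lerD2l -[leRHS]mul1r.
  by rewrite ler_nM2r// ler1n.
have H : n.+1%:R * (- b0 / (n.+1%:R + b0)) <= (1 + b0)^-1.
  rewrite mulrCA -[leRHS]mul1r; apply: ler_pM => //.
  - by rewrite oppr_ge0 ltW.
  - by rewrite divr_ge0// ltW.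
  - by rewrite lerNl ltW.
  - by rewrite ler_pdivrMr// ler_pdivlMl// mulrC.
have H1 : - b0 / (n.+1%:R + b0) <= (1 + b0)^-1.
  apply: le_trans H; rewrite ler_peMl ?ler1n// divr_ge0 ?oppr_ge0 ?(ltW n0)//.
  exact: ltW.
by split; last rewrite mulrA; apply: ler_wpM2r.
Qed.

Lemma Qcoef_sum_bounded s : 0 < s -> exists2 M, 0 <= M &
  forall n, \sum_(k < n) `|Qcoef s k| <= M /\
            \sum_(k < n) k%:R * `|Qcoef s k| <= M.
Proof.
move=> s0; have [M M0 Mle] := gbinom_sum_bounded s0.
have b1 : 0 <= (1 + b0)^-1 by rewrite invr_ge0 addrC -lerBlDr sub0r ltW.
exists ((1 + b0)^-1 * M); first by rewrite mulr_ge0.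
move=> n; split; apply: le_trans (ler_wpM2l b1 (Mle n)); rewrite mulr_sumr;
  by apply: ler_sum => k _; case: (Qcoef_le s k).
Qed.

Lemma bounded_series_cvg (u : R^nat) M :
  (forall n, \sum_(k < n) `|u k| <= M) -> cvgn (series u).
Proof.
move=> uM; apply: normed_cvg; apply: nondecreasing_is_cvgn.
  by apply/nondecreasing_series => k _ _ /=.
exists M => _ [n _ <-]; rewrite /= seriesEord; exact: uM.
Qed.

End Q_coefficients.

(** * Q on the closed disc *)

Section Q_series_theory.
Variable R : realType.
Implicit Types (s : R) (n k : nat) (x y xi eta : R[i]).

Lemma cmod_subX x y n : cmod x <= 1 -> cmod y <= 1 ->
  cmod (x ^+ n - y ^+ n) <= n%:R * cmod (x - y).
Proof.
move=> x1 y1; elim: n => [|n IH]; first by rewrite !expr0 subrr cmod0 mul0r.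
have -> : x ^+ n.+1 - y ^+ n.+1 = x * (x ^+ n - y ^+ n) + (x - y) * y ^+ n.
  by rewrite !exprS; ring.
apply: le_trans (cmodD _ _) _; rewrite !cmodM -natr1 mulrDl mul1r lerD//.
  by apply: le_trans IH; rewrite ler_piMl ?cmod_ge0.
by rewrite ler_piMr ?cmod_ge0// cmodX exprn_ile1 ?cmod_ge0.
Qed.

Lemma normr_lim_series_le (u : R^nat) (M : R) : cvgn (series u) ->
  (forall n, `|\sum_(k < n) u k| <= M) -> `|limn (series u)| <= M.
Proof.
move=> cu uM; rewrite ler_norml; apply/andP; split.
  apply: limr_ge => //; apply: nearW => n; rewrite seriesEord.
  by have := uM n; rewrite ler_norml => /andP[].
apply: limr_le => //; apply: nearW => n; rewrite seriesEord.
by have := uM n; rewrite ler_norml => /andP[].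
Qed.

Variables (b0 s M : R).
Hypotheses (b0N1 : -1 < b0) (b00 : b0 < 0) (s0 : 0 < s) (M0 : 0 <= M)
  (Mle : forall n, \sum_(k < n) `|Qcoef b0 s k| <= M /\
                   \sum_(k < n) k%:R * `|Qcoef b0 s k| <= M).

Section real_part.
Variable L : R[i] -> R.
Hypotheses (LB : forall u v, L (u - v) = L u - L v)
  (Lle : forall u, `|L u| <= cmod u).

(** L is the real or the imaginary part: the complex series is studied through
    these two real series. *)
Definition Qterm xi n := Qcoef b0 s n * L ((- xi) ^+ n).

Let normr_Qterm xi n : cmod xi <= 1 -> `|Qterm xi n| <= `|Qcoef b0 s n|.
Proof.
move=> xi1; rewrite normrM ler_piMr//; apply: le_trans (Lle _) _.
by rewrite cmodX cmodN exprn_ile1// cmod_ge0.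
Qed.

Lemma Qterm_sum_le xi n : cmod xi <= 1 -> \sum_(k < n) `|Qterm xi k| <= M.
Proof.
move=> xi1; have [+ _] := Mle n; apply: le_trans.
by apply: ler_sum => k _; exact: normr_Qterm.
Qed.

Lemma cvg_Qterm xi : cmod xi <= 1 -> cvgn (series (Qterm xi)).
Proof. by move=> xi1; apply: bounded_series_cvg => n; exact: Qterm_sum_le. Qed.

Definition Qlim xi := limn (series (Qterm xi)).

Lemma normr_Qlim xi : cmod xi <= 1 -> `|Qlim xi| <= M.
Proof.
move=> xi1; apply: normr_lim_series_le; first exact: cvg_Qterm.
by move=> n; apply: le_trans (ler_norm_sum _ _ _) _; exact: Qterm_sum_le.
Qed.

(** The power xi^n is n-Lipschitz on the closed disc, and n Qcoef(n) is
    summable. *)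
Lemma Qlim_lipschitz xi eta : cmod xi <= 1 -> cmod eta <= 1 ->
  `|Qlim xi - Qlim eta| <= M * cmod (xi - eta).
Proof.
move=> xi1 eta1; rewrite /Qlim -limB; [|exact: cvg_Qterm..].
have sE : series (Qterm xi) - series (Qterm eta) =
    series (fun n => Qterm xi n - Qterm eta n).
  apply/funext => n.
  rewrite [LHS](_ : _ = series (Qterm xi) n - series (Qterm eta) n)//.
  by rewrite !seriesEord -sumrB.
rewrite sE; apply: normr_lim_series_le.
  by rewrite -sE; apply: is_cvgB; exact: cvg_Qterm.
move=> n; apply: le_trans (ler_norm_sum _ _ _) _.
have [_ /(ler_wpM2r (cmod_ge0 (xi - eta)))] := Mle n; apply: le_trans.
rewrite mulr_suml; apply: ler_sum => k _.
rewrite /Qterm -mulrBr -LB normrM mulrC [_%:R * _]mulrC mulrAC -mulrA.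
rewrite [X in _ <= X]mulrC ler_wpM2r//; apply: le_trans (Lle _) _.
apply: le_trans (cmod_subX _ _ _) _; rewrite ?cmodN//.
by rewrite -opprD cmodN addrC mulrC.
Qed.

End real_part.

Definition Qfun xi : R[i] :=
  Qlim (@complex.Re R) xi +i* Qlim (@complex.Im R) xi.

Lemma cmod_Qfun_le xi : cmod xi <= 1 -> cmod (Qfun xi) <= 2 * M.
Proof.
move=> xi1; apply: le_trans (cmod_le_ReIm _) _; rewrite mulr_natl mulr2n/=.
apply: lerD; apply: normr_Qlim => //; [exact: normr_Re_le|exact: normr_Im_le].
Qed.

Lemma cmod_Qfun_lipschitz xi eta : cmod xi <= 1 -> cmod eta <= 1 ->
  cmod (Qfun xi - Qfun eta) <= 2 * M * cmod (xi - eta).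
Proof.
move=> xi1 eta1; apply: le_trans (cmod_le_ReIm _) _; rewrite ReB ImB/=.
rewrite -mulrA mulr_natl mulr2n.
by apply: lerD; apply: Qlim_lipschitz => //;
  [exact: ReB|exact: normr_Re_le|exact: ImB|exact: normr_Im_le].
Qed.

(** The series in the definition of Q converges in R[i] because its real and
    imaginary parts do. *)
Lemma Q_seriesE (alpha beta : R) xi : alpha + 1 = s -> beta0_of beta = b0 ->
  cmod xi <= 1 -> Q_series alpha beta xi = Qfun xi.
Proof.
move=> sE b0E xi1; rewrite /Q_series sE b0E.
have cR : series (Qterm (@complex.Re R) xi) n @[n --> \oo] --> Qlim (@complex.Re R) xi.
  by apply: cvg_Qterm => //; exact: normr_Re_le.
have cI : series (Qterm (@complex.Im R) xi) n @[n --> \oo] --> Qlim (@complex.Im R) xi.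
  by apply: cvg_Qterm => //; exact: normr_Im_le.
set u := series _.
have uE n : u n = series (Qterm (@complex.Re R) xi) n +i*
                  series (Qterm (@complex.Im R) xi) n.
  rewrite /u !seriesEord/=; elim: n => [|n IH]; first by rewrite !big_ord0.
  rewrite !big_ord_recr/= IH /Qterm.
  rewrite [X in _ + X](_ : _ = (Qcoef b0 s n)%:C * (- xi) ^+ n); last first.
    by rewrite /Qcoef (rmorphM _ (b0 / (n%:R + b0))) (fmorph_div _ b0)/= [X in X * _ = _]mulrAC [LHS]mulrAC.
  case: ((- xi) ^+ n) => x y; apply/eqP; rewrite eq_complex/=.
  by rewrite !mul0r subr0 addr0 !eqxx.
suff cu : u n @[n --> \oo] --> (Qfun xi : R[i]^o).
  by apply: (@cvg_lim R[i]^o) cu; exact: norm_hausdorff.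
apply/cvgrPdist_lt => e; rewrite ltcE/= => /andP[/eqP e2 e0].
have e20 : 0 < complex.Re e / 2 by rewrite divr_gt0.
have -> : e = (complex.Re e)%:C by case: e e2 {e0 e20} => er ei /= ->.
have hR : \forall n \near \oo, `|Qlim (@complex.Re R) xi -
    series (Qterm (@complex.Re R) xi) n| < complex.Re e / 2.
  by move/cvgrPdist_lt : cR; exact.
have hI : \forall n \near \oo, `|Qlim (@complex.Im R) xi -
    series (Qterm (@complex.Im R) xi) n| < complex.Re e / 2.
  by move/cvgrPdist_lt : cI; exact.
apply: filterS2 hR hI => n hR hI.
change ((cmod (Qfun xi - u n))%:C < (complex.Re e)%:C); rewrite ltcR.
apply: le_lt_trans (cmod_le_ReIm _) _; rewrite ReB ImB uE/=.
by rewrite [ltRHS]splitr; apply: ltrD.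
Qed.

End Q_series_theory.

(** * Positivity of Q at 1 *)

Section Q_values.
Variable R : realType.
Implicit Types (s : R) (n k : nat).

Lemma gbinom_absorb s n : n.+1%:R * gbinom (s + 1) n.+1 = (s + 1) * gbinom s n.
Proof.
elim: n => [|n IH]; first by rewrite gbinomS !gbinom0 subr0.
apply: (@mulfI _ n.+1%:R); first by rewrite pnatr_eq0.
rewrite gbinomS mulrCA IH [RHS]mulrCA gbinomS mulrCA; congr (_ * (_ * _)).
by rewrite -natr1; ring.
Qed.

Lemma gbinom_pascal s n : gbinom (s + 1) n.+1 = gbinom s n.+1 + gbinom s n.
Proof.
apply: (@mulfI _ n.+1%:R); first by rewrite pnatr_eq0.
rewrite gbinom_absorb mulrDr gbinomS -mulrDl -natr1; congr (_ * _); ring.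
Qed.

Variable b0 : R.
Hypotheses (b0N1 : -1 < b0) (b00 : b0 < 0).

Let nb0 n : 0 < n.+1%:R + b0.
Proof.
rewrite -natr1 -addrA ltr_wpDl// ?ler0n//.
by rewrite addrC -ltrBlDr sub0r.
Qed.

Let G s : R^nat := series (fun n => Qcoef b0 s n * (- 1) ^+ n).

Let G_cvg s : 0 < s -> cvgn (G s).
Proof.
move=> s0; have [M M0 Mle] := Qcoef_sum_bounded b0N1 b00 s0.
apply: (@bounded_series_cvg _ _ M) => n; have [+ _] := Mle n.
by under [X in _ -> X <= _]eq_bigr do rewrite normrM normrX normrN1 expr1n mulr1.
Qed.

Let alternating s n : s <= 1 -> 0 < s -> gbinom s n.+1 * (- 1) ^+ n.+1 <= 0.
Proof.
move=> s1 s0; elim: n => [|n IH].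
  by have := gbinomS s 0; rewrite subr0 gbinom0 mul1r mulr1 expr1 => ->; lra.
rewrite -(@pmulr_rle0 _ n.+2%:R)//.
have -> : n.+2%:R * (gbinom s n.+2 * (- 1) ^+ n.+2) =
  (n.+1%:R - s) * (gbinom s n.+1 * (- 1) ^+ n.+1).
  by rewrite mulrA gbinomS exprS; ring.
by rewrite mulr_ge0_le0// subr_ge0; apply: le_trans s1 _; rewrite ler1n.
Qed.

(** Up to a term that tends to 0, Pascal's rule gives
    (1 + s + b0) G(s + 1) = (1 + s) G(s). *)
Let G_step s n : (1 + s + b0) * G (s + 1) n.+1 =
  (1 + s) * G s n.+1 + b0 * (gbinom s n * (- 1) ^+ n).
Proof.
rewrite /G !seriesEord/=; elim: n => [|n IH].
  by rewrite !big_ord1 !Qcoef0// gbinom0 expr0 !mulr1.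
rewrite big_ord_recr/= [in RHS]big_ord_recr/= mulrDr IH [in RHS]mulrDr.
rewrite /Qcoef gbinom_pascal exprS.
have n0 : n%:R + 1 + b0 != 0 by rewrite natr1 gt_eqF.
have n1 : n%:R + 1 != 0 :> R by rewrite natr1 pnatr_eq0.
have -> : gbinom s n.+1 = (s - n%:R) * gbinom s n / (n%:R + 1).
  by rewrite -gbinomS -natr1 mulrC mulKf.
rewrite -natr1; move: (\sum_(i < _) _) (gbinom s n) ((-1) ^+ n) => S v e.
by field; rewrite n0 n1.
Qed.

(** By [G_step] the sign of the limit does not change when s grows by 1, so that
    0 < s <= 1 suffices; there the first term is 1 and all others are
    nonnegative. *)
Lemma Qcoef_alternating_gt0 s : 0 < s -> 0 < limn (G s).
Proof.
move=> s0; have [N] : exists N : nat, s <= N.+1%:R.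
  by exists (Num.truncn s); rewrite ltW// truncnS_gt.
elim: N s s0 => [|N IH] s s0 sN.
  apply: (@lt_le_trans _ _ 1) => //; apply: limr_ge; first exact: G_cvg.
  exists 1%N => // -[//|n] _ /=; rewrite /G seriesEord/= big_ord_recl/= Qcoef0// expr0 mulr1.
  rewrite lerDl sumr_ge0// => k _; rewrite /Qcoef /bump/= add1n -mulrA.
  by rewrite mulr_le0 ?alternating// mulr_le0_ge0 ?invr_ge0 ?ltW.
have [s1|s1] := leP s 1.
  by apply: IH => //; apply: le_trans s1 _; rewrite ler1n.
have s10 : 0 < s - 1 by rewrite subr_gt0.
have GS := IH (s - 1) s10; rewrite lerBlDr natr1 in GS.
have {}GS := GS sN.
have d0 : 0 < 1 + (s - 1) + b0 by move: b0N1 s1; lra.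
rewrite -(pmulr_rgt0 _ d0).
have [M M0 Mle] := gbinom_sum_bounded s10.
have u0 : gbinom (s - 1) n * (- 1) ^+ n @[n --> \oo] --> (0 : R).
  apply: cvg_series_cvg_0; apply: (@bounded_series_cvg _ _ M) => n.
  by under [X in X <= _]eq_bigr do rewrite normrM normrX normrN1 expr1n mulr1.
suff -> : (1 + (s - 1) + b0) * limn (G s) = (1 + (s - 1)) * limn (G (s - 1)).
  by rewrite mulr_gt0//; lra.
have h1 : (1 + (s - 1) + b0) * G s n.+1 @[n --> \oo] --> (1 + (s - 1) + b0) * limn (G s).
  by apply: cvgMr; rewrite (cvg_shiftS (G s)); exact: G_cvg.
have h2 : (1 + (s - 1)) * G (s - 1) n.+1 + b0 * (gbinom (s - 1) n * (- 1) ^+ n)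
    @[n --> \oo] --> (1 + (s - 1)) * limn (G (s - 1)) + b0 * 0.
  apply: cvgD; last exact: cvgMr.
  by apply: cvgMr; rewrite (cvg_shiftS (G (s - 1))); exact: G_cvg.
rewrite -[RHS]addr0 -[in RHS](mulr0 b0) -(cvg_lim _ h1)// -(cvg_lim _ h2)//.
by congr (limn _); apply/funext => n; rewrite -G_step subrK.
Qed.

End Q_values.

(** * What the kernels use of Q *)

Section Q_regularity.
Variable R : realType.
Implicit Types (xi : R[i]).
Local Notation pairing := (@pairing R).

Definition disc2 : set (plane R * plane R) := disc R `*` disc R.

Lemma measurable_disc2 : measurable disc2.
Proof. by apply: measurableX; exact: measurable_disc. Qed.

(** Near 0 and 1, where the operators are tested from below, q has to be almost
    real and positive: the ratio 3 between the bounds on its real and imaginary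
    parts survives the division by (1 - xi)^s in the proof of
    [kernel_regular_cpow]. *)
Definition Q_regular (q : R[i] -> R[i]) : Prop :=
  [/\ exists C, forall xi, cmod xi < 1 -> cmod (q xi) <= C,
      exists c r, [/\ 0 < c, 0 < r & forall xi, cmod xi < 1 ->
        cmod xi < r \/ cmod (1 - xi) < r ->
        3 * c <= complex.Re (q xi) /\ `|complex.Im (q xi)| <= c] &
      cmeas disc2 (q \o pairing)].

Lemma Q_regular_cst (c : R) : 0 < c -> Q_regular (fun=> c%:C).
Proof.
move=> c0; split.
- by exists c => xi _; rewrite cmod_real gtr0_norm.
- exists (c / 3), 1; split=> [||xi _ _] //; first by rewrite divr_gt0.
  by rewrite /= normr0 mulrC divfK// divr_ge0// ltW.
- exact: cmeas_cst.
Qed.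

Section negative_b0.
Variables (b0 s : R).
Hypotheses (b0N1 : -1 < b0) (b00 : b0 < 0) (s0 : 0 < s).

Let cmeas_Qfun : cmeas disc2 (Qfun b0 s \o pairing).
Proof.
have [M M0 Mle] := Qcoef_sum_bounded b0N1 b00 s0.
have xi1 u : disc2 u -> cmod (pairing u) <= 1.
  by move=> [u1 u2]; rewrite ltW// pairing_disc.
have mX n : cmeas disc2 (fun u => (- pairing u) ^+ n).
  apply: cmeasX; apply: (@cmeas_ext _ _ _ _ (fun u => (-1)%:C * pairing u)).
    by move=> u; rewrite rmorphN1 mulN1r.
  by apply: cmeasM; [exact: cmeas_cst|exact: cmeas_pairing].
have mlim (L : R[i] -> R) : (forall v, `|L v| <= cmod v) ->
    (forall n, measurable_fun disc2 (fun u => L ((- pairing u) ^+ n))) ->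
    measurable_fun disc2 (fun u => Qlim b0 s L (pairing u)).
  move=> Lle mL; apply: (@measurable_fun_cvg _ _ _ _
    (fun n u => series (Qterm b0 s L (pairing u)) n)) => [n|u /xi1 u1].
    rewrite (_ : (fun _ => _) = (fun u =>
      \sum_(k < n) Qcoef b0 s k * L ((- pairing u) ^+ k))).
      by apply: measurable_sum => k; apply: measurable_funM.
    by apply/funext => u; rewrite seriesEord.
  exact: (cvg_Qterm Mle).
split; apply: mlim => [v|n]; by [exact: normr_Re_le|exact: normr_Im_le|case: (mX n)].
Qed.

Let Qfun_real (x : R) : Qfun b0 s x%:C =
  (limn (series (fun n => Qcoef b0 s n * (- x) ^+ n)))%:C.
Proof.
rewrite /Qfun /Qlim /Qterm.
have E n : (- x%:C) ^+ n = ((- x) ^+ n)%:C :> R[i] by rewrite rmorphXn rmorphN.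
under eq_fun do rewrite E/=.
under [X in _ +i* limn (series X)]eq_fun do rewrite E/= mulr0.
congr (_ +i* _); rewrite (_ : series _ = cst 0) ?lim_cst//.
by apply/funext => n; rewrite seriesEord/= big1.
Qed.

Let Qfun0 : Qfun b0 s 0 = 1.
Proof.
rewrite (_ : 0 = (0 : R)%:C)// Qfun_real oppr0; congr (_ %:C).
apply/cvg_lim => //; rewrite -cvg_shiftS/=.
rewrite (_ : (fun _ => _) = cst 1); first exact: cvg_cst.
apply/funext => n; rewrite seriesEord/= big_ord_recl/= Qcoef0// mul1r expr0.
by rewrite big1 ?addr0// => i _; rewrite expr0n mulr0.
Qed.

Let Qfun1 : exists2 q : R, 0 < q & Qfun b0 s 1 = q%:C.
Proof.
exists (limn (series (fun n => Qcoef b0 s n * (- 1) ^+ n))).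
  exact: Qcoef_alternating_gt0.
by rewrite (_ : 1 = (1 : R)%:C)// Qfun_real.
Qed.

(** The function is Lipschitz up to the boundary and takes positive real values
    at 0 and at 1. *)
Lemma Q_regular_Qfun : Q_regular (Qfun b0 s).
Proof.
have [M M0 Mle] := Qcoef_sum_bounded b0N1 b00 s0.
have [q q0 q1E] := Qfun1.
split => //.
  by exists (2 * M) => xi xi1; exact: (cmod_Qfun_le Mle (ltW xi1)).
(* within distance c of a real value p >= 4 c *)
pose c := Num.min 1 q / 4.
have c0 : 0 < c by rewrite divr_gt0// lt_min ltr01.
pose r := c / (2 * M + 1).
have M1 : 0 < 2 * M + 1 by rewrite ltr_wpDl// mulr_ge0.
exists c, r; split=> //; first by rewrite divr_gt0.
have near p eta xi : cmod xi < 1 -> cmod eta <= 1 -> Qfun b0 s eta = p%:C ->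
    4 * c <= p -> cmod (eta - xi) < r ->
    3 * c <= complex.Re (Qfun b0 s xi) /\ `|complex.Im (Qfun b0 s xi)| <= c.
  move=> xi1 eta1 pE cp xir.
  have := cmod_Qfun_lipschitz Mle eta1 (ltW xi1); rewrite pE => h.
  have {}h : cmod (p%:C - Qfun b0 s xi) <= c.
    apply: (le_trans h); apply: (@le_trans _ _ ((2 * M + 1) * r)).
      by rewrite ler_pM ?cmod_ge0 ?mulr_ge0 ?lerDl ?(ltW xir).
    by rewrite /r mulrC divfK// gt_eqF.
  have := le_trans (normr_Re_le _) h; have := le_trans (normr_Im_le _) h.
  case: (Qfun b0 s xi) => x y /=; rewrite sub0r normrN => hy.
  by rewrite ler_norml => /andP[_ hx]; split => //; lra.
have c1 : 4 * c <= 1 by rewrite /c mulrC divfK// ge_min lexx.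
have cq : 4 * c <= q by rewrite /c mulrC divfK// ge_min lexx orbT.
move=> xi xi1 [xir|xir].
  by apply: (near 1 0) => //; rewrite ?cmod0 ?Qfun0 ?sub0r ?cmodN.
by apply: (near q 1) => //; rewrite cmod1.
Qed.

End negative_b0.

Lemma Q_regular_scale (k : R) q : 0 < k -> Q_regular q ->
  Q_regular (fun xi => k%:C * q xi).
Proof.
move=> k0 [[C Cle] [c [r [c0 r0 cr]]] mq]; split.
- exists (k * C) => xi xi1; rewrite cmodM cmod_real gtr0_norm// ler_pM2l//.
  exact: Cle.
- exists (k * c), r; split=> //; first by rewrite mulr_gt0.
  move=> xi xi1 /(cr _ xi1)[h1 h2]; rewrite Re_mul Im_mul/= !mul0r subr0 addr0.
  by rewrite mulrCA ler_pM2l// normrM gtr0_norm// ler_pM2l.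
- by apply: cmeasM => //; exact: cmeas_cst.
Qed.

Lemma Q_regularP alpha beta beta0 m : -1 < alpha -> -1 < beta ->
  beta = beta0 + m%:R -> -1 < beta0 -> beta0 <= 0 ->
  exists2 q, Q_regular q & forall xi, cmod xi < 1 -> Q alpha beta xi = q xi.
Proof.
move=> a1 b1 betaE b0N1; have s0 : 0 < alpha + 1 by lra.
rewrite le_eqVlt => /predU1P[b0E|b00].
  exists (fun=> ((alpha + 1) * euler_beta (alpha + 1) (beta + 1))%:C).
    apply: Q_regular_cst; rewrite mulr_gt0// euler_beta_gt0//; lra.
  by move=> xi _; rewrite /Q betaE b0E add0r natr_nat.
have bE : beta0_of beta = beta0 by rewrite betaE beta0_ofE// ltW.
have bN : beta \isn't a Num.nat.
  apply/negP => /natrP[k kE]; move: bE; rewrite kE -[k%:R]add0r beta0_ofE//.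
  by move=> b0E; rewrite -b0E ltxx in b00.
exists (fun xi => (euler_beta (alpha + 1) (beta + 1)
       / euler_beta (alpha + 1) (beta0 + 1))%:C * Qfun beta0 (alpha + 1) xi).
  apply: Q_regular_scale; last exact: Q_regular_Qfun.
  by rewrite divr_gt0// euler_beta_gt0//; lra.
move=> xi xi1; rewrite /Q (negbTE bN) bE; congr (_ * _).
have [M M0 Mle] := Qcoef_sum_bounded b0N1 b00 s0.
by apply: (Q_seriesE Mle) => //; rewrite ltW.
Qed.

End Q_regularity.

(** * The kernels Q(xi) / (1 - xi)^s *)

Section kernels.
Variable R : realType.
Implicit Types (u xi : R[i]) (s x y : R).

(** Continuity on the open interval, completed by the two endpoints. *)
Lemma measurable_acos : measurable_fun (`[(-1), 1]%classic : set R) (@acos R).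
Proof.
rewrite (_ : `[(-1), 1]%classic = [set -1; 1] `|` `](-1), 1[%classic :> set R).
  apply/measurable_funU.
  - exact: measurableU.
  - exact: measurable_itv.
  split; first by apply/measurable_funU => //; split; exact: measurable_fun_set1.
  apply: open_continuous_measurable_fun => //.
  by move=> x /[!inE]/=; rewrite in_itv/= => x1; exact: continuous_acos.
apply/seteqP; split => x /=; rewrite !in_itv/=; last first.
  by move=> [[->|->]|]; lra.
move=> /andP[]; rewrite le_eqVlt => /predU1P[<-|x1]; first by left; left.
by rewrite le_eqVlt => /predU1P[->|x2]; [left; right|right; rewrite x1].
Qed.

Lemma Re_div_cmod u : -1 <= complex.Re u / cmod u <= 1.
Proof.
rewrite -ler_norml normrM normfV [`|cmod u|]ger0_norm ?cmod_ge0//.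
have [->|u0] := eqVneq (cmod u) 0; first by rewrite invr0 mulr0.
by rewrite ler_pdivrMr ?mul1r ?normr_Re_le// lt_neqAle eq_sym u0 cmod_ge0.
Qed.

Let sg y : R := if 0 <= y then 1 else -1.

Let measurable_sg : measurable_fun setT sg.
Proof.
apply: measurable_fun_ifT; last 2 first.
- exact: measurable_cst.
- exact: measurable_cst.
- by apply: measurable_fun_ler.
Qed.

Lemma cargE u : carg u = sg (complex.Im u) * acos (complex.Re u / cmod u).
Proof. by rewrite /carg /sg; case: ifP => _; rewrite ?mul1r ?mulN1r. Qed.

Lemma measurable_carg d (T : measurableType d) (D : set T) (f : T -> R[i]) :
  measurable D -> cmeas D f -> measurable_fun D (fun t => carg (f t)).
Proof.
move=> mD mf; under eq_fun do rewrite cargE; apply: measurable_funM.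
  by apply: (measurableT_comp measurable_sg); case: mf.
apply: (measurable_comp _ _ measurable_acos) => //.
  by move=> _ [t _ <-] /=; rewrite in_itv/= Re_div_cmod.
apply: measurable_funM; first by case: mf.
apply: measurable_fun_inv => [|t]; last exact: cmod_ge0.
exact: cmeas_cmod.
Qed.

Lemma cmeas_cpow d (T : measurableType d) (D : set T) (f : T -> R[i]) s :
  measurable D -> cmeas D f -> cmeas D (fun t => cpow (f t) s).
Proof.
move=> mD mf; apply: cmeasM.
  by apply: cmeas_real; apply: measurable_fun_powR; exact: cmeas_cmod.
have ms : measurable_fun D (fun t => s * carg (f t)).
  by apply: measurable_funM => //; exact: measurable_carg.
split.
  by apply: (measurableT_comp _ ms); apply: continuous_measurable_fun; exact: continuous_cos.
by apply: (measurableT_comp _ ms); apply: continuous_measurable_fun; exact: continuous_sin.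
Qed.

Lemma cmod_cpow u s : cmod (cpow u s) = cmod u `^ s.
Proof.
by rewrite /cpow cmodM cmod_real [cmod (_ +i* _)]cmodE/= cos2Dsin2 sqrtr1 mulr1 ger0_norm ?powR_ge0.
Qed.

Lemma Re_div_cpow (q : R[i]) u s : complex.Re (q / cpow u s) =
  cmod u `^ (- s) * (complex.Re q * cos (s * carg u) + complex.Im q * sin (s * carg u)).
Proof.
have [u0|u0] := eqVneq (cmod u `^ s) 0.
  rewrite powRN u0 invr0 mul0r (_ : cpow u s = 0) ?invr0 ?mulr0//.
  by apply/eqP; rewrite -cmod_eq0 cmod_cpow u0.
rewrite complex_invE cmod_cpow /cpow powRN.
case: q => x y; move: u0; set r := cmod u `^ s; move: (cos _) (sin _) => co si r0.
by rewrite /=; field.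
Qed.

(** In a thin cone around the positive axis the argument is so small that
    cos (s arg u) >= 1/2. *)
Lemma thin_cone s : exists2 eta, 0 < eta & forall u, 0 < complex.Re u ->
  `|complex.Im u| <= eta * complex.Re u -> 2^-1 <= cos (s * carg u).
Proof.
have [e e0 eP] : exists2 e : R, 0 < e & forall x, `|x| < e -> 2^-1 <= cos x.
  have /cvgrPdist_lt/(_ 2^-1) := @continuous_cos R 0.
  rewrite invr_gt0 ltr0n => /(_ isT)/nbhs_ballP[e /= e0 eP].
  exists e => // x xe; have := eP x; rewrite /ball/= sub0r normrN => /(_ xe).
  by rewrite cos0 ltr_norml; lra.
pose t := Num.min (e / (2 * (1 + `|s|))) 1.
have s1 : 0 < 2 * (1 + `|s|) by rewrite mulr_gt0// ltr_wpDr.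
have t0 : 0 < t by rewrite lt_min divr_gt0//= ltr01.
have tpi : t <= pi by rewrite (@le_trans _ _ 1) ?ge_min ?lexx ?orbT//; apply: le_trans (pi_ge2 R); rewrite ler1n.
have tI : t \in `[0, pi] by rewrite in_itv/= (ltW t0).
have ct1 : cos t < 1.
  by rewrite -(@cos0 R) ltr_cos// in_itv/= lexx pi_ge0.
(* |u| <= (2 - cos t) Re u in this cone, and cos t (2 - cos t) <= 1 *)
exists (1 - cos t); first by rewrite subr_gt0.
move=> u u0 ui.
have uR : cmod u <= (1 + (1 - cos t)) * complex.Re u.
  rewrite mulrDl mul1r; apply: le_trans (cmod_le_ReIm _) _.
  by rewrite gtr0_norm// lerD2l.
have cu0 : 0 < cmod u by apply: lt_le_trans (Re_le_cmod u).
have ctu : cos t <= complex.Re u / cmod u.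
  rewrite ler_pdivlMr//; have [ct0|ct0] := leP 0 (cos t).
    apply: le_trans (ler_wpM2l ct0 uR) _; rewrite mulrA ler_piMl ?(ltW u0)//.
    rewrite (_ : cos t * _ = 1 - (1 - cos t) ^+ 2); last by ring.
    by rewrite gerBl sqr_ge0.
  by apply: le_trans (_ : 0 <= _); [rewrite mulr_le0_ge0 ?ltW|exact: ltW].
have aI := Re_div_cmod u.
have at_ : acos (complex.Re u / cmod u) <= t.
  rewrite leNgt; apply/negP => ta.
  have : acos (complex.Re u / cmod u) \in `[0, pi].
    by rewrite in_itv/= acos_ge0//= acos_lepi.
  move=> aIpi; have := ltr_cos tI aIpi; rewrite ta acosK ?in_itv//.
  by rewrite ltNge ctu.
apply: eP; rewrite cargE !normrM (_ : `|sg _| = 1) ?mul1r; last first.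
  by rewrite /sg; case: ifP; rewrite ?normr1 ?normrN1.
rewrite [`|acos _|]ger0_norm ?acos_ge0//.
apply: (@le_lt_trans _ _ (`|s| * t)); first by rewrite ler_wpM2l.
apply: (@le_lt_trans _ _ ((1 + `|s|) * (e / (2 * (1 + `|s|))))).
  by rewrite ler_pM ?(ltW t0) ?lerDr// ge_min lexx.
have r0 : 1 + `|s| != 0 by rewrite gt_eqF// ltr_wpDr.
have -> : (1 + `|s|) * (e / (2 * (1 + `|s|))) = e / 2.
  by move: (`|s|) r0 => r r0; field.
by rewrite ltr_pdivrMr// ltr_pMr// ltr1n.
Qed.

(** The common properties of the kernels of A and B: the size of
    |1 - xi|^{-(2+alpha)}, and no cancellation near 0 and in a thin cone
    at 1. *)
Definition kernel_regular s (K : R[i] -> R[i]) : Prop :=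
  [/\ exists2 C, 0 <= C & forall xi, cmod xi < 1 ->
        cmod (K xi) <= C * cmod (1 - xi) `^ (- s),
      exists c r eta, [/\ 0 < c, 0 < r, 0 < eta & forall xi, cmod xi < 1 ->
        cmod xi < r \/ cmod (1 - xi) < r ->
        `|complex.Im xi| <= eta * (1 - complex.Re xi) ->
        c * cmod (1 - xi) `^ (- s) <= complex.Re (K xi)] &
      cmeas (@disc2 R) (K \o @pairing R)].

Let Re1 xi : complex.Re (1 - xi) = 1 - complex.Re xi. Proof. by case: xi. Qed.
Let Im1 xi : complex.Im (1 - xi) = - complex.Im xi.
Proof. by case: xi => x y /=; rewrite sub0r. Qed.

(** In the thin cone the cosine of the argument of (1 - xi)^s is at least 1/2,
    so that the real part of the quotient is at least (3 c / 2 - c) |1 - xi|^-s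
    by the bounds of [Q_regular]. *)
Lemma kernel_regular_cpow s q : Q_regular q ->
  kernel_regular s (fun xi => q xi / cpow (1 - xi) s).
Proof.
move=> [[C Cle] [c [r [c0 r0 cr]]] mq].
have [eta eta0 etaP] := thin_cone s.
split.
- exists C => [|xi xi1]; first by apply: le_trans (Cle 0 _); rewrite ?cmod_ge0 ?cmod0.
  by rewrite cmodM cmodV cmod_cpow -powRN ler_wpM2r ?powR_ge0// Cle.
- exists (c / 2), r, eta; split => //; first by rewrite divr_gt0.
  move=> xi xi1 xir cone; have [h1 h2] := cr _ xi1 xir.
  rewrite Re_div_cpow mulrC ler_wpM2l ?powR_ge0//.
  have Re0 : 0 < complex.Re (1 - xi).
    by rewrite Re1 subr_gt0; apply: le_lt_trans xi1; exact: Re_le_cmod.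
  have := etaP (1 - xi) Re0; rewrite Re1 Im1 normrN => /(_ cone).
  set co := cos _; set si := sin _ => hco.
  have hsi : `|complex.Im (q xi) * si| <= c.
    rewrite normrM; apply: (@le_trans _ _ (c * 1)); last by rewrite mulr1.
    by apply: ler_pM => //; exact: sin_max.
  have h3 : 3 * c * 2^-1 <= complex.Re (q xi) * co.
    by apply: ler_pM => //; rewrite ?mulr_ge0 ?(ltW c0)// invr_ge0.
  by move: hsi; rewrite ler_norml => /andP[]; lra.
- apply: cmeasM => //; apply: cmeasV; apply: cmeas_cpow; first exact: measurable_disc2.
  exact: cmeas_one_sub (cmeas_pairing _).
Qed.

Lemma kernel_regular_cmod s q : Q_regular q ->
  kernel_regular s (fun xi => (cmod (q xi) / cmod (1 - xi) `^ s)%:C).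
Proof.
move=> [[C Cle] [c [r [c0 r0 cr]]] mq]; split.
- exists C => [|xi xi1]; first by apply: le_trans (Cle 0 _); rewrite ?cmod_ge0 ?cmod0.
  rewrite cmod_real -powRN ger0_norm ?mulr_ge0 ?cmod_ge0 ?powR_ge0//.
  by rewrite ler_wpM2r ?powR_ge0// Cle.
- exists c, r, 1; split => // xi xi1 xir _; have [h1 h2] := cr _ xi1 xir.
  rewrite /= -powRN ler_wpM2r ?powR_ge0//; apply: le_trans (Re_le_cmod _).
  by apply: le_trans h1; rewrite ler_peMl ?(ltW c0)// ler1n.
- apply: cmeas_real; apply: measurable_funM; first exact: cmeas_cmod.
  under eq_fun do rewrite -powRN.
  by apply: measurable_fun_powR; exact: cmeas_cmod (cmeas_one_sub (cmeas_pairing _)).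
Qed.

End kernels.

(** * Schur's test *)

Lemma ge0_le_poweR (R : realType) (r : R) (x y : \bar R) :
  0 <= r -> (0 <= x)%E -> (x <= y)%E -> (x `^ r <= y `^ r)%E.
Proof.
move=> r0 x0 xy; apply: gt0_ler_poweR => //; rewrite in_itv/= leey andbT//.
exact: le_trans xy.
Qed.

Section schur.
Context d (T : measurableType d) (R : realType).
Variables (mu : {sigma_finite_measure set T -> \bar R}) (H : T * T -> R) (F : T -> R).
Hypotheses (mH : measurable_fun setT H) (H0 : forall x, 0 <= H x)
  (mF : measurable_fun setT F) (F0 : forall w, 0 <= F w).
Implicit Types (p q C : R) (u v h : T -> R).

Definition kint z := (\int[mu]_w (H (z, w) * F w)%:E)%E.

Lemma kint_ge0 z : (0 <= kint z)%E.
Proof. by apply: integral_ge0 => w _; rewrite lee_fin mulr_ge0. Qed.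

Let mHz z : measurable_fun setT (fun w => H (z, w)).
Proof. exact: measurableT_comp mH (measurable_pair1 z). Qed.

Let mHw w : measurable_fun setT (fun z => H (z, w)).
Proof. exact: measurableT_comp mH (measurable_pair2 w). Qed.

Lemma measurable_kint : measurable_fun setT kint.
Proof.
apply: (@measurable_fun_fubini_tonelli_F _ _ _ _ _ mu
  (fun x : T * T => (H x * F x.2)%:E)).
  apply/measurable_EFinP; apply: measurable_funM => //.
  exact: measurableT_comp mF measurable_snd.
by move=> x; rewrite lee_fin mulr_ge0.
Qed.

(** The step common to p = 1 and p > 1: a pointwise bound of (kint z)^p by an
    integral in w is integrated in z, and the order of integration is
    exchanged. *)
Lemma schur_tonelli p C u v : measurable_fun setT u -> measurable_fun setT v ->
  (forall z, 0 <= u z) -> (forall w, 0 <= v w) -> 0 <= C ->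
  (forall z, (kint z `^ p <= \int[mu]_w (u z * H (z, w) * (F w `^ p * v w))%:E)%E) ->
  (forall w, (\int[mu]_z (u z * H (z, w) * v w)%:E <= C%:E)%E) ->
  (\int[mu]_z (kint z `^ p) <= C%:E * \int[mu]_w (F w `^ p)%:E)%E.
Proof.
move=> mu_ mv u0 v0 C0 le1 le2.
pose g (x : T * T) := u x.1 * H x * (F x.2 `^ p * v x.2).
have mFp : measurable_fun setT (fun w => F w `^ p) by exact: measurable_fun_powR.
have mg : measurable_fun setT (EFin \o g).
  apply/measurable_EFinP; apply: measurable_funM.
    by apply: measurable_funM => //; exact: measurableT_comp mu_ measurable_fst.
  apply: measurable_funM; first exact: measurableT_comp mFp measurable_snd.
  exact: measurableT_comp mv measurable_snd.
have g0 x : (0 <= (EFin \o g) x)%E by rewrite lee_fin !mulr_ge0 ?powR_ge0.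
apply: (@le_trans _ _ (\int[mu]_z \int[mu]_w (g (z, w))%:E)%E).
  apply: ge0_le_integral => //.
  - by move=> z _; exact: poweR_ge0.
  - exact: measurableT_comp (measurable_poweR p) measurable_kint.
  - exact: (@measurable_fun_fubini_tonelli_F _ _ _ _ _ mu (EFin \o g)).
rewrite (fubini_tonelli (EFin \o g))//= -ge0_integralZl_EFin//; last 2 first.
- by move=> w _; rewrite lee_fin powR_ge0.
- exact/measurable_EFinP.
apply: ge0_le_integral => //.
- by move=> w _; apply: integral_ge0 => z _; exact: (g0 (z, w)).
- exact: (@measurable_fun_fubini_tonelli_G _ _ _ _ _ mu (EFin \o g)).
- by under eq_fun do rewrite -EFinM; apply/measurable_EFinP; exact: measurable_funM.
move=> w _; rewrite muleC.
apply: (@le_trans _ _ ((F w `^ p)%:E * \int[mu]_z (u z * H (z, w) * v w)%:E)%E);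
  last by apply: lee_wpmul2l => //; rewrite lee_fin powR_ge0.
rewrite -ge0_integralZl_EFin ?powR_ge0//; last 2 first.
- by move=> z _; rewrite lee_fin !mulr_ge0.
- apply/measurable_EFinP; apply: measurable_funM => //.
  by apply: measurable_funM.
rewrite le_eqVlt; apply/predU1P; left; apply: eq_integral => z _.
by rewrite -EFinM /g/=; congr EFin; ring.
Qed.

(** Hoelder's inequality for the splitting
    H F = (H^(1/q) h) (H^(1/p) h^-1 F). *)
Lemma schur_hoelder p q C h z : 1 < p -> p^-1 + q^-1 = 1 -> 0 <= C ->
  measurable_fun setT h -> (forall w, 0 <= h w) ->
  (forall w, 0 < H (z, w) -> 0 < h w) ->
  (\int[mu]_w (H (z, w) * h w `^ q)%:E <= (C * h z `^ q)%:E)%E ->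
  (kint z `^ p <= \int[mu]_w
     (C `^ (p / q) * h z `^ p * H (z, w) * (F w `^ p * h w `^ (- p)))%:E)%E.
Proof.
move=> p1 pq C0 mh h0 hH hq.
have p0 : 0 < p by exact: lt_trans p1.
have q0 : 0 < q.
  by rewrite -invr_gt0 (_ : q^-1 = 1 - p^-1) ?subr_gt0 ?invf_lt1// -pq addrC addKr.
pose f1 w := H (z, w) `^ q^-1 * h w.
pose f2 w := H (z, w) `^ p^-1 * (h w `^ (-1) * F w).
have mf1 : measurable_fun setT f1.
  by apply: measurable_funM => //; exact: measurable_fun_powR.
have mf2 : measurable_fun setT f2.
  apply: measurable_funM; first exact: measurable_fun_powR.
  by apply: measurable_funM => //; exact: measurable_fun_powR.
have f10 w : 0 <= f1 w by rewrite mulr_ge0 ?powR_ge0.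
have f20 w : 0 <= f2 w by rewrite !mulr_ge0 ?powR_ge0.
have f12 w : f1 w * f2 w = H (z, w) * F w.
  have := H0 (z, w); rewrite le_eqVlt => /predU1P[Hz|Hz].
    by rewrite /f1 -Hz powR0 ?invr_neq0 ?gt_eqF// !mul0r.
  rewrite /f1 /f2 powR_inv1// mulrACA -powRD; last by rewrite (gt_eqF Hz) implybT.
  by rewrite [q^-1 + _]addrC pq powRr1// mulVKf// gt_eqF// hH.
have := hoelder mu mf2 mf1 p0 q0 pq.
have -> : 'N[mu]_1[EFin \o (f2 \* f1)%R]%E = kint z.
  rewrite Lnorm1; apply: eq_integral => w _ /=.
  by rewrite mulrC f12 ger0_norm// mulr_ge0.
have N2 : ('N[mu]_p%:E[EFin \o f2] `^ p =
    \int[mu]_w (H (z, w) * (F w `^ p * h w `^ (- p)))%:E)%E.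
  rewrite poweR_Lnorm ?gt_eqF//; apply: eq_integral => w _.
  have -> : `|(EFin \o f2) w|%E = (f2 w)%:E by rewrite gee0_abs ?lee_fin.
  rewrite poweR_EFin /f2 !powRM ?mulr_ge0 ?powR_ge0//.
  rewrite -!powRrM mulVf ?gt_eqF// powRr1// mulN1r.
  by congr (_%:E); ring.
have N1 : ('N[mu]_q%:E[EFin \o f1] `^ q = \int[mu]_w (H (z, w) * h w `^ q)%:E)%E.
  rewrite poweR_Lnorm ?gt_eqF//; apply: eq_integral => w _.
  have -> : `|(EFin \o f1) w|%E = (f1 w)%:E by rewrite gee0_abs ?lee_fin.
  rewrite poweR_EFin /f1 !powRM ?powR_ge0//.
  by rewrite -!powRrM mulVf ?gt_eqF// powRr1.
move=> hol.
apply: (@le_trans _ _ (('N[mu]_p%:E[EFin \o f2] * 'N[mu]_q%:E[EFin \o f1]) `^ p)%E).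
  by apply: ge0_le_poweR hol; [exact: ltW|exact: kint_ge0].
rewrite poweRM ?Lnorm_ge0// N2.
have -> : ('N[mu]_q%:E[EFin \o f1] `^ p =
    (\int[mu]_w (H (z, w) * h w `^ q)%:E) `^ (p / q))%E.
  by rewrite -N1 -poweRrM mulrC divfK ?gt_eqF.
have mI : measurable_fun setT (fun w => (H (z, w) * (F w `^ p * h w `^ (- p)))%:E).
  apply/measurable_EFinP; apply: measurable_funM => //.
  by apply: measurable_funM; exact: measurable_fun_powR.
have -> : (\int[mu]_w
    (C `^ (p / q) * h z `^ p * H (z, w) * (F w `^ p * h w `^ (- p)))%:E =
    (C `^ (p / q) * h z `^ p)%:E * \int[mu]_w (H (z, w) * (F w `^ p * h w `^ (- p)))%:E)%E.
  rewrite -ge0_integralZl_EFin ?mulr_ge0 ?powR_ge0//.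
  - by apply: eq_integral => w _; rewrite -EFinM; congr EFin; ring.
  - by move=> w _; rewrite lee_fin !mulr_ge0 ?powR_ge0.
rewrite muleC; apply: lee_wpmul2r.
  by apply: integral_ge0 => w _; rewrite lee_fin !mulr_ge0 ?powR_ge0.
apply: (@le_trans _ _ (((C * h z `^ q)%:E) `^ (p / q))%E).
  apply: ge0_le_poweR hq; first by rewrite divr_ge0 ?(ltW p0) ?(ltW q0).
  by apply: integral_ge0 => w _; rewrite lee_fin !mulr_ge0 ?powR_ge0.
rewrite poweR_EFin lee_fin powRM ?powR_ge0// -powRrM.
by rewrite [q * _]mulrC divfK// gt_eqF.
Qed.

(** The test function h is an approximate eigenvector of the kernel in both
    variables: the first bound turns [schur_hoelder] into the hypothesis of
    [schur_tonelli], and the second one finishes. *)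
Lemma schur_test p q C h : 1 < p -> p^-1 + q^-1 = 1 -> 0 <= C ->
  measurable_fun setT h -> (forall w, 0 <= h w) ->
  (forall z w, 0 < H (z, w) -> 0 < h w) ->
  (forall z, (\int[mu]_w (H (z, w) * h w `^ q)%:E <= (C * h z `^ q)%:E)%E) ->
  (forall w, (\int[mu]_z (h z `^ p * H (z, w))%:E <= (C * h w `^ p)%:E)%E) ->
  (\int[mu]_z (kint z `^ p) <= (C `^ (p / q) * C)%:E * \int[mu]_w (F w `^ p)%:E)%E.
Proof.
move=> p1 pq C0 mh h0 hH hq hp.
apply: (@schur_tonelli _ _ (fun z => C `^ (p / q) * h z `^ p) (fun w => h w `^ (- p))).
- by apply: measurable_funM => //; exact: measurable_fun_powR.
- exact: measurable_fun_powR.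
- by move=> z; rewrite mulr_ge0 ?powR_ge0.
- by move=> w; exact: powR_ge0.
- by rewrite mulr_ge0 ?powR_ge0.
- by move=> z; apply: schur_hoelder => // w; exact: hH.
move=> w; rewrite (_ : (\int[mu]_z _)%E = ((C `^ (p / q) * h w `^ (- p))%:E *
  \int[mu]_z (h z `^ p * H (z, w))%:E)%E); last first.
  rewrite -ge0_integralZl_EFin ?mulr_ge0 ?powR_ge0//.
  - by apply: eq_integral => z _; rewrite -EFinM; congr EFin; ring.
  - by move=> z _; rewrite lee_fin mulr_ge0 ?powR_ge0.
  - apply/measurable_EFinP; apply: measurable_funM => //.
    exact: measurable_fun_powR.
apply: le_trans (lee_wpmul2l _ (hp w)) _; rewrite ?lee_fin ?mulr_ge0 ?powR_ge0//.
rewrite -!mulrA ler_wpM2l ?powR_ge0//.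
rewrite mulrCA ler_piMr// powRN mulrC.
by have [->|h1] := eqVneq (h w `^ p) 0; rewrite ?mul0r// divff.
Qed.

End schur.

(** * The positive majorant of the kernels *)

Section majorant.
Variable R : realType.
Variables (a b alpha beta : R) (m : nat).
Implicit Types (z w : plane R) (s t p q : R).
Local Notation nz z := (cmod (cplx z)).
Local Notation mu := (mu_disc a b).

Definition radial s t z : R := nz z `^ s * (1 - nz z ^+ 2) `^ t.

Lemma radial_ge0 s t z : 0 <= radial s t z.
Proof. by rewrite mulr_ge0 ?powR_ge0. Qed.

Lemma radial_gt0 s t z : pdisc z -> 0 < radial s t z.
Proof.
move=> zD; rewrite mulr_gt0 ?powR_gt0 ?pdisc_gt0// one_sub_sqr_gt0//.
exact: pdisc_disc.
Qed.

Lemma measurable_radial s t : measurable_fun setT (radial s t).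
Proof.
apply: measurable_funM; apply: measurable_fun_powR.
  exact: measurable_cmod_cplx.
exact: measurable_one_sub_sqr.
Qed.

Lemma radialM s t s' t' z : pdisc z ->
  radial s t z * radial s' t' z = radial (s + s') (t + t') z.
Proof.
move=> zD; have z0 := pdisc_gt0 zD.
have z1 := one_sub_sqr_gt0 (pdisc_disc zD).
by rewrite /radial mulrACA -!powRD// ?(gt_eqF z0) ?(gt_eqF z1) implybT.
Qed.

Lemma radial_powR s t q z : radial s t z `^ q = radial (s * q) (t * q) z.
Proof. by rewrite /radial powRM ?powR_ge0// -!powRrM. Qed.

Lemma radial_le s s' t z : pdisc z -> s' <= s -> radial s t z <= radial s' t z.
Proof.
move=> zD ss; rewrite ler_wpM2r ?powR_ge0//.
by apply: ger_powR => //; rewrite pdisc_gt0//= ltW//; apply: pdisc_disc zD.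
Qed.

Lemma radial00 z : radial 0 0 z = 1.
Proof. by rewrite /radial !powRr0 mulr1. Qed.

(** The radial factor of both integrands, relative to mu_{a,b}. *)
Definition phi := radial (2 * beta - 2 * b - m%:R) (alpha - a).

Definition majorant0 (u : plane R * plane R) : R :=
  nz u.1 `^ (- m%:R) * (phi u.2 * kdist u.1 u.2 `^ (- (2 + alpha))).

(** On the punctured disc all bases of powers are positive, so that exponents
    add up without exceptions. *)
Definition majorant : plane R * plane R -> R := majorant0 \_ (@pdisc R `*` @pdisc R).

Lemma majorantE z w : pdisc z -> pdisc w -> majorant (z, w) = majorant0 (z, w).
Proof. by move=> zD wD; rewrite /majorant patchE mem_set. Qed.

Lemma majorant_out u : ~ (pdisc u.1 /\ pdisc u.2) -> majorant u = 0.
Proof. by move=> uD; rewrite /majorant patchE memNset. Qed.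

Let mpd : measurable (@pdisc R). Proof. exact: measurable_pdisc. Qed.

Lemma majorant_ge0 u : 0 <= majorant u.
Proof.
by rewrite /majorant patchE; case: ifPn => // _; rewrite !mulr_ge0 ?radial_ge0 ?powR_ge0.
Qed.

Lemma measurable_majorant : measurable_fun setT majorant.
Proof.
apply/(measurable_restrictT majorant0); first exact: measurableX.
apply: measurable_funTS; apply: measurable_funM.
  apply: measurable_fun_powR.
  exact: (measurableT_comp (@measurable_cmod_cplx R) measurable_fst).
apply: measurable_funM.
  exact: (measurableT_comp (measurable_radial _ _) measurable_snd).
by apply: measurable_fun_powR; exact: measurable_kdist2.
Qed.

Lemma majorant_pdisc u : 0 < majorant u -> pdisc u.1 /\ pdisc u.2.
Proof.
by rewrite /majorant patchE; case: ifPn => [/[!inE] -[]//|_]; rewrite ltxx.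
Qed.

(** The Forelli-Rudin estimate in w with c = t leaves |z|^-m, which is at most
    |z|^-s. *)
Lemma row_bound s t : -2 < 2 * beta - m%:R - s -> -1 < alpha - t -> 0 < t ->
  m%:R <= s -> exists2 C, 0 <= C & forall z,
  (\int[mu]_w (majorant (z, w) * radial (- s) (- t) w)%:E
   <= (C * radial (- s) (- t) z)%:E)%E.
Proof.
move=> h1 h2 h3 h4.
have [|||C C0 Cle] := @forelli_rudin_pdisc _ a b
  (2 * beta - 2 * b - m%:R - s) (alpha - a - t) t; [lra|lra|done|].
rewrite (_ : 2 + (alpha - a - t + a) + t = 2 + alpha) in Cle; last by ring.
exists C => // z; have [zD|zD] := pselect (pdisc z); last first.
  rewrite integral0_eq ?lee_fin ?(mulr_ge0 C0 (radial_ge0 _ _ _))// => w _.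
  by rewrite majorant_out ?mul0r// => -[].
apply: (le_trans (Cle z (nz z `^ (- m%:R)) _ (pdisc_disc zD) (powR_ge0 _ _) _ _)).
- move=> w wD; rewrite majorantE// /majorant0/= /phi.
  rewrite -mulrA; congr (_ * _).
  by rewrite mulrAC radialM// /radial; ring.
- by move=> w wD; rewrite majorant_out ?mul0r// => -[].
rewrite lee_fin ler_wpM2l// -/(radial (- m%:R) (- t) z).
by apply: radial_le => //; rewrite lerN2.
Qed.

(** The Forelli-Rudin estimate in z with c = alpha - a + t leaves a power of |w|
    that is at most |w|^-s. *)
Lemma col_bound s t : -2 < 2 * b - m%:R - s -> -1 < a - t -> 0 < alpha - a + t ->
  0 <= 2 * beta - 2 * b - m%:R + s -> exists2 C, 0 <= C & forall w,
  (\int[mu]_z (radial (- s) (- t) z * majorant (z, w))%:E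
   <= (C * radial (- s) (- t) w)%:E)%E.
Proof.
move=> h1 h2 h3 h4.
have [|||C C0 Cle] := @forelli_rudin_pdisc _ a b
  (- s - m%:R) (- t) (alpha - a + t); [lra|lra|done|].
rewrite (_ : 2 + (- t + a) + (alpha - a + t) = 2 + alpha) in Cle; last by ring.
exists C => // w; have [wD|wD] := pselect (pdisc w); last first.
  rewrite integral0_eq ?lee_fin ?(mulr_ge0 C0 (radial_ge0 _ _ _))// => z _.
  by rewrite majorant_out ?mulr0// => -[].
apply: (le_trans (Cle w (phi w) _ (pdisc_disc wD) (radial_ge0 _ _ _) _ _)).
- move=> z zD; rewrite majorantE// /majorant0/= kdistC.
  rewrite powRD; last by rewrite (gt_eqF (pdisc_gt0 zD)) implybT.
  by rewrite /radial; ring.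
- by move=> z zD; rewrite majorant_out ?mulr0// => -[].
rewrite lee_fin ler_wpM2l//.
rewrite -[X in _ * X]mul1r -[X in X * (1 - _) `^ _](powRr0 (nz w)).
rewrite -/(radial 0 (- (alpha - a + t)) w) /phi radialM// addr0.
rewrite (_ : alpha - a - (alpha - a + t) = - t); last by ring.
by apply: radial_le => //; rewrite lerNl -subr_ge0 opprK addrC.
Qed.

Definition exponent_condition p : Prop := p * (alpha + 1) > a + 1 /\
    (p = 1 -> m%:R - 2 < 2 * b /\ 2 * b <= 2 * beta - m%:R) /\
    (1 < p -> p * m%:R - 2 < 2 * b /\
              2 * b < p * (2 * beta + 2) - p * m%:R - 2).

Lemma between2 (x1 x2 y1 y2 : R) : x1 < y1 -> x1 < y2 -> x2 < y1 -> x2 < y2 ->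
  exists s, [/\ x1 < s, x2 < s, s < y1 & s < y2].
Proof.
move=> *; exists ((Num.max x1 x2 + Num.min y1 y2) / 2).
have h : Num.max x1 x2 < Num.min y1 y2 by rewrite lt_min !gt_max; lra.
have [h1 h2] := midf_lt h.
by move: h1 h2; rewrite gt_max lt_min => /andP[-> ->] /andP[-> ->].
Qed.

(** For p = 1 the column bound with s = t = 0 is the boundedness on L^1. For
    p > 1 Schur's test function is |z|^(-s/p) (1 - |z|^2)^(-t/p); the two bounds
    confine s and t to open intervals, and the exponent condition says that
    these intervals meet. *)
Lemma majorant_bounded p : -1 < a -> -1 < alpha -> -1 < beta - m%:R ->
  1 <= p -> exponent_condition p ->
  exists2 C, 0 <= C & forall F : plane R -> R, measurable_fun setT F ->
    (forall w, 0 <= F w) ->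
    (\int[mu]_z (kint mu majorant F z `^ p) <= C%:E * \int[mu]_w (F w `^ p)%:E)%E.
Proof.
move=> a1 al1 b01; rewrite le_eqVlt => /predU1P[<-|p1] [ha [hp1 hp]].
  have [h1 h2] := hp1 erefl; rewrite mul1r in ha.
  have [||||C C0 Cle] := @col_bound 0 0; [lra|lra|lra|lra|].
  exists C => // F mF F0.
  apply: (@schur_tonelli _ _ _ _ _ _ measurable_majorant majorant_ge0 mF F0 _ _ (cst 1) (cst 1)) => //.
  - move=> z; rewrite poweRe1 ?kint_ge0//; last exact: majorant_ge0.
    rewrite le_eqVlt; apply/predU1P; left; apply: eq_integral => w _.
    by rewrite powRr1// mulr1 mul1r.
  - move=> w; have := Cle w; rewrite oppr0 radial00 mulr1; apply: le_trans.
    rewrite le_eqVlt; apply/predU1P; left; apply: eq_integral => z _.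
    by rewrite radial00 mulr1.
have {hp hp1}[h1 h2] := hp p1.
have p0 : 0 < p by exact: lt_trans p1.
pose q := p / (p - 1).
have p10 : 0 < p - 1 by rewrite subr_gt0.
have q0 : 0 < q by rewrite divr_gt0.
have pq : p^-1 + q^-1 = 1.
  by rewrite /q invf_div; field; rewrite gt_eqF.
(* the first and third bounds on s and t come from row_bound with exponents
   s / (p - 1) and t / (p - 1), the others from col_bound *)
have [s [s1 s2 s3 s4]] : exists s, [/\ m%:R * (p - 1) < s,
    m%:R + 2 * b - 2 * beta < s, s < (2 * beta - m%:R + 2) * (p - 1) &
    s < 2 * b - m%:R + 2].
  apply: between2; [|lra|lra|lra].
  by rewrite ltr_pM2r//; lra.
have [t [t1 t2 t3 t4]] : exists t, [/\ 0 < t, a - alpha < t,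
    t < (alpha + 1) * (p - 1) & t < a + 1].
  apply: between2; [|lra|lra|lra].
  by rewrite mulr_gt0//; lra.
have qS x : x / p * q = x / (p - 1) by rewrite /q mulrA divfK// gt_eqF.
have [||||C1 C10 row] := @row_bound (s / (p - 1)) (t / (p - 1)).
- have : s / (p - 1) < 2 * beta - m%:R + 2 by rewrite ltr_pdivrMr.
  lra.
- have : t / (p - 1) < alpha + 1 by rewrite ltr_pdivrMr.
  lra.
- by rewrite divr_gt0.
- by rewrite ler_pdivlMr// ltW.
have [||||C2 C20 col] := @col_bound s t; [lra|lra|lra|lra|].
pose C := Num.max C1 C2.
have C0 : 0 <= C by rewrite le_max C10.
exists (C `^ (p / q) * C) => [|F mF F0]; first by rewrite mulr_ge0 ?powR_ge0.
apply: (@schur_test _ _ _ _ _ _ measurable_majorant majorant_ge0 mF F0 p q C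
  (radial (- (s / p)) (- (t / p)))) => //.
- exact: measurable_radial.
- by move=> w; exact: radial_ge0.
- by move=> z w /majorant_pdisc[_ wD]; exact: radial_gt0.
- move=> z; rewrite radial_powR !mulNr !qS.
  under eq_integral do rewrite radial_powR !mulNr !qS.
  by apply: le_trans (row z) _; rewrite lee_fin ler_wpM2r ?radial_ge0// le_max lexx.
- move=> w; rewrite radial_powR !mulNr !divfK ?gt_eqF//.
  under eq_integral do rewrite radial_powR !mulNr !divfK ?gt_eqF//.
  by apply: le_trans (col w) _; rewrite lee_fin ler_wpM2r ?radial_ge0// le_max lexx orbT.
Qed.

End majorant.

(** * Operators with a regular kernel: sufficiency *)

Section kernel_operator.
Variable R : realType.
Variables (a b alpha beta : R) (m : nat).
Variables (k e : plane R -> R[i]) (K : R[i] -> R[i]).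
Implicit Types (z w : plane R) (f : plane R -> R[i]) (p : R).
Local Notation nz z := (cmod (cplx z)).
Local Notation mu := (mu_disc a b).
Local Notation phi := (phi a b alpha beta m).
Local Notation M := (majorant a b alpha beta m).

(** The common form of the operators A and B: k has modulus |z|^-m, e is a phase,
    and K is the kernel as a function of z w^*. *)
Definition kop_integrand f z w : R[i] :=
  f w * e w * (phi w)%:C * K (cplx z * (cplx w)^*).

Definition kop f z : R[i] := k z * cintegral mu (kop_integrand f z).

Definition kop_bounded p : Prop :=
  bounded_on_Lp mu p (fun f z => cintegrable mu (kop_integrand f z)) kop.

Definition kop_regular : Prop :=
  [/\ cmeas (disc R) k /\ (forall z, cmod (k z) = (nz z ^+ m)^-1),
      [/\ cmeas (disc R) e, forall w, cmod (e w) <= 1 &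
          forall w, pdisc w -> cmod (e w) = 1] &
      kernel_regular (2 + alpha) K].

Let mD : measurable (disc R). Proof. exact: measurable_disc. Qed.
Let mpd : measurable (@pdisc R). Proof. exact: measurable_pdisc. Qed.

Lemma poweR_Lp_norm p f : 0 < p ->
  (Lp_norm mu p f `^ p = \int[mu]_(z in disc R) (cmod (f z) `^ p)%:E)%E.
Proof.
move=> p0; rewrite /Lp_norm poweR_Lnorm ?gt_eqF// [RHS]integral_mkcond.
apply: eq_integral => z _; rewrite !patchE; case: ifPn => // _.
  by rewrite gee0_abs ?poweR_EFin// lee_fin cmod_ge0.
by rewrite abse0 poweR_EFin powR0// gt_eqF.
Qed.

Lemma Lp_norm_ge0 p f : (0 <= Lp_norm mu p f)%E.
Proof. exact: Lnorm_ge0. Qed.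

Lemma Lp_norm_le p f (X : \bar R) : 0 < p -> (0 <= X)%E ->
  (\int[mu]_(z in disc R) (cmod (f z) `^ p)%:E <= X `^ p)%E -> (Lp_norm mu p f <= X)%E.
Proof.
move=> p0 X0; rewrite -poweR_Lp_norm// => h.
have := ge0_le_poweR (_ : 0 <= p^-1) (poweR_ge0 _ _) h.
by rewrite invr_ge0 (ltW p0) -!poweRrM !divff ?gt_eqF// !poweRe1 ?Lp_norm_ge0//; exact.
Qed.

Section measurability.
Hypothesis hreg : kop_regular.
Variable f : plane R -> R[i].
Hypothesis mf : cmeas (disc R) f.

Let mfst (g : plane R -> R[i]) : cmeas (disc R) g ->
  cmeas (@disc2 R) (fun u => g u.2).
Proof.
move=> [g1 g2]; split.
  apply: (measurable_comp mD _ g1); first by move=> _ [u [_ u2] <-].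
  by apply: measurable_funTS; exact: measurable_snd.
apply: (measurable_comp mD _ g2); first by move=> _ [u [_ u2] <-].
by apply: measurable_funTS; exact: measurable_snd.
Qed.

Let integrand2 : cmeas (@disc2 R) (fun u => kop_integrand f u.1 u.2).
Proof.
have [_ [me _ _] [_ _ mK]] := hreg.
apply: cmeasM => //; apply: cmeasM.
  by apply: cmeasM; exact: mfst.
apply: (mfst (g := fun w => (phi w)%:C)); apply: cmeas_real.
by apply: measurable_funTS; exact: measurable_radial.
Qed.

Lemma cmeas_integrand z : disc R z -> cmeas (disc R) (kop_integrand f z).
Proof.
move=> zD; have [h1 h2] := integrand2.
have mz : measurable_fun (disc R) (pair z).
  by apply: measurable_funTS; exact: measurable_pair1.
have zdisc : pair z @` disc R `<=` @disc2 R by move=> _ [w wD <-].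
split.
  exact: (measurable_comp (@measurable_disc2 R) zdisc h1 mz).
exact: (measurable_comp (@measurable_disc2 R) zdisc h2 mz).
Qed.

Let measurable_Rint (g : plane R * plane R -> R) : measurable_fun (@disc2 R) g ->
  measurable_fun (disc R) (fun z => \int[mu]_(w in disc R) g (z, w)).
Proof.
move=> mg; pose J := (EFin \o g) \_ (@disc2 R).
have mJ : measurable_fun setT J.
  apply/(measurable_restrictT (EFin \o g) (@measurable_disc2 R)).
  exact/measurable_EFinP.
apply: (eq_measurable_fun (fine \o (fun z => \int[mu]_w (J (z, w)))%E)).
  move=> z /[!inE] zD /=; rewrite /Rintegral [in RHS]integral_mkcond.
  congr fine; apply: eq_integral => w _; rewrite /J !patchE.
  have -> : ((z, w) \in @disc2 R) = (w \in disc R).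
    by apply/idP/idP => /[!inE]; [case|].
  by [].
apply: measurable_funTS; apply: measurableT_comp.
  exact: fine_measurable.
under eq_fun do rewrite integralE.
apply: emeasurable_funB.
  have := @measurable_fun_fubini_tonelli_F _ _ _ _ _ mu _ (measurable_funepos mJ).
  move=> /(_ (funepos_ge0 _)); apply: eq_measurable_fun => z _.
  by rewrite /fubini_F; apply: eq_integral => w _; rewrite !funeposE.
have := @measurable_fun_fubini_tonelli_F _ _ _ _ _ mu _ (measurable_funeneg mJ).
move=> /(_ (funeneg_ge0 _)); apply: eq_measurable_fun => z _.
by rewrite /fubini_F; apply: eq_integral => w _; rewrite !funenegE.
Qed.

Lemma cmeas_kop : cmeas (disc R) (kop f).
Proof.
have [[mk _] _ _] := hreg; have [h1 h2] := integrand2.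
by apply: cmeasM mk _; split; [exact: measurable_Rint h1|exact: measurable_Rint h2].
Qed.

End measurability.

Let normr_fine_le (x : \bar R) : (`|fine x|%:E <= `|x|)%E.
Proof. by case: x => [r| |] //=; rewrite ?normr0 ?leey. Qed.

(** The real and the imaginary part are bounded separately, whence the factor
    2. *)
Lemma cmod_cintegral_le (g : plane R -> R[i]) : cmeas (disc R) g ->
  ((cmod (cintegral mu g))%:E <= 2%:E * \int[mu]_(w in disc R) (cmod (g w))%:E)%E.
Proof.
move=> mg; have [mR mI] := mg; have mC := cmeas_cmod mg.
have half (L : R[i] -> R) : (forall u, `|L u| <= cmod u) ->
    measurable_fun (disc R) (L \o g) ->
    (`|\int[mu]_(w in disc R) L (g w)|%R%:E <=
     \int[mu]_(w in disc R) (cmod (g w))%:E)%E.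
  move=> Lle mL; apply: le_trans (normr_fine_le _) _.
  apply: le_trans (le_abse_integral _ mD _) _; first exact/measurable_EFinP.
  apply: ge0_le_integral => //.
  - by apply: measurableT_comp => //; exact/measurable_EFinP.
  - exact/measurable_EFinP.
  - by move=> w _; rewrite lee_fin Lle.
apply: (@le_trans _ _ (`|complex.Re (cintegral mu g)|%:E + `|complex.Im (cintegral mu g)|%:E)%E).
  by rewrite -EFinD lee_fin cmod_le_ReIm.
rewrite mule_natl mule2n; apply: leeD; apply: half => //.
- exact: normr_Re_le.
- exact: normr_Im_le.
Qed.

Lemma cintegrable_cmod (g : plane R -> R[i]) : cmeas (disc R) g ->
  (\int[mu]_(w in disc R) (cmod (g w))%:E < +oo)%E -> cintegrable mu g.
Proof.
move=> mg fin; have [mR mI] := mg; have mC := cmeas_cmod mg.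
split; apply/integrableP; (split; first exact/measurable_EFinP);
  apply: le_lt_trans fin; apply: ge0_le_integral => //.
- by apply: measurableT_comp => //; exact/measurable_EFinP.
- exact/measurable_EFinP.
- by move=> w _; rewrite lee_fin normr_Re_le.
- by apply: measurableT_comp => //; exact/measurable_EFinP.
- exact/measurable_EFinP.
- by move=> w _; rewrite lee_fin normr_Im_le.
Qed.

(** Off the origin, the integral defining T f(z) is dominated by the majorant
    applied to |f|. That the latter is in L^p gives the norm inequality and also
    the absolute convergence of the integral for almost every z. *)
Lemma kop_bounded_of_majorant p (C : R) : kop_regular -> 1 <= p -> 0 <= C ->
  (forall F : plane R -> R, measurable_fun setT F -> (forall w, 0 <= F w) ->
    (\int[mu]_z (kint mu M F z `^ p) <= C%:E * \int[mu]_w (F w `^ p)%:E)%E) ->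
  kop_bounded p.
Proof.
move=> hreg p1 C0 bnd; have [[mk kE] [me e1 _] [[CK CK0 CKle] _ _]] := hreg.
have p0 : 0 < p by exact: lt_le_trans p1.
exists ((2 `^ p * (C * CK `^ p)) `^ p^-1) => f [mf fN].
have mi z : disc R z -> cmeas (disc R) (kop_integrand f z) by exact: cmeas_integrand.
have mcf : measurable_fun (disc R) (fun w => cmod (f w)) by exact: cmeas_cmod.
pose F := (fun w => CK * cmod (f w)) \_ (@pdisc R).
have F0 w : 0 <= F w.
  by rewrite /F patchE; case: ifPn => // _; rewrite mulr_ge0 ?cmod_ge0.
have mF : measurable_fun setT F.
  apply/(measurable_restrictT _ mpd); apply: measurable_funM => //.
  by apply: measurable_funS mcf => //; exact: pdisc_disc.
have FN : (\int[mu]_w (F w `^ p)%:E = (CK `^ p)%:E * Lp_norm mu p f `^ p)%E.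
  rewrite poweR_Lp_norm// integral_pdisc; last 2 first.
  - by apply/measurable_EFinP; exact: measurable_fun_powR.
  - by move=> z _; rewrite lee_fin powR_ge0.
  rewrite -ge0_integralZl_EFin ?powR_ge0//; last 2 first.
  - by move=> z _; rewrite lee_fin powR_ge0.
  - apply/measurable_EFinP; apply: measurable_fun_powR.
    by apply: measurable_funS mcf => //; exact: pdisc_disc.
  rewrite [RHS]integral_mkcond; apply: eq_integral => w _.
  rewrite /F !patchE; case: ifPn => _; first by rewrite -EFinM powRM ?cmod_ge0.
  by rewrite powR0// gt_eqF.
pose X z := (\int[mu]_(w in disc R) (cmod (kop_integrand f z w))%:E)%E.
have XF z : pdisc z -> (((nz z ^+ m)^-1)%:E * X z <= kint mu M F z)%E.
  move=> zD; have zd := pdisc_disc zD; have mz := cmeas_cmod (mi z zd).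
  rewrite /X integral_pdisc//; last 2 first.
  - exact/measurable_EFinP.
  - by move=> w _; rewrite lee_fin cmod_ge0.
  rewrite -ge0_integralZl_EFin ?invr_ge0 ?exprn_ge0 ?cmod_ge0//; last 2 first.
  - by move=> w _; rewrite lee_fin cmod_ge0.
  - apply/measurable_EFinP; apply: measurable_funS mz => //; exact: pdisc_disc.
  rewrite [leLHS]integral_mkcond; apply: ge0_le_integral => //.
  - move=> w _; rewrite patchE; case: ifPn => // _; rewrite lee_fin.
    by rewrite mulr_ge0 ?invr_ge0 ?exprn_ge0 ?cmod_ge0.
  - apply/(measurable_restrictT _ mpd); apply/measurable_EFinP.
    apply: measurable_funM => //; apply: measurable_funS mz => //; exact: pdisc_disc.
  - apply/measurable_EFinP; apply: measurable_funM => //.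
    by apply: (measurableT_comp (measurable_majorant a b alpha beta m)); exact: measurable_pair1.
  move=> w _; rewrite /F /majorant !patchE; case: ifPn => [|wD]; last first.
    by rewrite mulr0.
  rewrite inE => wD; rewrite mem_set//= lee_fin /majorant0/=.
  have -> : nz z `^ (- m%:R) = (nz z ^+ m)^-1.
    by rewrite powRN powR_mulrn ?cmod_ge0.
  rewrite -[leRHS]mulrA ler_wpM2l ?invr_ge0 ?exprn_ge0 ?cmod_ge0//.
  rewrite /kop_integrand !cmodM cmod_real ger0_norm ?radial_ge0//.
  have kle := CKle _ (pairing_disc zd (pdisc_disc wD)).
  rewrite (_ : _ * (CK * _) = cmod (f w) * 1 * phi w * (CK * kdist z w `^ (- (2 + alpha)))); last by ring.
  apply: ler_pM; [by rewrite !(radial_ge0, cmod_ge0, mulr_ge0)|exact: cmod_ge0| |exact: kle].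
  by rewrite ler_wpM2r ?radial_ge0// ler_wpM2l ?cmod_ge0.
have kopX z : pdisc z -> ((cmod (kop f z))%:E <= 2%:E * kint mu M F z)%E.
  move=> zD; have zd := pdisc_disc zD; rewrite /kop cmodM kE EFinM.
  apply: le_trans (_ : _ <= 2%:E * (((nz z ^+ m)^-1)%:E * X z))%E _.
    rewrite muleCA lee_wpmul2l ?lee_fin ?invr_ge0 ?exprn_ge0 ?cmod_ge0//.
    exact: cmod_cintegral_le (mi z zd).
  by rewrite lee_wpmul2l ?lee_fin//; exact: XF.
have intk : (\int[mu]_z (kint mu M F z `^ p) <=
    (C * CK `^ p)%:E * Lp_norm mu p f `^ p)%E.
  by apply: le_trans (bnd F mF F0) _; rewrite FN EFinM muleA.
have mkop : cmeas (disc R) (kop f) by exact: cmeas_kop.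
have mkint : measurable_fun setT (fun z => kint mu M F z `^ p)%E.
  apply: measurableT_comp (measurable_poweR p) _.
  by apply: measurable_kint => //; [exact: measurable_majorant|exact: majorant_ge0].
have kint0 z : (0 <= kint mu M F z)%E.
  by apply: kint_ge0 => //; exact: majorant_ge0.
have normle : (Lp_norm mu p (kop f) <=
    ((2 `^ p * (C * CK `^ p)) `^ p^-1)%:E * Lp_norm mu p f)%E.
  apply: Lp_norm_le => //.
    by rewrite mule_ge0 ?Lp_norm_ge0// lee_fin powR_ge0.
  have mck : measurable_fun (disc R) (fun w => cmod (kop f w) `^ p).
    by apply: measurable_fun_powR; exact: cmeas_cmod.
  rewrite integral_pdisc; last 2 first.
  - exact/measurable_EFinP.
  - by move=> z _; rewrite lee_fin powR_ge0.
  rewrite poweRM ?Lp_norm_ge0 ?lee_fin ?powR_ge0// poweR_EFin -powRrM mulVf ?gt_eqF//.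
  rewrite powRr1 ?mulr_ge0 ?powR_ge0// EFinM -muleA.
  apply: le_trans (lee_wpmul2l _ intk); last by rewrite lee_fin powR_ge0.
  rewrite -ge0_integralZl_EFin ?powR_ge0//; last by move=> z _; exact: poweR_ge0.
  rewrite [leLHS]integral_mkcond; apply: ge0_le_integral => //.
  - by move=> z _; rewrite patchE; case: ifPn => // _; rewrite lee_fin powR_ge0.
  - apply/(measurable_restrictT _ mpd); apply/measurable_EFinP.
    by apply: measurable_funS mck => //; exact: pdisc_disc.
  - by apply: emeasurable_funM => //; exact: measurable_cst.
  move=> z _; rewrite patchE; case: ifPn => [/[!inE] zD|_]; last first.
    by rewrite mule_ge0 ?poweR_ge0// lee_fin powR_ge0.
  rewrite -poweR_EFin -[X in (X * _)%E]poweR_EFin -poweRM ?lee_fin//.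
  by apply: ge0_le_poweR (kopX z zD); [exact: ltW|rewrite lee_fin cmod_ge0].
have Npoo : (Lp_norm mu p f `^ p < +oo)%E by exact: poweR_lty.
split => //; last first.
  split => //; apply: le_lt_trans normle _.
  by rewrite lte_mul_pinfty ?lee_fin ?powR_ge0.
have ik : mu.-integrable setT (fun z => kint mu M F z `^ p)%E.
  apply/integrableP; split => //.
  under eq_integral do rewrite gee0_abs ?poweR_ge0//.
  apply: le_lt_trans intk _; rewrite lte_mul_pinfty ?lee_fin ?mulr_ge0 ?powR_ge0//.
have ae0 : {ae mu, forall z, z <> ((0 : R), (0 : R))}.
  exists [set ((0 : R), (0 : R))]; split.
  - exact: measurable_plane_set1.
  - exact: mu_disc_set1.
  - by move=> z /= /contrapT.
apply: filterS2 (integrable_ae measurableT ik) ae0 => z kf z0 zd.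
have zD : pdisc z by split.
apply: cintegrable_cmod; first exact: mi.
have kfin : (kint mu M F z < +oo)%E.
  apply: (@lty_poweRy _ _ p); first by rewrite gt_eqF.
  by rewrite -ge0_fin_numE ?poweR_ge0//; exact: kf.
have := le_lt_trans (XF z zD) kfin.
have i0 : 0 < (nz z ^+ m)^-1 by rewrite invr_gt0 exprn_gt0// pdisc_gt0.
rewrite -/(X z); case: (X z) => [r _| |]; rewrite ?ltry//.
by rewrite mulry gtr0_sg// mul1e.
Qed.

Lemma kop_bounded_of_exponents p : -1 < a -> -1 < alpha -> -1 < beta - m%:R ->
  1 <= p -> kop_regular -> exponent_condition a b alpha beta m p -> kop_bounded p.
Proof.
move=> a1 al1 b1 p1 hreg h3; have [C C0 bnd] := majorant_bounded a1 al1 b1 p1 h3.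
exact: kop_bounded_of_majorant hreg p1 C0 bnd.
Qed.

End kernel_operator.

(** * Divergence over dyadic layers *)

Section dyadic_divergence.
Context d (T : measurableType d) (R : realType) (mu : {measure set T -> \bar R}).
Local Open Scope ereal_scope.

(** The sets S n lie in disjoint layers of l, each contributes at least eps, and
    the first N of them are contained in the domain of integration. *)
Lemma dyadic_divergence (E : set T) (S : nat -> set T) (G l : T -> R)
    (t eps : R) (c : nat -> R) N :
  measurable E -> measurable_fun E G -> (forall x, E x -> (0 <= G x)%R) ->
  measurable_fun setT l -> (0 < t)%R ->
  (forall n, measurable (S n)) -> (forall n, S n `<=` E) ->
  (forall n x, S n x -> (t * 2^-1 ^+ n.+1 <= l x < t * 2^-1 ^+ n)%R) ->
  (forall n, (0 <= c n)%R) -> (forall n x, S n x -> (c n <= G x)%R) ->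
  (forall n, eps%:E <= (c n)%:E * mu (S n)) ->
  (N%:R * eps)%:E <= \int[mu]_(x in E `&` [set x | (t * 2^-1 ^+ N <= l x)%R]) (G x)%:E.
Proof.
move=> mE mG G0 ml t0 mS SE Sl c0 cG eps_le.
set El := _ `&` _.
have mEl : measurable El.
  apply: measurableI => //; rewrite (_ : [set x | _] = setT `&` l @^-1` `[(t * 2^-1 ^+ N)%R, +oo[).
    exact: ml.
  by rewrite setTI; apply/seteqP; split => x /=; rewrite in_itv/= andbT.
pose B := \big[setU/set0]_(i <- index_iota 0 N) S i.
have mB : measurable B by exact: bigsetU_measurable.
have BEl : B `<=` El.
  move=> x; rewrite /B -bigcup_seq => -[n /=].
  rewrite mem_index_iota => nN Sx; split; first exact: SE Sx.
  have /andP[+ _] := Sl _ _ Sx; apply: le_trans; rewrite ler_pM2l//.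
  by rewrite ler_wiXn2l ?invr_ge0 ?invf_le1 ?ler1n.
have mGB : measurable_fun B (EFin \o G).
  apply/measurable_EFinP; apply: measurable_funS mG => // x /BEl[]//.
apply: (@le_trans _ _ (\int[mu]_(x in B) (G x)%:E)); last first.
  apply: ge0_subset_integral => //.
    apply/measurable_EFinP; apply: measurable_funS mG => //; exact: subIsetl.
  by move=> x [/G0 ? _]; rewrite lee_fin.
rewrite /B ge0_integral_bigsetU//; last 3 first.
- exact: iota_uniq.
- move=> i j _ _ [x [/Sl/andP[i1 i2] /Sl/andP[j1 j2]]].
  have half k k' : (t * 2^-1 ^+ k.+1 <= l x)%R -> (l x < t * 2^-1 ^+ k')%R -> (k' <= k)%N.
    move=> h1 h2; rewrite leqNgt; apply/negP => kk.
    have := le_lt_trans h1 h2; rewrite ltr_pM2l// ltNge ler_wiXn2l//.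
    by rewrite invf_le1// ler1n.
  by apply/eqP; rewrite eqn_leq !half.
- by move=> x /BEl [/G0 ? _]; rewrite lee_fin.
rewrite big_mkord.
apply: (@le_trans _ _ (\sum_(i < N) eps%:E)).
  by rewrite sumEFin lee_fin sumr_const card_ord mulr_natl.
apply: lee_sum => i _; apply: le_trans (eps_le i) _.
rewrite -integral_cst//; apply: ge0_le_integral => //.
- by move=> x _; rewrite lee_fin.
- by apply/measurable_EFinP; apply: measurable_funS mG.
- by move=> x Sx; rewrite lee_fin cG.
Qed.

End dyadic_divergence.

(** * Divergent integrals at the critical exponents *)

Section divergence.
Variable R : realType.
Variables (a b : R).
Hypotheses (a1 : -1 < a) (b1 : -1 < b).
Implicit Types (x y s t r B : R) (z w : plane R).
Local Notation leb2 := (@prod_leb R).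
Local Notation nz z := (cmod (cplx z)).
Local Notation mu := (mu_disc a b).

Let mD : measurable (disc R). Proof. exact: measurable_disc. Qed.
Let mpd : measurable (@pdisc R). Proof. exact: measurable_pdisc. Qed.

Definition density_cst : R := pi^-1 * (euler_beta (a + 1) (b + 1))^-1.

Lemma density_cst_gt0 : 0 < density_cst.
Proof.
rewrite mulr_gt0 ?invr_gt0 ?pi_gt0// euler_beta_gt0//; first by rewrite -ltrBlDr sub0r.
by rewrite -ltrBlDr sub0r.
Qed.

Lemma densityE z : pi^-1 * weight a b z = density_cst * radial (2 * b) a z.
Proof. by rewrite /weight /density_cst /radial !mulrA. Qed.

Lemma powR_half_one_ge x s : 2^-1 <= x -> x <= 1 -> 2 `^ (- `|s|) <= x `^ s.
Proof.
move=> x2 x1; have x0 : 0 < x by apply: lt_le_trans x2; rewrite invr_gt0.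
rewrite powRN -[leRHS]invrK lef_pV2 ?posrE ?invr_gt0 ?powR_gt0//.
by rewrite -powRN -normrN; exact: powR_half_one.
Qed.

Lemma le_integral_mu (E : set (plane R)) (G G' : plane R -> R) :
  measurable E -> E `<=` disc R -> measurable_fun E G -> measurable_fun E G' ->
  (forall z, E z -> 0 <= G z) -> (forall z, E z -> 0 <= G' z) ->
  (forall z, E z -> G' z <= G z * (density_cst * radial (2 * b) a z)) ->
  (\int[leb2]_(z in E) (G' z)%:E <= \int[mu]_(z in E) (G z)%:E)%E.
Proof.
move=> mE ED mG mG' G0 G'0 GG'.
have -> : (\int[mu]_(z in E) (G z)%:E =
    \int[leb2]_(z in E) (G z * (density_cst * radial (2 * b) a z))%:E)%E.
  have EDE : disc R `&` E = E by apply/setIidPr.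
  rewrite -{1}EDE integral_mkcondr integral_mu_disc//; last 2 first.
  - apply/measurable_restrict => //; rewrite EDE.
    exact/measurable_EFinP.
  - by move=> z _; rewrite patchE; case: ifPn => // /[!inE] Ez; rewrite lee_fin G0.
  rewrite -[in RHS]EDE [RHS]integral_mkcondr; apply: eq_integral => z _.
  by rewrite !patchE; case: ifPn; rewrite ?mul0e// densityE -EFinM.
apply: ge0_le_integral => //.
- exact/measurable_EFinP.
- apply/measurable_EFinP; apply: measurable_funM => //; apply: measurable_funM => //.
  by apply: measurable_funTS; exact: measurable_radial.
Qed.

Lemma mu_disc_gt0 (E : set (plane R)) : measurable E -> E `<=` disc R ->
  (0 < leb2 E)%E -> (0 < mu E)%E.
Proof.
move=> mE ED E0; pose o : plane R := ((0 : R), (0 : R)).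
have mE' : measurable (E `\` [set o]).
  by apply: measurableD => //; exact: measurable_plane_set1.
have E'0 : (0 < leb2 (E `\` [set o]))%E.
  rewrite lt0e measure_ge0 andbT; apply/negP => /eqP E'0.
  have : (leb2 E <= leb2 (E `\` [set o]) + leb2 [set o])%E.
    have mz : measurable [set o] by exact: measurable_plane_set1.
    apply: (@le_trans _ _ (leb2 ((E `\` [set o]) `|` [set o])));
      last by apply: measureU2.
    apply: le_measure; rewrite ?inE//.
      by apply: measurableU => //; exact: measurable_plane_set1.
    by move=> z Ez; have [z0|z0] := pselect (z = o); [right|left].
  by rewrite E'0 prod_leb_set1 adde0 leNgt E0.
apply: (@lt_le_trans _ _ (mu (E `\` [set o]))); last first.
  by apply: le_measure; rewrite ?inE//; exact: subIsetl.
rewrite mu_discE//.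
have E'D : (E `\` [set o]) `&` disc R = E `\` [set o].
  by apply/setIidPl => z [/ED].
rewrite E'D; apply: integral_gt0 => //.
- apply: measurable_funM => //; apply: measurable_funTS; exact: measurable_weight.
- move=> z [Ez z0]; rewrite densityE mulr_gt0 ?density_cst_gt0//.
  by apply: radial_gt0; split => //; exact: ED.
Qed.

Lemma measurable_rect (i j : interval R) :
  measurable ([set` i] `*` [set` j] : set (plane R)).
Proof.
have := @measurableX _ _ (measurableTypeR R) (measurableTypeR R) [set` i] [set` j].
by apply; exact: measurable_itv.
Qed.

Lemma prod_leb_rectE x x' y y' : x < x' -> y < y' ->
  leb2 (`[x, x'[%classic `*` `[y, y']%classic) = ((x' - x) * (y' - y))%:E /\
  leb2 (`]x, x']%classic `*` `[y, y']%classic) = ((x' - x) * (y' - y))%:E.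
Proof.
move=> xx yy; rewrite !prod_leb_rect//; try exact: measurable_itv.
by rewrite !lebesgue_measure_itv/= !lte_fin xx yy -!EFinB -EFinM.
Qed.

Lemma mu_disc_gt0_rect (E : set (plane R)) x x' y : measurable E -> E `<=` disc R ->
  x < x' -> 0 < y -> (forall z, x <= (z.1 : R) < x' -> 0 <= (z.2 : R) <= y -> E z) ->
  (0 < mu E)%E.
Proof.
move=> mE ED xx y0 rE; apply: mu_disc_gt0 => //.
apply: (@lt_le_trans _ _ (leb2 (`[x, x'[%classic `*` `[0, y]%classic))).
  by rewrite (prod_leb_rectE xx y0).1 lte_fin mulr_gt0// ?subr0// subr_gt0.
apply: le_measure; rewrite ?inE//; first exact: measurable_rect.
by move=> z [/=]; rewrite !in_itv/=; exact: rE.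
Qed.

Let tn0 t n : 0 < t -> 0 < t * 2^-1 ^+ n.
Proof. by move=> t0; rewrite mulr_gt0// exprn_gt0// invr_gt0. Qed.

Let tnS t n : t * 2^-1 ^+ n.+1 = t * 2^-1 ^+ n / 2.
Proof. by rewrite exprS; ring. Qed.

Let tn_le t n : 0 < t -> t * 2^-1 ^+ n <= t.
Proof.
by move=> t0; rewrite ler_piMr ?(ltW t0)// exprn_ile1 ?invr_ge0// invf_le1 ?ler1n.
Qed.

Lemma divergence_unbounded (I : nat -> \bar R) eps : 0 < eps ->
  (forall N, ((N%:R * eps)%:E <= I N)%E) -> forall B, exists N, (B%:E <= I N)%E.
Proof.
move=> e0 h B; exists (Num.truncn (B / eps)).+1; apply: le_trans (h _).
by rewrite lee_fin -ler_pdivrMr// ltW// truncnS_gt.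
Qed.

(** Near the origin the integrand times the density of mu_{a,b} is comparable to
    |z|^-2, and the annulus |z| ~ 2^-n contains a rectangle of area ~ 4^-n. *)
Lemma divergence_origin r B : 0 < r -> r <= 2^-1 -> exists2 rho, 0 < rho &
  (B%:E <= \int[mu]_(z in (@pdisc R `&` [set z | (nz z < r)%R]) `&`
     [set z | (rho <= nz z)%R]) (nz z `^ (- (2 * b + 2)))%:E)%E.
Proof.
move=> r0 r2; pose t := r / 2; have t0 : 0 < t by rewrite divr_gt0.
pose E : set (plane R) := @pdisc R `&` [set z | nz z < r].
have mE : measurable E.
  apply: measurableI => //; rewrite -[X in measurable X]setCK; apply: measurableC.
  rewrite (_ : ~` _ = [set z | r <= nz z]).
    by apply: measurable_ge_set; exact: measurable_cmod_cplx.
  by apply/seteqP; split => z /=; rewrite leNgt => /negP.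
pose x n := t * 2^-1 ^+ n.
have x0 n : 0 < x n by exact: tn0.
have xS n : x n.+1 = x n / 2 by exact: tnS.
have xt n : x n <= t by exact: tn_le.
pose S n : set (plane R) := `[x n.+1, x n[%classic `*` `[0, x n.+1]%classic.
pose k := density_cst * 2 `^ (- `|a|).
have k0 : 0 < k by rewrite mulr_gt0 ?density_cst_gt0 ?powR_gt0.
pose G z := k * nz z `^ (- 2).
have mnz s (F : set (plane R)) : measurable_fun F (fun z => nz z `^ s).
  by apply: measurable_funTS; apply: measurable_fun_powR; exact: measurable_cmod_cplx.
have Sle n z : S n z -> 0 < nz z /\ nz z <= 3 / 2 * x n.
  move=> Sz.
  have /andP[h1 h2] : x n.+1 <= (z.1 : R) < x n by case: Sz => /=; rewrite in_itv.
  have /andP[h3 h4] : 0 <= (z.2 : R) <= x n.+1 by case: Sz => _ /=; rewrite in_itv.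
  have hx : 0 < (z.1 : R) by apply: lt_le_trans h1.
  split; first by apply: lt_le_trans hx _; exact: Re_le_cmod (cplx z).
  apply: le_trans (cmod_le_ReIm _) _; rewrite /= gtr0_norm// ger0_norm//.
  by rewrite xS in h4; lra.
have SE n : S n `<=` E.
  move=> z Sz; have [z0 zx] := Sle _ _ Sz.
  have zr : nz z < r by apply: le_lt_trans zx _; have := xt n; rewrite /t; lra.
  split => //; split; first by apply: lt_le_trans zr _; lra.
  by move=> /= zE; move: z0; rewrite zE (_ : cplx _ = 0)// cmod0 ltxx.
pose c n := k * (3 / 2 * x n) `^ (- 2).
have low N : ((N%:R * (k / 9))%:E <=
    \int[leb2]_(z in E `&` [set z | (t * 2^-1 ^+ N <= z.1)%R]) (G z)%:E)%E.
  apply: (@dyadic_divergence _ _ _ leb2 E S G (fun z => z.1 : R) t _ c) => //.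
  - by apply: measurable_funM => //.
  - by move=> z _; rewrite mulr_ge0 ?powR_ge0// ltW.
  - exact: measurable_fst.
  - by move=> n; exact: measurable_rect.
  - by move=> n z [/=]; rewrite in_itv.
  - by move=> n; rewrite mulr_ge0 ?powR_ge0// ltW.
  - move=> n z Sz; have [z0 zx] := Sle _ _ Sz.
    rewrite ler_pM2l// !powRN lef_pV2 ?posrE ?powR_gt0 ?mulr_gt0 ?x0//.
    by rewrite ge0_ler_powR ?nnegrE ?(ltW z0)// mulr_ge0// ltW.
  - move=> n; have xlt : x n.+1 < x n by rewrite xS; have := x0 n; lra.
    apply: (@le_trans _ _ ((c n)%:E * leb2 (S n))%E) => //.
    rewrite /S; have [-> _] := prod_leb_rectE xlt (x0 n.+1).
    rewrite -EFinM lee_fin /c powRN powR_mulrn; last by rewrite mulr_ge0 ?(ltW (x0 n)).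
    rewrite xS subr0.
    rewrite le_eqVlt; apply/predU1P; left.
    by have := x0 n; move: (x n) => y y0; field; rewrite gt_eqF.
have [N hN] := divergence_unbounded (divr_gt0 k0 (ltr0n _ 9)) low B.
exists (t * 2^-1 ^+ N); first exact: x0.
apply: (le_trans hN).
have mEN (h : plane R -> R) : measurable_fun setT h ->
    measurable (E `&` [set z | t * 2^-1 ^+ N <= h z]).
  by move=> mh; apply: measurableI => //; exact: measurable_ge_set.
apply: (@le_trans _ _ (\int[leb2]_(z in E `&` [set z | (t * 2^-1 ^+ N <= nz z)%R]) (G z)%:E)%E).
  apply: ge0_subset_integral => //.
  - by apply: mEN; exact: measurable_fst.
  - by apply: mEN; exact: measurable_cmod_cplx.
  - by apply/measurable_EFinP; apply: measurable_funM.
  - by move=> z _; rewrite lee_fin mulr_ge0 ?powR_ge0// ltW.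
  - by move=> z [Ez /= h]; split => //=; apply: le_trans h _; exact: Re_le_cmod (cplx z).
apply: le_integral_mu => //.
- by apply: mEN; exact: measurable_cmod_cplx.
- by move=> z [[/pdisc_disc]].
- by apply: measurable_funM.
- by move=> z _; exact: powR_ge0.
- by move=> z _; rewrite mulr_ge0 ?powR_ge0// ltW.
move=> z [[zD /= zr] _]; have z0 := pdisc_gt0 zD.
rewrite /G /k /radial mulrCA -mulrA ler_pM2l ?density_cst_gt0//.
rewrite mulrA [X in _ <= X * _ `^ a](_ : _ = nz z `^ (-2)); last first.
  rewrite -powRD; last by rewrite (gt_eqF z0) implybT.
  by congr (_ `^ _); ring.
rewrite mulrC ler_wpM2l ?powR_ge0//; apply: powR_half_one_ge.
  have : nz z ^+ 2 <= 2^-1 ^+ 2.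
    by rewrite ler_pXn2r ?nnegrE ?cmod_ge0//; apply: ltW; apply: lt_le_trans zr r2.
  by lra.
exact: one_sub_sqr_le1.
Qed.

(** Near the circle the integrand times the density is comparable to
    1 / (1 - |z|^2), and the layer 1 - |z|^2 ~ 2^-n has area ~ 2^-n, as its
    horizontal slices at heights in [0, 1/2] show. *)
Lemma divergence_boundary B : exists2 rho, 0 < rho &
  (B%:E <= \int[mu]_(z in (@pdisc R `&` [set z | (2^-1 <= nz z)%R]) `&`
     [set z | (rho <= 1 - nz z ^+ 2)%R]) ((1 - nz z ^+ 2) `^ (- (a + 1)))%:E)%E.
Proof.
pose t : R := 4^-1; have t0 : 0 < t by rewrite invr_gt0.
pose l z : R := 1 - nz z ^+ 2.
have ml : measurable_fun setT l by exact: measurable_one_sub_sqr.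
pose E : set (plane R) := @pdisc R `&` [set z | 2^-1 <= nz z].
have mE : measurable E.
  by apply: measurableI => //; apply: measurable_ge_set; exact: measurable_cmod_cplx.
pose x n := t * 2^-1 ^+ n.
have x0 n : 0 < x n by exact: tn0.
have xS n : x n.+1 = x n / 2 by exact: tnS.
have xt n : x n <= t by exact: tn_le.
pose S n : set (plane R) := (([set: R] `*` `[0, 2^-1]) `&`
  (`]0, +oo[ `*` [set: R])) `&` l @^-1` `[x n.+1, x n[.
have mS n : measurable (S n).
  apply: measurableI.
    by apply: measurableI; rewrite -set_itvNyy; exact: measurable_rect.
  by rewrite -[X in measurable X]setTI; exact: ml.
pose k := density_cst * 2 `^ (- `|2 * b|).
have k0 : 0 < k by rewrite mulr_gt0 ?density_cst_gt0 ?powR_gt0.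
pose G z := k * l z `^ (- 1).
have ml1 s : measurable_fun setT (fun z => l z `^ s) by exact: measurable_fun_powR.
have Sl n z : S n z -> x n.+1 <= l z < x n by move=> [_]; rewrite /= in_itv.
have SE n : S n `<=` E.
  move=> z Sz; have /andP[l1 l2] := Sl _ _ Sz.
  have z1 : nz z < 1.
    rewrite -(@ltr_pXn2r _ 2) ?nnegrE ?cmod_ge0// expr1n -subr_gt0.
    exact: lt_le_trans l1.
  have z2 : 2^-1 <= nz z.
    rewrite -(@ler_pXn2r _ 2) ?nnegrE ?cmod_ge0//.
    by have := xt n; move: l2; rewrite /l /t; lra.
  split => //; split => //= z0; move: z2; rewrite z0 (_ : cplx _ = 0)// cmod0; lra.
have Sarea n : ((x n / 4)%:E * lebesgue_measure (`[0%R, (2^-1)%R]%classic : set R) <= leb2 (S n))%E.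
  apply: prod_leb_yslice_ge => //; first by rewrite divr_ge0 ?(ltW (x0 n)).
  move=> y; rewrite /= in_itv/= => /andP[y0 y2].
  have yy : y ^+ 2 <= 4^-1 by nra.
  have xn := xt n; rewrite /t in xn.
  pose u := Num.sqrt (1 - y ^+ 2 - x n); pose v := Num.sqrt (1 - y ^+ 2 - x n / 2).
  have u2 : u ^+ 2 = 1 - y ^+ 2 - x n by rewrite sqr_sqrtr//; lra.
  have v2 : v ^+ 2 = 1 - y ^+ 2 - x n / 2 by rewrite sqr_sqrtr//; have := x0 n; lra.
  have u0 : 0 <= u by exact: sqrtr_ge0.
  have v0 : 0 <= v by exact: sqrtr_ge0.
  have uv : x n / 4 <= v - u.
    have xn0 := x0 n; have uv0 : u <= v by apply: ler_wsqrtr; lra.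
    have v1 : v <= 1.
      by rewrite -(@ler_pXn2r _ 2) ?nnegrE// v2 expr1n; have := sqr_ge0 y; lra.
    have : (v - u) * (v + u) = x n / 2 by rewrite -subr_sqr u2 v2; lra.
    have : (v - u) * (v + u) <= (v - u) * 2 by rewrite ler_wpM2l ?subr_ge0//; lra.
    lra.
  have uv' : u < v by have := x0 n; lra.
  apply: (@le_trans _ _ (lebesgue_measure (`]u, v]%classic : set R))).
    by rewrite lebesgue_measure_itv/= lte_fin uv' -EFinB lee_fin.
  apply: le_measure; rewrite ?inE//; first exact: measurable_ysection.
  move=> w; rewrite /= in_itv/= => /andP[uw wv].
  have w0 : 0 < w by exact: le_lt_trans uw.
  rewrite /ysection/= inE; split; first by split; split; rewrite //= in_itv/= ?y0 ?w0.
  by rewrite /= in_itv/= /l sqr_cmod_cplx/= xS; nra.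
have low N : ((N%:R * (k / 8))%:E <=
    \int[leb2]_(z in E `&` [set z | (t * 2^-1 ^+ N <= l z)%R]) (G z)%:E)%E.
  apply: (@dyadic_divergence _ _ _ leb2 E S G l t _ (fun n => k * (x n) `^ (-1))) => //.
  - by apply: measurable_funTS; apply: measurable_funM.
  - by move=> z _; rewrite mulr_ge0 ?powR_ge0// ltW.
  - by move=> n; rewrite mulr_ge0 ?powR_ge0// ltW.
  - move=> n z /Sl /andP[l1 l2]; have l0 : 0 < l z by exact: lt_le_trans l1.
    rewrite ler_pM2l// !powRN lef_pV2 ?posrE ?powR_gt0 ?x0// !powRr1 ?ltW//.
  - move=> n; apply: (@le_trans _ _ ((k * x n `^ (-1))%:E *
      ((x n / 4)%:E * lebesgue_measure (`[0%R, (2^-1)%R]%classic : set R)))%E); last first.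
      by apply: lee_wpmul2l (Sarea n); rewrite lee_fin mulr_ge0 ?powR_ge0// ltW.
    rewrite lebesgue_measure_itv/= lte_fin invr_gt0 ltr0n -EFinB -!EFinM lee_fin.
    rewrite powR_inv1 ?(ltW (x0 n))// le_eqVlt; apply/predU1P; left.
    by have := x0 n; move: (x n) => y y0; field; rewrite gt_eqF.
have [N hN] := divergence_unbounded (divr_gt0 k0 (ltr0n _ 8)) low B.
exists (t * 2^-1 ^+ N); first exact: x0.
apply: (le_trans hN); apply: le_integral_mu => //.
- by apply: measurableI => //; apply: measurable_ge_set.
- by move=> z [[/pdisc_disc]].
- by apply: measurable_funTS; exact: ml1.
- by apply: measurable_funTS; apply: measurable_funM.
- by move=> z _; exact: powR_ge0.
- by move=> z _; rewrite mulr_ge0 ?powR_ge0// ltW.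
move=> z [[zD /= zr] _]; have l0 := one_sub_sqr_gt0 (pdisc_disc zD).
rewrite -/(l z) in l0 *; rewrite /G /k /radial -/(l z) mulrCA -mulrA ler_pM2l ?density_cst_gt0//.
rewrite mulrCA -[X in _ <= _ * X]powRD; last by rewrite (gt_eqF l0) implybT.
rewrite (_ : - (a + 1) + a = -1); last by ring.
rewrite ler_wpM2r ?powR_ge0//; apply: powR_half_one_ge => //.
exact: ltW (pdisc_disc zD).
Qed.

(** If z is in a narrow cone with vertex 1 and w is so close to 1 that
    dl = z (1 - w)^* is small compared with 1 - Re z, then z w^* = z - dl is in
    a slightly wider cone, where kernels are bounded below. *)
Lemma cone_perturbation eta et (zeta dl : R[i]) :
  et <= 4^-1 -> et <= eta / 4 -> 0 < 1 - complex.Re zeta ->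
  0 <= complex.Im zeta <= et * (1 - complex.Re zeta) ->
  cmod dl <= et * (1 - complex.Re zeta) ->
  cmod (1 - (zeta - dl)) <= 2 * (1 - complex.Re zeta) /\
  `|complex.Im (zeta - dl)| <= eta * (1 - complex.Re (zeta - dl)).
Proof.
move=> et4 ete x0 /andP[y0 yl] dlh.
move: (le_trans (normr_Re_le dl) dlh) (le_trans (normr_Im_le dl) dlh) => {dlh}.
have := cmod_le_ReIm (1 - (zeta - dl)); rewrite !ReB !ImB /= sub0r normrN.
move: (complex.Im zeta) (complex.Re dl) (complex.Im dl) y0 yl => y dx dy.
move: (complex.Re zeta) x0 => zx; set x := 1 - zx => x0 y0 yl h.
rewrite !ler_norml => /andP[R1 R2] /andP[I1 I2]; rewrite -!ler_norml.
have etx : et * x <= x / 4 by nra.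
have etax : et * x <= eta / 4 * x by rewrite ler_pM2r.
have xE : 1 - (zx - dx) = x + dx by rewrite /x; ring.
have yi : `|y - dy| <= 2 * (et * x) by rewrite ler_norml; lra.
split.
  by apply: (le_trans h); rewrite xE ger0_norm; lra.
rewrite xE; apply: (le_trans yi); have {}h : 3 / 4 * x <= x + dx by lra.
have eta0 : 0 <= eta by nra.
apply: le_trans (ler_wpM2l eta0 h); nra.
Qed.

(** A half cone with vertex 1, bounded by the real axis and cut at distance
    t. *)
Definition cone1 eta t : set (plane R) :=
  [set z | 0 <= (z.2 : R)] `&` [set z | (z.2 : R) <= eta * (1 - z.1)] `&`
  ([set z | 0 < 1 - (z.1 : R)] `&` [set z | 1 - (z.1 : R) <= t]).

Let m1 : measurable_fun setT (fun z : plane R => 1 - (z.1 : R)).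
Proof. by apply: measurable_funB => //; exact: measurable_fst. Qed.

Lemma measurable_cone1 eta t : measurable (cone1 eta t).
Proof.
apply: measurableI; apply: measurableI.
- by apply: measurable_ge_set; exact: measurable_snd.
- rewrite (_ : [set z | _] = [set z | (z.2 : R) - eta * (1 - (z.1 : R)) <= 0]).
    apply: measurable_le_set; apply: measurable_funB; first exact: measurable_snd.
    exact: measurable_funM.
  by apply/seteqP; split => z /=; rewrite subr_le0.
- rewrite -[X in measurable X]setTI.
  rewrite (_ : [set z | _] = (fun z : plane R => 1 - (z.1 : R)) @^-1` `]0, +oo[).
    exact: m1.
  by apply/seteqP; split => z /=; rewrite in_itv/= andbT.
- exact: measurable_le_set.
Qed.

Lemma cone1_bounds eta t z : 0 < eta -> eta <= 4^-1 -> t <= 4^-1 -> cone1 eta t z ->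
  [/\ pdisc z, 2^-1 <= nz z, 1 - (z.1 : R) <= 1 - nz z ^+ 2 &
      1 - nz z ^+ 2 <= 2 * (1 - (z.1 : R))].
Proof.
move=> e0 e4 t4 [[/= y0 yl] [/= u0 ut]].
move: y0 yl u0 ut; set y := (z.2 : R); set u := 1 - _ => y0 yl u0 ut.
have zE : nz z ^+ 2 = (1 - u) ^+ 2 + y ^+ 2.
  by rewrite sqr_cmod_cplx /u subKr.
have u4 : u <= 4^-1 by exact: le_trans t4.
have y4 : y <= u / 4 by nra.
have yy : y ^+ 2 <= u ^+ 2 / 16 by nra.
have uu : u ^+ 2 <= u / 4 by nra.
have y2 := sqr_ge0 y; have u2 := sqr_ge0 u.
have z1 : nz z < 1.
  by rewrite -(@ltr_pXn2r _ 2) ?nnegrE ?cmod_ge0// expr1n zE; nra.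
have z2 : 2^-1 <= nz z.
  by rewrite -(@ler_pXn2r _ 2) ?nnegrE ?cmod_ge0// zE; nra.
split => //; try by rewrite zE; lra.
by split => //= z0; move: z2; rewrite z0 (_ : cplx _ = 0)// cmod0; lra.
Qed.

(** In the cone 1 - |z|^2 is comparable to 1 - Re z, so that the integrand times
    the density is comparable to (1 - Re z)^-2, and the n-th layer contains a
    rectangle of area ~ 4^-n. The growth in N is quantified because the test
    function of [alpha_neq_a] depends on N. *)
Lemma divergence_cone eta t : 0 < eta -> eta <= 4^-1 -> 0 < t -> t <= 4^-1 ->
  exists2 eps, 0 < eps & forall N, ((N%:R * eps)%:E <=
    \int[mu]_(z in cone1 eta t `&` [set z | (t * 2^-1 ^+ N <= 1 - (z.1 : R))%R])
      ((1 - (z.1 : R)) `^ (- (2 + a)))%:E)%E.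
Proof.
move=> e0 e4 t0 t4.
pose x n := t * 2^-1 ^+ n.
have x0 n : 0 < x n by exact: tn0.
have xS n : x n.+1 = x n / 2 by exact: tnS.
have xt n : x n <= t by exact: tn_le.
have mE := measurable_cone1 eta t.
pose S n : set (plane R) := `]1 - x n, 1 - x n.+1]%classic `*` `[0, eta * x n.+1]%classic.
pose k := density_cst * (2 `^ (- `|2 * b|) * 2 `^ (- `|a|)).
have k0 : 0 < k by rewrite mulr_gt0 ?density_cst_gt0 ?mulr_gt0 ?powR_gt0.
pose G z := k * (1 - (z.1 : R)) `^ (- 2).
have mp s : measurable_fun setT (fun z : plane R => (1 - (z.1 : R)) `^ s).
  exact: measurable_fun_powR.
have Sl n z : S n z -> x n.+1 <= 1 - (z.1 : R) < x n.
  by move=> [/=]; rewrite in_itv/=; lra.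
have SE n : S n `<=` cone1 eta t.
  move=> z Sz; have /andP[l1 l2] := Sl _ _ Sz.
  have /andP[h3 h4] : 0 <= (z.2 : R) <= eta * x n.+1 by case: Sz => _ /=; rewrite in_itv.
  split; split => //=.
  - by apply: le_trans h4 _; rewrite ler_pM2l.
  - exact: lt_le_trans l1.
  - by apply: ltW; apply: lt_le_trans l2 _.
exists (k * eta / 4) => [|N]; first by rewrite divr_gt0// mulr_gt0.
have low : ((N%:R * (k * eta / 4))%:E <=
    \int[leb2]_(z in cone1 eta t `&` [set z | (t * 2^-1 ^+ N <= 1 - (z.1 : R))%R]) (G z)%:E)%E.
  apply: (@dyadic_divergence _ _ _ leb2 _ S G (fun z => 1 - (z.1 : R)) t _
    (fun n => k * (x n) `^ (-2))) => //.
  - by apply: measurable_funTS; apply: measurable_funM.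
  - by move=> z _; rewrite mulr_ge0 ?powR_ge0// ltW.
  - by move=> n; exact: measurable_rect.
  - by move=> n; rewrite mulr_ge0 ?powR_ge0// ltW.
  - move=> n z /Sl /andP[l1 l2]; have l0 : 0 < 1 - (z.1 : R) by exact: lt_le_trans l1.
    rewrite ler_pM2l// !powRN lef_pV2 ?posrE ?powR_gt0 ?x0//.
    by rewrite ge0_ler_powR ?nnegrE ?ltW// ltW.
  - move=> n; have xlt : 1 - x n < 1 - x n.+1 by rewrite xS; have := x0 n; lra.
    have elt : 0 < eta * x n.+1 by rewrite mulr_gt0.
    apply: (@le_trans _ _ ((k * x n `^ (-2))%:E * leb2 (S n))%E) => //.
    rewrite /S; have [_ ->] := prod_leb_rectE xlt elt.
    rewrite -EFinM lee_fin powRN powR_mulrn ?(ltW (x0 n))// xS.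
    rewrite le_eqVlt; apply/predU1P; left.
    by have := x0 n; move: (x n) => y y0; field; rewrite gt_eqF.
apply: (le_trans low); apply: le_integral_mu => //.
- by apply: measurableI => //; apply: measurable_ge_set.
- by move=> z [zc _]; have [/pdisc_disc] := cone1_bounds e0 e4 t4 zc.
- by apply: measurable_funTS; exact: mp.
- by apply: measurable_funTS; apply: measurable_funM.
- by move=> z _; exact: powR_ge0.
- by move=> z _; rewrite mulr_ge0 ?powR_ge0// ltW.
move=> z [zc _]; have [zD z2 zl zu] := cone1_bounds e0 e4 t4 zc.
have u0 : 0 < 1 - (z.1 : R) by case: zc => _ [].
rewrite /G /k /radial [leRHS]mulrCA -[leLHS]mulrA ler_pM2l ?density_cst_gt0//.
have := powR_dyadic a u0 zl zu; set u := 1 - (z.1 : R) in u0 zl zu *.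
rewrite -ler_pdivrMl ?powR_gt0// -powRN => ua.
rewrite mulrCA -mulrA; apply: ler_pM; rewrite ?powR_ge0 ?mulr_ge0 ?powR_ge0//.
  by apply: powR_half_one_ge => //; exact: ltW (pdisc_disc zD).
rewrite (_ : - 2 = - (2 + a) + a); last by ring.
rewrite powRD; last by rewrite (gt_eqF u0) implybT.
by rewrite mulrCA ler_wpM2l ?powR_ge0.
Qed.

End divergence.

(** * Operators with a regular kernel: necessity *)

Section necessity.
Variable R : realType.
Variables (a b alpha beta : R) (m : nat).
Variables (k e : plane R -> R[i]) (K : R[i] -> R[i]).
Implicit Types (z w : plane R) (g : plane R -> R) (c s t : R).
Local Notation nz z := (cmod (cplx z)).
Local Notation mu := (mu_disc a b).
Local Notation leb2 := (@prod_leb R).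
Local Notation Phi := (phi a b alpha beta m).
Local Notation integrand := (kop_integrand a b alpha beta m e K).
Local Notation T := (kop a b alpha beta m k e K).
Hypotheses (a1 : -1 < a) (b1 : -1 < b) (al1 : -1 < alpha)
  (hreg : kop_regular alpha m k e K).

Let mD : measurable (disc R). Proof. exact: measurable_disc. Qed.
Let mpd : measurable (@pdisc R). Proof. exact: measurable_pdisc. Qed.

Let mphi : measurable_fun setT Phi. Proof. exact: measurable_radial. Qed.
Let phi0 w : 0 <= Phi w. Proof. exact: radial_ge0. Qed.

Lemma mu_radial_lty s t : -2 < s + 2 * b -> -1 < t + a ->
  (\int[mu]_(w in disc R) (radial s t w)%:E < +oo)%E.
Proof.
move=> sb ta; have [C C0 Cle] := @forelli_rudin_mu R a b s t 1 sb ta ltr01.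
pose o : plane R := ((0 : R), (0 : R)).
have o0 : cplx o = 0 by [].
have Do : disc R o by rewrite /disc /preimage/mkset /unit_disc/mkset o0 cmod0 ltr01.
apply: le_lt_trans (ltry (C * (1 - nz o ^+ 2) `^ (-1))); apply: le_trans (Cle _ Do).
rewrite le_eqVlt; apply/predU1P; left; apply: eq_integral => w _.
by rewrite /kdist o0 mul0r subr0 cmod1 powR1 mulr1.
Qed.

Lemma mu_radial_sub_lty s t (E : set (plane R)) (f : plane R -> R) :
  -2 < s + 2 * b -> -1 < t + a -> measurable E -> E `<=` disc R ->
  f =1 radial s t -> (\int[mu]_(w in E) (f w)%:E < +oo)%E.
Proof.
move=> sb ta mE ED fE; apply: le_lt_trans (mu_radial_lty sb ta).
under eq_integral do rewrite fE; apply: ge0_subset_integral => //.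
- by apply/measurable_EFinP; apply: measurable_funTS; exact: measurable_radial.
- by move=> z _; rewrite lee_fin radial_ge0.
Qed.

(** The conjugate of e cancels the phase in the integrand, so that only K
    contributes an argument. *)
Definition test g w : R[i] := (e w)^* * (g w : R)%:C.

Lemma cmeas_test g : measurable_fun (disc R) g -> cmeas (disc R) (test g).
Proof.
move=> mg; have [_ [me _ _] _] := hreg.
by apply: cmeasM; [exact: cmeas_conj|exact: cmeas_real].
Qed.

Lemma cmod_test_le g w : 0 <= g w -> cmod (test g w) <= g w.
Proof.
move=> g0; have [_ [_ e1 _] _] := hreg.
by rewrite cmodM cmod_conj cmod_real ger0_norm// ler_piMl.
Qed.

Lemma kop_lower g z c : measurable_fun (disc R) g ->
  (forall w, disc R w -> 0 <= g w) -> disc R z -> 0 <= c ->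
  (forall w, disc R w -> 0 < g w -> c <= complex.Re (K (cplx z * (cplx w)^*))) ->
  cintegrable mu (integrand (test g) z) ->
  (((nz z ^+ m)^-1 * c)%:E * \int[mu]_(w in disc R) (g w * Phi w)%:E <=
   (cmod (T (test g) z))%:E)%E.
Proof.
move=> mg g0 zD c0 cK [iRe _].
have [[_ kE] [_ _ e1] _] := hreg.
have ReE w : complex.Re (integrand (test g) z w) =
    cmod (e w) ^+ 2 * (g w * Phi w) * complex.Re (K (cplx z * (cplx w)^*)).
  rewrite /kop_integrand /test.
  rewrite (_ : _ * e w * _ = (cmod (e w) ^+ 2 * (g w * Phi w))%:C); last first.
    have CM (x y : R) : (x * y)%:C = x%:C * y%:C :> R[i] by rewrite rmorphM.
    by rewrite (CM (cmod (e w) ^+ 2)) -mul_conj (CM (g w)); ring.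
  by rewrite Re_mul/= mul0r subr0.
have Re0 w : disc R w -> 0 <= complex.Re (integrand (test g) z w).
  move=> wD; rewrite ReE; have := g0 w wD; rewrite le_eqVlt => /predU1P[<-|gw].
    by rewrite mul0r mulr0 mul0r.
  apply: mulr_ge0; last exact: le_trans c0 (cK w wD gw).
  by apply: mulr_ge0; [exact: sqr_ge0|rewrite mulr_ge0 ?phi0 ?(ltW gw)].
have mRe : measurable_fun (disc R) (fun w => complex.Re (integrand (test g) z w)).
  by apply/measurable_EFinP; exact: measurable_int iRe.
have mgphi : measurable_fun (disc R) (fun w => g w * Phi w).
  by apply: measurable_funM => //; exact: measurable_funTS.
have low : (c%:E * \int[mu]_(w in disc R) (g w * Phi w)%:E <=
    \int[mu]_(w in disc R) (complex.Re (integrand (test g) z w))%:E)%E.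
  rewrite integral_pdisc//; last 2 first.
  - exact/measurable_EFinP.
  - by move=> w wD; rewrite lee_fin mulr_ge0 ?g0.
  rewrite [leRHS]integral_pdisc//; last first.
  - exact/measurable_EFinP.
  rewrite -ge0_integralZl_EFin//; last 2 first.
  - by move=> w /pdisc_disc wD; rewrite lee_fin mulr_ge0 ?g0.
  - by apply/measurable_EFinP; apply: measurable_funS mgphi => //; exact: pdisc_disc.
  apply: ge0_le_integral => //.
  - by move=> w /pdisc_disc wD; rewrite lee_fin mulr_ge0// mulr_ge0 ?g0.
  - apply/measurable_EFinP; apply: measurable_funM => //.
    by apply: measurable_funS mgphi => //; exact: pdisc_disc.
  - by apply/measurable_EFinP; apply: measurable_funS mRe => //; exact: pdisc_disc.
  move=> w wpD; have wD := pdisc_disc wpD; rewrite lee_fin ReE e1// expr1n mul1r.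
  have := g0 w wD; rewrite le_eqVlt => /predU1P[<-|gw].
    by rewrite !mul0r mulr0.
  rewrite mulrC; apply: ler_wpM2l; first by rewrite mulr_ge0 ?(ltW gw).
  exact: cK.
rewrite EFinM -muleA; apply: le_trans (lee_wpmul2l _ low) _.
  by rewrite lee_fin invr_ge0 exprn_ge0 ?cmod_ge0.
rewrite /kop cmodM kE EFinM lee_wpmul2l ?lee_fin ?invr_ge0 ?exprn_ge0 ?cmod_ge0//.
rewrite -(fineK (integrable_fin_num mD iRe)) lee_fin.
exact: (Re_le_cmod (cintegral mu (integrand (test g) z))).
Qed.

(** For z near 0 the point z w^* is near 0, whatever w is. *)
Lemma kernel_lower_origin : exists d c, [/\ 0 < d, d <= 2^-1, 0 < c &
  forall z w, disc R z -> nz z < d -> disc R w ->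
    c <= complex.Re (K (cplx z * (cplx w)^*))].
Proof.
have [_ _ [_ [c [r [eta [c0 r0 eta0 cP]]]] _]] := hreg.
pose d := Num.min (Num.min r 2^-1) (eta / 2).
have d0 : 0 < d by rewrite !lt_min r0 invr_gt0 ltr0n divr_gt0.
have dr : d <= r by rewrite !ge_min lexx.
have d2 : d <= 2^-1 by rewrite !ge_min lexx orbT.
have de : d <= eta / 2 by rewrite ge_min lexx orbT.
exists d, (c * 2 `^ (- (2 + alpha))); split => //; first by rewrite mulr_gt0 ?powR_gt0.
move=> z w zD zd wD; set xi := cplx z * _.
have xi1 : cmod xi < 1 by exact: pairing_disc.
have xid : cmod xi < d.
  apply: le_lt_trans zd; rewrite cmodM cmod_conj ler_piMr ?cmod_ge0//; exact: ltW.
have s0 : 0 <= 2 + alpha.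
  have al10 : 0 < alpha + 1 by rewrite -ltrBlDr sub0r.
  lra.
have Rexi := Re_le_cmod xi.
have Imxi := normr_Im_le xi.
have cone : `|complex.Im xi| <= eta * (1 - complex.Re xi).
  apply: le_trans Imxi _; apply: le_trans (ltW xid) _; apply: (le_trans de).
  rewrite ler_wpM2l ?(ltW eta0)//.
  by move: (le_lt_trans Rexi xid) d2; lra.
apply: le_trans (cP xi xi1 (or_introl (lt_le_trans xid dr)) cone).
rewrite ler_pM2l// !powRN lef_pV2 ?posrE ?powR_gt0//; last exact: kdist_gt0.
by rewrite ge0_ler_powR ?nnegrE ?cmod_ge0//; exact: kdist_le2.
Qed.

Section bounded.
Variable p : R.
Hypotheses (p1 : 1 <= p) (bnd : kop_bounded a b alpha beta m k e K p).

Let p0 : 0 < p. Proof. exact: lt_le_trans p1. Qed.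

Lemma bounded_test : exists2 C, 0 <= C & forall g, measurable_fun (disc R) g ->
  (forall w, disc R w -> 0 <= g w) ->
  (\int[mu]_(w in disc R) (g w `^ p)%:E < +oo)%E ->
  {ae mu, forall z, disc R z -> cintegrable mu (integrand (test g) z)} /\
  (measurable_fun (disc R) (fun z => cmod (T (test g) z) `^ p) /\
  (\int[mu]_(z in disc R) (cmod (T (test g) z) `^ p)%:E <=
   C%:E * \int[mu]_(w in disc R) (g w `^ p)%:E)%E).
Proof.
have [C Cle] := bnd; exists (`|C| `^ p) => [|g mg g0 gfin]; first exact: powR_ge0.
have mt := cmeas_test mg.
have tle : (\int[mu]_(w in disc R) (cmod (test g w) `^ p)%:E <=
    \int[mu]_(w in disc R) (g w `^ p)%:E)%E.
  apply: ge0_le_integral => //.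
  - by move=> w _; rewrite lee_fin powR_ge0.
  - by apply/measurable_EFinP; apply: measurable_fun_powR; exact: cmeas_cmod.
  - by apply/measurable_EFinP; exact: measurable_fun_powR.
  - move=> w wD; rewrite lee_fin ge0_ler_powR ?nnegrE ?cmod_ge0 ?g0 ?(ltW p0)//.
    by rewrite cmod_test_le// g0.
have Lt : Lp mu p (test g).
  split => //; apply: (@lty_poweRy _ _ p); first by rewrite gt_eqF.
  by rewrite (poweR_Lp_norm _ _ _ p0); exact: le_lt_trans tle gfin.
have [h1 [h2 h2'] h3] := Cle _ Lt.
split; [exact: h1|split]; first by apply: measurable_fun_powR; exact: cmeas_cmod.
rewrite -(poweR_Lp_norm _ _ _ p0).
apply: (@le_trans _ _ ((`|C|%:E * Lp_norm mu p (test g)) `^ p)%E).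
  apply: ge0_le_poweR; [exact: ltW|exact: Lp_norm_ge0|].
  by apply: le_trans h3 _; rewrite lee_wpmul2r ?Lp_norm_ge0// lee_fin ler_norm.
rewrite poweRM ?Lp_norm_ge0// poweR_EFin lee_wpmul2l ?lee_fin ?powR_ge0//.
by rewrite (poweR_Lp_norm _ _ _ p0).
Qed.

Definition near0 d : set (plane R) := @pdisc R `&` [set z | nz z < d].

Lemma measurable_near0 d : measurable (near0 d).
Proof.
apply: measurableI => //; rewrite -[X in measurable X]setTI.
rewrite (_ : [set z | _] = (fun z => nz z) @^-1` `]-oo, d[).
  exact: (@measurable_cmod_cplx R).
by apply/seteqP; split => z /=; rewrite in_itv.
Qed.

Let mnzp (F : set (plane R)) : measurable_fun F (fun z => (nz z ^+ m)^-1 `^ p).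
Proof.
apply: measurable_funTS; apply: measurable_fun_powR; apply: measurable_fun_inv.
  by apply: measurable_funX; exact: measurable_cmod_cplx.
by move=> z; rewrite exprn_ge0 ?cmod_ge0.
Qed.

(** Near the origin [kop_lower] holds with a constant c, so that the image of a
    test function is at least a multiple of |z|^-m times the integral of
    g phi. *)
Lemma origin_test_inequality : exists d C, [/\ 0 < d, d <= 2^-1, 0 <= C &
  forall g, measurable_fun (disc R) g ->
  (forall w, disc R w -> 0 <= g w) ->
  (\int[mu]_(w in disc R) (g w `^ p)%:E < +oo)%E ->
  ((\int[mu]_(w in disc R) (g w * Phi w)%:E) `^ p *
     \int[mu]_(z in near0 d) ((nz z ^+ m)^-1 `^ p)%:E <=
   C%:E * \int[mu]_(w in disc R) (g w `^ p)%:E)%E].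
Proof.
have [d [c [d0 d2 c0 cK]]] := kernel_lower_origin.
have [C C0 Cle] := bounded_test.
exists d, (c `^ (- p) * C); split; [exact: d0|exact: d2| |move=> g mg g0 gfin].
  by rewrite mulr_ge0 ?powR_ge0.
have [aei [mk kle]] := Cle g mg g0 gfin.
set J := (\int[mu]_(w in disc R) (g w * Phi w)%:E)%E.
have J0 : (0 <= J)%E.
  by apply: integral_ge0 => w wD; rewrite lee_fin mulr_ge0 ?g0.
have md := measurable_near0 d.
have nD : near0 d `<=` disc R by move=> z [/pdisc_disc].
set Z := (\int[mu]_(z in near0 d) _)%E.
have Z0 : (0 <= Z)%E by apply: integral_ge0 => z _; rewrite lee_fin powR_ge0.
have main : ((c `^ p)%:E * (J `^ p * Z) <=
    \int[mu]_(z in disc R) (cmod (T (test g) z) `^ p)%:E)%E.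
  apply: (@le_trans _ _ (\int[mu]_(z in near0 d) (cmod (T (test g) z) `^ p)%:E)%E);
    last first.
    apply: ge0_subset_integral => //; first exact/measurable_EFinP.
    by move=> z _; rewrite lee_fin powR_ge0.
  have -> : ((c `^ p)%:E * (J `^ p * Z) =
     \int[mu]_(z in near0 d) (((nz z ^+ m)^-1 `^ p)%:E * (c%:E * J) `^ p))%E.
    rewrite ge0_integralZr//.
    - by rewrite poweRM ?lee_fin ?(ltW c0)// poweR_EFin muleA muleC.
    - exact/measurable_EFinP.
    - by move=> z _; rewrite lee_fin powR_ge0.
    - exact: poweR_ge0.
  apply: ae_ge0_le_integral; first exact: md.
  - by move=> z _; rewrite mule_ge0 ?poweR_ge0// lee_fin powR_ge0.
  - by apply: emeasurable_funM; [exact/measurable_EFinP|exact: measurable_cst].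
  - by move=> z _; rewrite lee_fin powR_ge0.
  - by apply/measurable_EFinP; exact: measurable_funS mk.
  apply: filterS aei => z iz [zpD /= zd]; have zD := pdisc_disc zpD.
  have i0 : 0 <= (nz z ^+ m)^-1 by rewrite invr_ge0 exprn_ge0 ?cmod_ge0.
  rewrite -!poweR_EFin -poweRM ?lee_fin ?mule_ge0 ?lee_fin ?(ltW c0)//.
  apply: ge0_le_poweR; first exact: ltW.
    by rewrite !mule_ge0 ?lee_fin ?(ltW c0).
  rewrite muleA -EFinM; apply: kop_lower => //; first exact: ltW.
    by move=> w wD _; exact: cK.
  exact: iz.
have -> : (J `^ p * Z = (c `^ (- p))%:E * ((c `^ p)%:E * (J `^ p * Z)))%E.
  by rewrite muleA -EFinM powRN mulVf ?mul1e// gt_eqF// powR_gt0.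
rewrite EFinM -[in leRHS]muleA; apply: lee_wpmul2l; first by rewrite lee_fin powR_ge0.
exact: le_trans main kle.
Qed.

Let disc_lty : (mu (disc R) < +oo)%E. Proof. exact: mu_disc_lty. Qed.

Let pdisc_mu_gt0 (E : set (plane R)) r : measurable E -> E `<=` disc R ->
  0 < r -> r <= 2^-1 -> (forall z, pdisc z -> nz z < r -> E z) -> (0 < mu E)%E.
Proof.
move=> mE ED r0 r2 rE.
apply: (@mu_disc_gt0_rect _ _ _ a1 b1 _ (r / 4) (r / 2) (r / 4)) => //; [lra|lra|].
move=> z /andP[x1 x2] /andP[y1 y2]; have r4 : 0 < r / 4 by lra.
have x0 : 0 < (z.1 : R) by exact: lt_le_trans x1.
have zr : nz z < r.
  apply: le_lt_trans (cmod_le_ReIm _) _ => /=.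
  by rewrite gtr0_norm// ger0_norm//; lra.
apply: rE => //; split; first by apply: lt_le_trans zr _; lra.
by move=> /= z0; move: x0; rewrite z0 ltxx.
Qed.

(** The test function g = 1 shows that |z|^(-p m) is integrable near the
    origin. *)
Lemma origin_exponent : p * m%:R - 2 < 2 * b.
Proof.
have [d [C [d0 d2 C0 Cle]]] := origin_test_inequality.
rewrite ltNge; apply/negP => hle.
have e1 : (\int[mu]_(w in disc R) ((cst 1 w : R) `^ p)%:E = mu (disc R))%E.
  rewrite -[RHS]mul1e -(integral_cst _ mD); apply: eq_integral => w _.
  by rewrite /cst powR1.
have := Cle (cst 1) (measurable_cst _) (fun _ _ => ler01); rewrite e1 => /(_ disc_lty).
set J := (\int[mu]_(w in disc R) _)%E; set W := (\int[mu]_(z in near0 d) _)%E => h.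
have J0 : (0 < J)%E.
  rewrite /J integral_pdisc//; last 2 first.
  - by apply/measurable_EFinP; apply: measurable_funM => //; exact: measurable_funTS.
  - by move=> w _; rewrite lee_fin mulr_ge0.
  apply: integral_gt0 => //.
  - by apply: (@pdisc_mu_gt0 _ 2^-1) => //; exact: pdisc_disc.
  - by apply: measurable_funM => //; exact: measurable_funTS.
  - by move=> w wD; rewrite mul1r; exact: radial_gt0.
have Woo : W = +oo%E.
  apply/eqP; rewrite -leye_eq leNgt; apply/negP => Wfin.
  have W0 : (0 <= W)%E by apply: integral_ge0 => z _; rewrite lee_fin powR_ge0.
  have [rho rho0] := @divergence_origin R a b a1 b1 d (fine W + 1) d0 d2.
  apply/negP; rewrite -ltNge; apply: (@le_lt_trans _ _ W); last first.
    by rewrite -(@fineK _ W) ?ge0_fin_numE// lte_fin ltrDl.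
  have mE : measurable (near0 d `&` [set z | rho <= nz z]).
    apply: measurableI; first exact: measurable_near0.
    by apply: measurable_ge_set; exact: measurable_cmod_cplx.
  apply: (@le_trans _ _ (\int[mu]_(z in near0 d `&` [set z | (rho <= nz z)%R])
     ((nz z ^+ m)^-1 `^ p)%:E)%E); last first.
    apply: ge0_subset_integral => //; first exact: measurable_near0.
    - exact/measurable_EFinP.
    - by move=> z _; rewrite lee_fin powR_ge0.
  apply: ge0_le_integral => //.
  - by move=> z _; rewrite lee_fin powR_ge0.
  - apply/measurable_EFinP; apply: measurable_funTS; apply: measurable_fun_powR.
    exact: measurable_cmod_cplx.
  - exact/measurable_EFinP.
  move=> z [[zD /= zd] _]; have z0 := pdisc_gt0 zD.
  rewrite lee_fin -[nz z ^+ m]powR_mulrn ?cmod_ge0// -powRN -powRrM.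
  apply: ger_powR; first by rewrite z0/= ltW//; apply: pdisc_disc zD.
  by rewrite mulNr lerN2; lra.
move: h; rewrite Woo leNgt => /negP; apply.
rewrite gt0_muley ?poweR_gt0//.
by apply: lte_mul_pinfty.
Qed.

(** Since |z|^(-p m) is integrable, what is left of [origin_test_inequality] is
    that phi defines a bounded functional on L^p. *)
Lemma functional_bounded : exists2 C, 0 <= C &
  forall g, measurable_fun (disc R) g -> (forall w, disc R w -> 0 <= g w) ->
  (\int[mu]_(w in disc R) (g w `^ p)%:E < +oo)%E ->
  ((\int[mu]_(w in disc R) (g w * Phi w)%:E) `^ p <=
   C%:E * \int[mu]_(w in disc R) (g w `^ p)%:E)%E.
Proof.
have [d [C [d0 d2 C0 Cle]]] := origin_test_inequality.
set W := (\int[mu]_(z in near0 d) ((nz z ^+ m)^-1 `^ p)%:E)%E in Cle.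
have nE z : (nz z ^+ m)^-1 `^ p = radial (- m%:R * p) 0 z.
  by rewrite /radial powRr0 mulr1 powRrM powRN powR_mulrn ?cmod_ge0.
have nD : near0 d `<=` disc R by move=> z [/pdisc_disc].
have Wfin : (W < +oo)%E.
  have oe := origin_exponent.
  by apply: mu_radial_sub_lty nE => //; [lra|rewrite add0r|exact: measurable_near0].
have W0 : (0 < W)%E.
  apply: integral_gt0 => //; first exact: measurable_near0.
  - apply: (@pdisc_mu_gt0 _ d) => //; exact: measurable_near0.
  - by move=> z [zD _]; rewrite nE; exact: radial_gt0.
have WE : W = (fine W)%:E by rewrite fineK// gt0_fin_numE.
have w0 : 0 < fine W by rewrite fine_gt0// W0.
exists ((fine W)^-1 * C) => [|g mg g0 gfin]; first by rewrite mulr_ge0// invr_ge0 ltW.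
have h := Cle g mg g0 gfin; rewrite EFinM -muleA.
apply: le_trans (lee_wpmul2l _ h); last by rewrite lee_fin invr_ge0 ltW.
by rewrite muleCA WE -EFinM mulVf ?mule1// gt_eqF.
Qed.

(** For phi ~ l^lam on a set where the layers of l have mass l^kap, the extremal
    test function is l^-(kap + lam), cut off where l < rho. The functional
    is then at least c I, where I is the integral of l^-kap over l >= rho, which
    is unbounded as rho tends to 0. For p = 1 and lam < 0 the norm of the test
    function stays bounded; for p > 1 and p (kap + lam) <= kap its p-th power is
    at most I, which grows more slowly than I^p. *)
Lemma layer_exponents (A : set (plane R)) (l : plane R -> R) (kap lam c : R) :
  measurable A -> A `<=` @pdisc R -> measurable_fun setT l -> 0 < c -> 0 < kap ->
  (forall z, A z -> 0 < l z <= 1 /\ c * l z `^ lam <= Phi z) ->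
  (forall B, exists2 rho, 0 < rho &
    (B%:E <= \int[mu]_(z in A `&` [set z | (rho <= l z)%R]) (l z `^ (- kap))%:E)%E) ->
  (lam < 0 -> (\int[mu]_(z in A) (l z `^ (- kap - lam))%:E < +oo)%E) ->
  (p = 1 -> 0 <= lam) /\ (1 < p -> kap < p * (kap + lam)).
Proof.
move=> mA ApD ml c0 kap0 Al divg lamfin.
have AD : A `<=` disc R by move=> z /ApD/pdisc_disc.
have [C C0 Cle] := functional_bounded.
pose Ar rho := A `&` [set z | rho <= l z].
have mAr rho : measurable (Ar rho).
  by apply: measurableI => //; exact: measurable_ge_set.
pose I rho := (\int[mu]_(z in Ar rho) (l z `^ (- kap))%:E)%E.
have mlp s (F : set (plane R)) : measurable_fun F (fun z => l z `^ s).
  by apply: measurable_funTS; exact: measurable_fun_powR.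
have Ifin rho : 0 < rho -> (I rho < +oo)%E.
  move=> rho0; apply: (@le_lt_trans _ _ (\int[mu]_(z in Ar rho) (rho `^ (- kap))%:E)%E).
    apply: ge0_le_integral => //.
    - by move=> z _; rewrite lee_fin powR_ge0.
    - exact/measurable_EFinP.
    move=> z [Az /= zr]; have [/andP[l0 _] _] := Al z Az.
    rewrite lee_fin !powRN lef_pV2 ?posrE ?powR_gt0//.
    by rewrite ge0_ler_powR ?nnegrE ?(ltW kap0) ?(ltW rho0) ?(ltW l0).
  rewrite (integral_cst _ (mAr rho)) lte_mul_pinfty ?lee_fin ?powR_ge0//.
  apply: le_lt_trans disc_lty; apply: le_measure; rewrite ?inE//.
  by move=> z [/AD].
(* the bounded functional at the test function l^-(kap + lam) on Ar rho *)
have testA rho : 0 < rho ->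
    (\int[mu]_(z in Ar rho) (l z `^ (- (kap + lam) * p))%:E < +oo)%E ->
    ((c%:E * I rho) `^ p <=
      C%:E * \int[mu]_(z in Ar rho) (l z `^ (- (kap + lam) * p))%:E)%E.
  move=> rho0 gfin.
  pose g := (fun z => l z `^ (- (kap + lam))) \_ (Ar rho).
  have mg : measurable_fun (disc R) g.
    by apply: measurable_funTS; apply/(measurable_restrictT _ (mAr rho)).
  have g0 w : disc R w -> 0 <= g w.
    by move=> _; rewrite /g patchE; case: ifPn => // _; exact: powR_ge0.
  have DAr : disc R `&` Ar rho = Ar rho by apply/setIidPr => z [/AD].
  have gp : (\int[mu]_(w in disc R) (g w `^ p)%:E =
      \int[mu]_(z in Ar rho) (l z `^ (- (kap + lam) * p))%:E)%E.
    rewrite -[in RHS]DAr integral_mkcondr; apply: eq_integral => w _.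
    rewrite /g !patchE; case: ifPn => _; first by rewrite powRrM.
    by rewrite powR0// gt_eqF.
  have := Cle g mg g0; rewrite gp => /(_ gfin); apply: le_trans.
  apply: ge0_le_poweR; first exact: ltW.
    apply: mule_ge0; first by rewrite lee_fin ltW.
    by apply: integral_ge0 => z _; rewrite lee_fin powR_ge0.
  rewrite -ge0_integralZl_EFin; last 4 first.
  - exact: mAr.
  - by move=> z _; rewrite lee_fin powR_ge0.
  - exact/measurable_EFinP.
  - exact: ltW.
  rewrite -[in leLHS]DAr integral_mkcondr; apply: ge0_le_integral; first exact: mD.
  - move=> z _; rewrite patchE; case: ifPn => _; last exact: lexx.
    by rewrite lee_fin mulr_ge0 ?powR_ge0 ?(ltW c0).
  - apply: measurable_funTS; apply/(measurable_restrictT _ (mAr rho)).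
    by apply/measurable_EFinP; exact: measurable_funM.
  - apply/measurable_EFinP; apply: measurable_funM; first exact: mg.
    exact: measurable_funTS.
  move=> z _; rewrite /g !patchE; case: ifPn => [/[!inE] -[Az _]|_]; last by rewrite mul0r.
  have [/andP[l0 _] lphi] := Al z Az; rewrite -EFinM lee_fin.
  apply: le_trans (ler_wpM2l (powR_ge0 _ _) lphi).
  rewrite mulrCA ler_pM2l// -powRD; last by rewrite (gt_eqF l0) implybT.
  by rewrite opprD -addrA addNr addr0.
have IE rho : 0 < rho -> exists2 i, 0 <= i & I rho = i%:E.
  move=> rho0; exists (fine (I rho)); last first.
    by rewrite fineK// ge0_fin_numE ?Ifin//; apply: integral_ge0 => z _; rewrite lee_fin powR_ge0.
  by rewrite fine_ge0//; apply: integral_ge0 => z _; rewrite lee_fin powR_ge0.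
have unbounded Y : ~ (forall rho i, 0 < rho -> 0 <= i -> I rho = i%:E -> i <= Y).
  move=> h; have [rho rho0] := divg (Y + 1); have [i i0 iE] := IE rho rho0.
  rewrite -/(Ar rho) -/(I rho) iE lee_fin => Yi.
  by have := h rho i rho0 i0 iE; lra.
split=> [p1E|pgt1].
- rewrite leNgt; apply/negP => lam0; have Zfin := lamfin lam0.
  set Z := (\int[mu]_(z in A) _)%E in Zfin.
  have Z0 : (0 <= Z)%E by apply: integral_ge0 => z _; rewrite lee_fin powR_ge0.
  apply: (unbounded (c^-1 * (C * fine Z))) => rho i rho0 i0 iE.
  have lE : (\int[mu]_(z in Ar rho) (l z `^ (- (kap + lam) * p))%:E <= Z)%E.
    rewrite p1E mulr1 opprD; apply: ge0_subset_integral => //.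
    - exact/measurable_EFinP.
    - by move=> z _; rewrite lee_fin powR_ge0.
    - exact: subIsetl.
  have := testA rho rho0 (le_lt_trans lE Zfin).
  rewrite iE {1}p1E -EFinM poweRe1 ?lee_fin ?mulr_ge0 ?(ltW c0)// => h.
  have {}h : ((c * i)%:E <= (C * fine Z)%:E)%E.
    apply: (le_trans h); rewrite [leRHS]EFinM lee_wpmul2l ?lee_fin//.
    by rewrite fineK ?ge0_fin_numE.
  by rewrite lee_fin in h; rewrite -ler_pdivrMl ?invr_gt0// invrK.
rewrite ltNge; apply/negP => bad.
have p10 : 0 < p - 1 by rewrite subr_gt0.
pose Y := (C / c `^ p) `^ (p - 1)^-1.
apply: (unbounded Y) => rho i rho0 i0 iE; rewrite leNgt; apply/negP => Yi.
have lE : (\int[mu]_(z in Ar rho) (l z `^ (- (kap + lam) * p))%:E <= I rho)%E.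
  apply: ge0_le_integral => //.
  - by move=> z _; rewrite lee_fin powR_ge0.
  - exact/measurable_EFinP.
  - exact/measurable_EFinP.
  move=> z [Az _]; have [l01 _] := Al z Az.
  by rewrite lee_fin ger_powR// mulNr lerN2 mulrC.
have := testA rho rho0 (le_lt_trans lE (Ifin rho rho0)).
rewrite iE -EFinM poweR_EFin => h.
have {}h : (c * i) `^ p <= C * i.
  by rewrite -lee_fin; apply: (le_trans h); rewrite EFinM -iE lee_wpmul2l ?lee_fin.
have i1 : 0 < i by apply: le_lt_trans Yi; exact: powR_ge0.
move: h; rewrite powRM ?(ltW c0)// -(mulr_powRB1 i0 p0) mulrCA [C * i]mulrC ler_pM2l//.
rewrite -ler_pdivlMl ?powR_gt0// [_^-1 * C]mulrC leNgt => /negP; apply.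
have -> : C / c `^ p = Y `^ (p - 1).
  by rewrite /Y -powRrM mulVf ?gt_eqF// powRr1// divr_ge0 ?powR_ge0.
by rewrite gt0_ltr_powR ?nnegrE// powR_ge0.
Qed.

Definition near1 h : set (plane R) := disc R `&` [set w | cmod (1 - cplx w) <= h].

Lemma measurable_near1 h : measurable (near1 h).
Proof.
apply: measurableI => //; apply: measurable_le_set => //.
rewrite (_ : (fun _ => _) = kdist ((1 : R), (0 : R))); first exact: measurable_kdist.
apply/funext => w; rewrite /kdist (_ : cplx ((1 : R), (0 : R)) = 1)// mul1r !cmodE/=.
by congr Num.sqrt; ring.
Qed.

Lemma mu_near1_gt0 h : 0 < h -> h <= 4^-1 -> (0 < mu (near1 h))%E.
Proof.
move=> h0 h4; have mU := measurable_near1 h.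
apply: (@mu_disc_gt0_rect _ _ _ a1 b1 _ (1 - h / 2) (1 - h / 4) (h / 4)) => //.
- by move=> w [].
- lra.
- lra.
move=> z /andP[x1 x2] /andP[y1 y2].
split.
  rewrite /disc /preimage/mkset /unit_disc/mkset.
  rewrite -(@ltr_pXn2r _ 2) ?nnegrE ?cmod_ge0// expr1n sqr_cmod_cplx; nra.
apply: le_trans (cmod_le_ReIm _) _; rewrite /= sub0r normrN gtr0_norm; last lra.
by rewrite ger0_norm//; lra.
Qed.

(** The borderline case on L^1, where the kernel has the size of the Bergman
    kernel: the image of a normalized bump at 1 is of size (1 - Re z)^-(2 + a)
    in a cone at 1, down to the scale of the bump. By [divergence_cone] the norm
    of this image tends to infinity as the bump shrinks. *)
Lemma alpha_neq_a : p = 1 -> alpha <> a.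
Proof.
move=> p1E aE; have [_ _ [_ [c [r [eta [c0 r0 eta0 cP]]]] _]] := hreg.
have [C C0 Cle] := bounded_test.
have a10 : 0 < a + 1 by rewrite -ltrBlDr sub0r.
have s0 : 0 < 2 + a by lra.
pose et := Num.min (eta / 4) 4^-1; pose t := Num.min (r / 4) 4^-1.
have et0 : 0 < et by rewrite lt_min invr_gt0 ltr0n divr_gt0.
have et4 : et <= 4^-1 by rewrite ge_min lexx orbT.
have ete : et <= eta / 4 by rewrite ge_min lexx.
have t0 : 0 < t by rewrite lt_min invr_gt0 ltr0n divr_gt0.
have t4 : t <= 4^-1 by rewrite ge_min lexx orbT.
have t2r : 2 * t < r.
  have : t <= r / 4 by rewrite ge_min lexx.
  lra.
have [eps eps0 div] := @divergence_cone R a b a1 b1 et t et0 et4 t0 t4.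
pose ga := 2 * beta - 2 * b - m%:R.
pose c1 := c * 2 `^ (- (2 + a)) * 2 `^ (- `|ga|).
have c10 : 0 < c1 by rewrite !mulr_gt0 ?powR_gt0.
suff bound N : N%:R * eps <= C / c1.
  have := bound (Num.truncn (C / c1 / eps)).+1; apply/negP; rewrite -ltNge.
  by rewrite -ltr_pdivrMr// truncnS_gt.
(* for w in a bump of this radius and z in the first N layers, z w^* differs
   from z by at most et (1 - Re z) *)
pose h := et * (t * 2^-1 ^+ N).
have tN : 0 < t * 2^-1 ^+ N by rewrite mulr_gt0// exprn_gt0// invr_gt0.
have h0 : 0 < h by rewrite mulr_gt0.
have tN4 : t * 2^-1 ^+ N <= 4^-1.
  apply: le_trans t4; rewrite ler_piMr ?(ltW t0)//.
  by rewrite exprn_ile1 ?invr_ge0// invf_le1 ?ler1n.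
have h4 : h <= 4^-1 by rewrite /h; nra.
pose U := near1 h.
have mU : measurable U := measurable_near1 h.
have UD : U `<=` disc R by move=> w [].
have U0 : (0 < mu U)%E by exact: mu_near1_gt0.
have Ufin : (mu U < +oo)%E.
  by apply: le_lt_trans disc_lty; apply: le_measure; rewrite ?inE.
have UE : mu U = (fine (mu U))%:E by rewrite fineK// gt0_fin_numE.
have u0 : 0 < fine (mu U) by rewrite fine_gt0// U0.
pose g w := (\1_U w : R).
have mg : measurable_fun (disc R) g by apply: measurable_funTS; exact: measurable_indic.
have g0 w : disc R w -> 0 <= g w by [].
have gp : (\int[mu]_(w in disc R) (g w `^ p)%:E = mu U)%E.
  rewrite p1E; under eq_integral do rewrite powRr1//.
  by rewrite integral_indic// setIidl.
have := Cle g mg g0; rewrite gp => /(_ Ufin)[aei [mk kle]].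
have J : ((2 `^ (- `|ga|))%:E * mu U <= \int[mu]_(w in disc R) (g w * Phi w)%:E)%E.
  rewrite -(integral_cst _ mU) -{1}(setIidr UD) integral_mkcondr.
  apply: ge0_le_integral => //.
  - by move=> w _; rewrite patchE; case: ifPn => // _; rewrite lee_fin powR_ge0.
  - by apply: measurable_funTS; apply/(measurable_restrictT _ mU); exact: measurable_cst.
  - by apply/measurable_EFinP; apply: measurable_funM => //; exact: measurable_funTS.
  move=> w wD; rewrite patchE /g indicE; case: ifPn => [/[!inE] -[_ wU]|_]; last first.
    by rewrite mul0r.
  have wh : cmod (1 - cplx w) <= h by exact: wU.
  rewrite mul1r lee_fin /phi /radial aE subrr powRr0 mulr1.
  apply: powR_half_one_ge; last exact: ltW.
  have : 1 <= cmod (1 - cplx w) + nz w.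
    by rewrite -[leLHS]cmod1 -[X in cmod X](subrK (cplx w)) cmodD.
  lra.
pose V := cone1 et t `&` [set z | t * 2^-1 ^+ N <= 1 - (z.1 : R)].
have mx1 : measurable_fun setT (fun z : plane R => 1 - (z.1 : R)).
  by apply: measurable_funB => //; exact: measurable_fst.
have mV : measurable V.
  apply: measurableI; first exact: measurable_cone1.
  exact: measurable_ge_set.
have VD : V `<=` disc R by move=> z [/(cone1_bounds et0 et4 t4)[/pdisc_disc]].
have Klow z w : V z -> U w -> c * (2 * (1 - (z.1 : R))) `^ (- (2 + a)) <=
    complex.Re (K (cplx z * (cplx w)^*)).
  move=> [zc /= zN] [wD wU]; have zD := VD _ (conj zc zN).
  have wh : cmod (1 - cplx w) <= h by exact: wU.
  have xi1 := pairing_disc zD wD.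
  case: zc => -[/= y0 yl] [/= x0 xt].
  have dlh : cmod (cplx z * (1 - cplx w)^*) <= et * (1 - (z.1 : R)).
    apply: (@le_trans _ _ h); last by rewrite /h ler_pM2l.
    by apply: le_trans wh; rewrite cmodM cmod_conj ler_piMl ?cmod_ge0//; exact: ltW.
  have xiE : cplx z * (cplx w)^* = cplx z - cplx z * (1 - cplx w)^*.
    by rewrite rmorphB rmorph1 mulrBr mulr1 subKr.
  have [k2 cone] : cmod (1 - cplx z * (cplx w)^*) <= 2 * (1 - (z.1 : R)) /\
      `|complex.Im (cplx z * (cplx w)^*)| <=
        eta * (1 - complex.Re (cplx z * (cplx w)^*)).
    have y01 : 0 <= complex.Im (cplx z) <= et * (1 - complex.Re (cplx z)) by rewrite y0.
    by rewrite xiE; exact: (@cone_perturbation _ eta et (cplx z)).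
  have xr : 2 * (1 - (z.1 : R)) < r by apply: le_lt_trans t2r; rewrite ler_pM2l.
  apply: le_trans (cP _ xi1 (or_intror _) cone); last exact: le_lt_trans xr.
  rewrite aE ler_pM2l// !powRN lef_pV2 ?posrE ?powR_gt0 ?mulr_gt0 ?(kdist_gt0 zD wD)//.
  by rewrite ge0_ler_powR ?nnegrE ?cmod_ge0 ?(ltW s0) ?mulr_ge0 ?(ltW x0).
have low : ((c1 * fine (mu U))%:E * (N%:R * eps)%:E <= C%:E * mu U)%E.
  apply: le_trans kle; rewrite p1E.
  apply: le_trans (lee_wpmul2l _ (div N)) _; first by rewrite lee_fin mulr_ge0 ?(ltW c10) ?(ltW u0).
  rewrite -/V -ge0_integralZl_EFin//; last 3 first.
  - by move=> z _; rewrite lee_fin powR_ge0.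
  - by apply/measurable_EFinP; apply: measurable_funTS; exact: measurable_fun_powR.
  - by rewrite mulr_ge0 ?(ltW c10) ?(ltW u0).
  rewrite p1E in mk.
  apply: (@le_trans _ _ (\int[mu]_(z in V) (cmod (T (test g) z) `^ 1)%:E)%E); last first.
    apply: ge0_subset_integral => //; first exact/measurable_EFinP.
    by move=> z _; rewrite lee_fin powR_ge0.
  apply: ae_ge0_le_integral => //.
  - by move=> z _; rewrite -EFinM lee_fin mulr_ge0 ?powR_ge0// mulr_ge0 ?(ltW c10) ?(ltW u0).
  - under eq_fun do rewrite -EFinM.
    apply/measurable_EFinP; apply: measurable_funM => //.
    by apply: measurable_funTS; exact: measurable_fun_powR.
  - by move=> z _; rewrite lee_fin powR_ge0.
  - by apply/measurable_EFinP; exact: measurable_funS mk.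
  apply: filterS aei => z iz zV; have zD := VD z zV.
  have [zpD _ _ _] := cone1_bounds et0 et4 t4 zV.1.
  have x0 : 0 < 1 - (z.1 : R) by case: zV => -[_ []].
  rewrite powRr1 ?cmod_ge0//.
  have kl := @kop_lower g z _ mg g0 zD (_ : 0 <= c * (2 * (1 - (z.1 : R))) `^ (- (2 + a))) _ (iz zD).
  apply: le_trans (kl _ _); last 2 first.
  - by rewrite mulr_ge0 ?powR_ge0 ?(ltW c0).
  - move=> w wD; rewrite /g indicE; case: (boolP (w \in U)) => [/[!inE] wU _|_]; last by rewrite ltxx.
    exact: Klow.
  apply: le_trans (lee_wpmul2l _ J); last first.
    by rewrite lee_fin !mulr_ge0 ?powR_ge0 ?(ltW c0)// invr_ge0 exprn_ge0 ?cmod_ge0.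
  rewrite UE -!EFinM lee_fin powRM ?(ltW x0)// /c1.
  set X := (1 - _) `^ _; set u := fine _.
  rewrite [leLHS](_ : _ = 1 * (c * (2 `^ (- (2 + a)) * X) * (2 `^ (- `|ga|) * u))); last by ring.
  rewrite -[leRHS]mulrA ler_wpM2r ?mulr_ge0 ?powR_ge0 ?(ltW u0) ?(ltW c0)//.
  by rewrite invf_ge1 ?exprn_gt0 ?pdisc_gt0// exprn_ile1 ?cmod_ge0// ltW.
rewrite ler_pdivlMr//.
move: low; rewrite UE -!EFinM lee_fin.
by rewrite mulrAC ler_pM2r// mulrC.
Qed.

Lemma phi_ge z : pdisc z ->
  (nz z <= 2^-1 -> 2 `^ (- `|alpha - a|) * nz z `^ (2 * beta - 2 * b - m%:R) <= Phi z) /\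
  (2^-1 <= nz z -> 2 `^ (- `|2 * beta - 2 * b - m%:R|) *
     (1 - nz z ^+ 2) `^ (alpha - a) <= Phi z).
Proof.
move=> zD; split=> z2.
  rewrite mulrC ler_wpM2l ?powR_ge0//; apply: powR_half_one_ge; last exact: one_sub_sqr_le1.
  have : nz z ^+ 2 <= 2^-1 ^+ 2 by rewrite ler_pXn2r ?nnegrE ?cmod_ge0.
  lra.
rewrite ler_wpM2r ?powR_ge0//; apply: powR_half_one_ge => //.
exact: ltW (pdisc_disc zD).
Qed.

(** [layer_exponents] with l = |z| near the origin, where kap = 2 b + 2, and with
    l = 1 - |z|^2 near the circle, where kap = a + 1. *)
Lemma exponents_of_kop_bounded : exponent_condition a b alpha beta m p.
Proof.
have a10 : 0 < a + 1 by rewrite -ltrBlDr sub0r.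
have b10 : 0 < b + 1 by rewrite -ltrBlDr sub0r.
have b20 : 0 < 2 * b + 2 by lra.
have oe := origin_exponent.
have [z1 z2] : (p = 1 -> 0 <= 2 * beta - 2 * b - m%:R) /\
    (1 < p -> 2 * b + 2 < p * (2 * b + 2 + (2 * beta - 2 * b - m%:R))).
  apply: (@layer_exponents (near0 2^-1) (fun z => nz z) _ _ (2 `^ (- `|alpha - a|))) => //.
  - exact: measurable_near0.
  - by move=> z [].
  - exact: measurable_cmod_cplx.
  - move=> z [zD /= zd]; split; last by have [+ _] := phi_ge zD; apply; exact: ltW.
    by rewrite pdisc_gt0//= ltW//; apply: pdisc_disc zD.
  - move=> B; apply: divergence_origin => //; by rewrite invr_gt0.
  - move=> lam0; apply: (@mu_radial_sub_lty (- (2 * b + 2) - (2 * beta - 2 * b - m%:R)) 0).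
    + by lra.
    + by rewrite add0r.
    + exact: measurable_near0.
    + by move=> z [/pdisc_disc].
    + by move=> z; rewrite /radial powRr0 mulr1.
pose A : set (plane R) := @pdisc R `&` [set z | 2^-1 <= nz z].
have mA : measurable A.
  by apply: measurableI => //; apply: measurable_ge_set; exact: measurable_cmod_cplx.
have [c1 c2] : (p = 1 -> 0 <= alpha - a) /\ (1 < p -> a + 1 < p * (a + 1 + (alpha - a))).
  apply: (@layer_exponents A (fun z => 1 - nz z ^+ 2) _ _
    (2 `^ (- `|2 * beta - 2 * b - m%:R|))) => //.
  - by move=> z [].
  - exact: measurable_one_sub_sqr.
  - move=> z [zD /= zd]; split; last by have [_] := phi_ge zD; apply.
    by rewrite one_sub_sqr_le1 one_sub_sqr_gt0//; apply: pdisc_disc zD.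
  - by move=> B; exact: divergence_boundary.
  - move=> lam0; apply: (@mu_radial_sub_lty 0 (- (a + 1) - (alpha - a))) => //.
    + by lra.
    + by lra.
    + by move=> z [/pdisc_disc].
    + by move=> z; rewrite /radial powRr0 mul1r.
split; last first.
  split=> [pE|pgt1]; last by have := z2 pgt1; lra.
  by move: (z1 pE) oe; rewrite pE; lra.
move: p1; rewrite le_eqVlt => /predU1P[pE|pgt1]; last by have := c2 pgt1; lra.
have aa : a < alpha.
  rewrite lt_neqAle -subr_ge0 c1// andbT eq_sym; apply/eqP.
  exact: alpha_neq_a.
rewrite -pE; lra.
Qed.

End bounded.
End necessity.

(** * The operators A and B *)

Section operators.
Variable R : realType.
Implicit Types (f : plane R -> R[i]) (z w : plane R).
Local Notation nz z := (cmod (cplx z)).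

Lemma Q_regular_eq (q q' : R[i] -> R[i]) :
  (forall xi, cmod xi < 1 -> q' xi = q xi) -> Q_regular q -> Q_regular q'.
Proof.
move=> qq [[C Cle] [c [r [c0 r0 cr]]] [mR mI]]; split.
- by exists C => xi xi1; rewrite qq//; exact: Cle.
- by exists c, r; split=> // xi xi1; rewrite qq//; exact: cr.
- have E u : u \in @disc2 R -> (q \o @pairing R) u = (q' \o @pairing R) u.
    by move=> /[!inE] -[u1 u2]; rewrite /= qq//; exact: pairing_disc.
  split; [apply: eq_measurable_fun mR|apply: eq_measurable_fun mI];
    by move=> u /E ->.
Qed.

Variables (a b alpha beta : R) (m : nat).

Definition phase w : R[i] := cplx w ^+ m / (nz w ^+ m)%:C.

Lemma A_integrandE : A_integrand a b alpha beta m =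
  kop_integrand a b alpha beta m phase
    (fun xi => Q alpha beta xi / cpow (1 - xi) (2 + alpha)).
Proof.
apply/funext => f; apply/funext => z; apply/funext => w.
rewrite /A_integrand /kop_integrand /phase /phi /radial.
set xi := cplx z * _; set u := 1 - xi; set om := cplx w.
have CM (x y : R) : (x * y)%:C = x%:C * y%:C :> R[i] by rewrite rmorphM.
have E : om ^+ m / (cmod om `^ (2 * m%:R + 2 * b - 2 * beta))%:C =
    om ^+ m / (cmod om ^+ m)%:C * (cmod om `^ (2 * beta - 2 * b - m%:R))%:C.
  (* at om = 0 the powers of the modulus do not combine, but both sides vanish
     for m > 0 *)
  have [om0|om0] := eqVneq om 0.
    case: m => [|n]; last by rewrite om0 expr0n/= !mul0r.
    rewrite !expr0 (_ : 1%:C = 1 :> R[i])// divr1 !mul1r -fmorphV -powRN.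
    by congr (_ `^ _)%:C; ring.
  have r0 : 0 < cmod om by rewrite lt_neqAle cmod_ge0 eq_sym cmod_eq0 om0.
  rewrite -mulrA; congr (_ * _).
  rewrite -!fmorphV -CM; congr (_%:C).
  rewrite -powRN -[cmod om ^+ m]powR_mulrn ?cmod_ge0// -powRN -powRD; last first.
    by rewrite (gt_eqF r0) implybT.
  by congr (_ `^ _); ring.
rewrite (CM (cmod om `^ _)) invfM.
transitivity (f w * Q alpha beta xi * ((1 - cmod om ^+ 2) `^ (alpha - a))%:C *
  (om ^+ m / (cmod om `^ (2 * m%:R + 2 * b - 2 * beta))%:C) / cpow u (2 + alpha)).
  by rewrite !mulrA.
rewrite E.
by ring.
Qed.

Lemma B_integrandE : B_integrand a b alpha beta m =
  kop_integrand a b alpha beta m (fun=> 1)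
    (fun xi => (cmod (Q alpha beta xi) / cmod (1 - xi) `^ (2 + alpha))%:C).
Proof.
apply/funext => f; apply/funext => z; apply/funext => w.
rewrite /B_integrand /kop_integrand /phi /radial mulr1.
have CM (x y : R) : (x * y)%:C = x%:C * y%:C :> R[i] by rewrite rmorphM.
rewrite -[RHS]mulrA -CM; congr (_ * _%:C).
by rewrite /=; ring.
Qed.

Hypotheses (a1 : -1 < a) (b1 : -1 < b) (al1 : -1 < alpha) (be1 : -1 < beta).
Variable beta0 : R.
Hypotheses (betaE : beta = beta0 + m%:R) (b0N1 : -1 < beta0) (b00 : beta0 <= 0).

Let Qreg : Q_regular (Q alpha beta).
Proof.
have [q qreg qE] := Q_regularP al1 be1 betaE b0N1 b00.
exact: Q_regular_eq qE qreg.
Qed.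

Let mcplx : cmeas (disc R) (@cplx R).
Proof. by apply: cmeas_cplx; exact: measurable_id. Qed.

Lemma kop_regular_A : kop_regular alpha m (fun z => (cplx z ^+ m)^-1) phase
  (fun xi => Q alpha beta xi / cpow (1 - xi) (2 + alpha)).
Proof.
have phaseE w : cmod (phase w) = nz w ^+ m / nz w ^+ m.
  by rewrite /phase cmodM cmodX cmodV cmod_real ger0_norm// exprn_ge0// cmod_ge0.
split.
- split; first by apply: cmeasV; exact: cmeasX.
  by move=> z; rewrite cmodV cmodX.
- split.
  + apply: cmeasM; first exact: cmeasX.
    apply: cmeasV; apply: cmeas_real.
    apply: measurable_funX.
    by apply: measurable_funTS; exact: measurable_cmod_cplx.
  + move=> w; rewrite phaseE; have [->|h] := eqVneq (nz w ^+ m) 0.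
      by rewrite mul0r.
    by rewrite divff.
  + by move=> w wD; rewrite phaseE divff// gt_eqF// exprn_gt0// pdisc_gt0.
- exact: kernel_regular_cpow.
Qed.

Lemma kop_regular_B : kop_regular alpha m (fun z => ((nz z ^+ m)^-1)%:C) (fun=> 1)
  (fun xi => (cmod (Q alpha beta xi) / cmod (1 - xi) `^ (2 + alpha))%:C).
Proof.
have n0 z : 0 <= nz z ^+ m by rewrite exprn_ge0// cmod_ge0.
split.
- split; last by move=> z; rewrite cmod_real ger0_norm// invr_ge0.
  apply: cmeas_real; apply: measurable_fun_inv => //.
  apply: measurable_funX.
  by apply: measurable_funTS; exact: measurable_cmod_cplx.
- by split; [exact: cmeas_cst|move=> w; rewrite cmod1|move=> w _; rewrite cmod1].
- exact: kernel_regular_cmod.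
Qed.

Let kop_bounded_iff p k e K : 1 <= p -> kop_regular alpha m k e K ->
  kop_bounded a b alpha beta m k e K p <-> exponent_condition a b alpha beta m p.
Proof.
move=> p1 hreg; split; first exact: exponents_of_kop_bounded.
by apply: kop_bounded_of_exponents => //; rewrite betaE addrK.
Qed.

Lemma A_bounded_iff p : 1 <= p ->
  A_bounded a b alpha beta m p <-> exponent_condition a b alpha beta m p.
Proof.
move=> p1; rewrite -(kop_bounded_iff p1 kop_regular_A).
by rewrite /A_bounded /kop_bounded /kop /opA A_integrandE.
Qed.

Lemma B_bounded_iff p : 1 <= p ->
  B_bounded a b alpha beta m p <-> exponent_condition a b alpha beta m p.
Proof.
move=> p1; rewrite -(kop_bounded_iff p1 kop_regular_B).
by rewrite /B_bounded /kop_bounded /kop /opB B_integrandE.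
Qed.

End operators.

Theorem theorem1 (R : realType) (a b alpha beta beta0 p : R) (m : nat)
    (ha : -1 < a) (hb : -1 < b) (halpha : -1 < alpha) (hbeta : -1 < beta)
    (hm : beta = beta0 + m%:R) (hJ : J_set alpha beta0) (hp : 1 <= p) :
  (A_bounded a b alpha beta m p <-> B_bounded a b alpha beta m p) /\
  (B_bounded a b alpha beta m p <->
    p * (alpha + 1) > a + 1 /\
    (p = 1 -> m%:R - 2 < 2 * b /\ 2 * b <= 2 * beta - m%:R) /\
    (1 < p -> p * m%:R - 2 < 2 * b /\
              2 * b < p * (2 * beta + 2) - p * m%:R - 2)).
Proof.
have [/andP[b0N1 b00] _] := hJ.
have iffA := A_bounded_iff ha hb halpha hbeta hm b0N1 b00 hp.
have iffB := B_bounded_iff ha hb halpha hbeta hm b0N1 b00 hp.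
by split; [rewrite iffA iffB|exact: iffB].
Qed.
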